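(* Let $n\ge2$, let $\ell\ge1$ and $a$ be integers with $\ell<a-1$, and let $i,j\ge0$ be integers with $i+j\le\ell$ and $2\mid \ell-(i+j)$. Put $p_\ell^{i,j}=h_{\{-\ell\},\{a^n\}}^{\{a+i,a^{n-2},a-j\}}$. Then $$p_\ell^{i,j}=\begin{cases} q^{(\ell+i-2)n-\frac{\ell+i+j}{2}+1}[n][n-1](q-1)^2 & i,j\ge1,\ i+j<\ell,\\ q^{(\ell+i-2)n-\ell+2}[n][n-1](q-1) & i,j\ge1,\ i+j=\ell,\\ q^{(2\ell-1)n-(\ell-1)}[n] & j=0,\ i=\ell,\\ q^{(\ell+i-1)n-\frac{\ell+i}{2}}[n](q-1) & j=0,\ i<\ell,\\ q^{(\ell-1)n-(\ell-1)}[n] & i=0,\ j=\ell,\\ q^{(\ell-1)n-\frac{\ell+j}{2}}[n](q-1) & i=0,\ j<\ell,\\ q^{(\ell-1)n-\frac{\ell}{2}}[n](q-1) & i=j=0. \end{cases}$$ Moreover $p_\ell^{i,j}=q^{(i-j)n}p_\ell^{j,i}$.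
   Context: $k$ is a finite field with $q$ elements, $\mathrm{char}(k)\neq2$; $[m]=\frac{q^m-1}{q-1}$. Let $N=2n$, $G=\mathrm{GL}_N(k((z)))$, $K=\mathrm{GL}_N(k[[z]])$, $H=\mathrm{GL}_N(k((z^2)))$, with Haar measure on $G$ giving $K$ measure $1$. All partitions are decreasing integer sequences of length $N=2n$, with zeros omitted in the notation: $\{-\ell\}$ is $(0^{2n-1},-\ell)$, $\{a^n\}$ is $(a^n,0^n)$, and $\{a+i,a^{n-2},a-j\}$ is $(a+i,a^{n-2},a-j,0^n)$. For $\mu$ a decreasing integer sequence, $\pi^\mu=\mathrm{diag}(z^{\mu_N},\dots,z^{\mu_1})$ and $c_\mu$ is the characteristic function of $K\pi^\mu K$. For a partition $\lambda$ of length $N$ with nonnegative entries and $m_0(\lambda)\ge\sum_{i>1}m_i(\lambda)$ ($m_i$ = number of entries equal to $i$), $\Pi^\lambda$ is the block diagonal matrix having one block $\begin{pmatrix}1&z\\0&z^i\end{pmatrix}$ for each entry $i>1$ of $\lambda$, $m_1(\lambda)$ blocks $(z)$ and $m_0(\lambda)-\sum_{i>1}m_i(\lambda)$ blocks $(1)$, in nondecreasing order of valuation; $d_\lambda$ is the characteristic function of $K\Pi^\lambda H$. With $(f\times g)(x)=\int_G g(y^{-1}x)f(y)\,dy$, the structure constants are $h_{\mu\nu}^\lambda=(c_\mu\times d_\lambda)(\Pi^\nu)$, i.e. $c_\mu\times d_\lambda=\sum_\nu h_{\mu\nu}^\lambda d_\nu$. *)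

(* Defs.v *)
From HB Require Import structures.
From mathcomp Require Import all_boot all_order all_algebra.
From mathcomp Require Import all_classical all_reals all_analysis.

Set Implicit Arguments.
Unset Strict Implicit.
Unset Printing Implicit Defensive.

Import Order.TTheory GRing.Theory Num.Theory.

Local Open Scope classical_set_scope.
Local Open Scope ring_scope.

(** * The ring [k[[z]]] *)

Record fpseries (k : fieldType) := FPSeries { fps_coef : nat -> k }.

Section FPSeries.
Variable k : fieldType.
Local Notation S := (fpseries k).
Implicit Types f g h : S.

Lemma fpsP f g : fps_coef f =1 fps_coef g -> f = g.
Proof. by case: f => f; case: g => g /= /funext ->. Qed.

HB.instance Definition _ := gen_eqMixin S.
HB.instance Definition _ := gen_choiceMixin S.

Definition fps_zero : S := FPSeries (fun=> 0).
Definition fps_opp f : S := FPSeries (fun i => - fps_coef f i).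
Definition fps_add f g : S := FPSeries (fun i => fps_coef f i + fps_coef g i).

Lemma fps_addA : associative fps_add.
Proof. by move=> f g h; apply: fpsP => i /=; rewrite addrA. Qed.
Lemma fps_addC : commutative fps_add.
Proof. by move=> f g; apply: fpsP => i /=; rewrite addrC. Qed.
Lemma fps_add0 : left_id fps_zero fps_add.
Proof. by move=> f; apply: fpsP => i /=; rewrite add0r. Qed.
Lemma fps_addN : left_inverse fps_zero fps_opp fps_add.
Proof. by move=> f; apply: fpsP => i /=; rewrite addNr. Qed.

HB.instance Definition _ :=
  GRing.isZmodule.Build S fps_addA fps_addC fps_add0 fps_addN.

Definition fps_one : S := FPSeries (fun i => (i == 0%N)%:R).
Definition fps_mul f g : S :=
  FPSeries (fun n => \sum_(i < n.+1) fps_coef f i * fps_coef g (n - i)).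

Definition fps_trunc (n : nat) f : {poly k} := \poly_(i < n.+1) fps_coef f i.

Lemma fps_coef_trunc f m n : (m <= n)%N -> (fps_trunc n f)`_m = fps_coef f m.
Proof. by move=> mn; rewrite coef_poly ltnS mn. Qed.

Lemma fps_mul_trunc f g m n : (m <= n)%N ->
  fps_coef (fps_mul f g) m = (fps_trunc n f * fps_trunc n g)`_m.
Proof.
move=> mn; rewrite coefM /=; apply: eq_bigr => i _.
rewrite !fps_coef_trunc //; first exact: leq_trans (leq_subr _ _) mn.
by rewrite (leq_trans _ mn) // -ltnS.
Qed.

Lemma fps_mulA : associative fps_mul.
Proof.
move=> f g h; apply: fpsP => n.
transitivity (fps_trunc n f * (fps_trunc n g * fps_trunc n h))`_n.
  rewrite (fps_mul_trunc _ _ (leqnn n)) !coefM; apply: eq_bigr => i _.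
  by rewrite (fps_coef_trunc _ (leq_subr _ _)) (fps_mul_trunc _ _ (leq_subr i n)).
rewrite mulrA (fps_mul_trunc _ _ (leqnn n)) !coefM; apply: eq_bigr => i _.
have ile : (i <= n)%N by rewrite -ltnS.
by rewrite (fps_coef_trunc _ ile) (fps_mul_trunc _ _ ile).
Qed.

Lemma fps_mulC : commutative fps_mul.
Proof.
by move=> f g; apply: fpsP => n; rewrite !(fps_mul_trunc _ _ (leqnn n)) mulrC.
Qed.

Lemma fps_mul1 : left_id fps_one fps_mul.
Proof.
move=> f; apply: fpsP => n /=.
rewrite big_ord_recl /= mul1r subn0 big1 ?addr0 // => i _.
by rewrite mul0r.
Qed.

Lemma fps_mulDl : left_distributive fps_mul fps_add.
Proof.
move=> f g h; apply: fpsP => n /=; rewrite -big_split /=.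
by apply: eq_bigr => i _; rewrite mulrDl.
Qed.

Lemma fps_one_neq0 : fps_one != 0.
Proof.
apply/eqP => /(congr1 (fun f => fps_coef f 0)) /= /eqP.
by rewrite oner_eq0.
Qed.

HB.instance Definition _ := GRing.Zmodule_isComNzRing.Build S
  fps_mulA fps_mulC fps_mul1 fps_mulDl fps_one_neq0.

Definition fps_unit : pred S := fun f => `[< exists g, g * f = 1 >].
Definition fps_inv f : S :=
  if pselect (exists g, g * f = 1) is left P then projT1 (cid P) else f.

Lemma fps_mulV : {in fps_unit, left_inverse 1 fps_inv *%R}.
Proof.
move=> f /asboolP uf; rewrite /fps_inv; case: pselect => // P.
exact: projT2 (cid P).
Qed.

Lemma fps_unitP f g : g * f = 1 -> fps_unit f.
Proof. by move=> gf; apply/asboolP; exists g. Qed.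

Lemma fps_inv_out : {in [predC fps_unit], fps_inv =1 id}.
Proof.
move=> f; rewrite inE => /asboolP nuf; rewrite /fps_inv.
by case: pselect.
Qed.

HB.instance Definition _ := GRing.ComNzRing_hasMulInverse.Build S
  fps_mulV fps_unitP fps_inv_out.

Lemma fps_neq0 f : f != 0 -> exists n, fps_coef f n != 0.
Proof.
move=> f0; apply: contrapT => nf; move/eqP: f0; apply; apply: fpsP => n /=.
by apply/eqP/negPn/negP => fn; apply: nf; exists n.
Qed.

Lemma fps_mulf_eq0 f g : f * g = 0 -> (f == 0) || (g == 0).
Proof.
move=> fg; apply/norP => -[/fps_neq0 ef /fps_neq0 eg].
case: (ex_minnP ef) => a fa mina; case: (ex_minnP eg) => b gb minb.
move/(congr1 (fun h => fps_coef h (a + b))) : fg => /=.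
have la : (a < (a + b).+1)%N by rewrite ltnS leq_addr.
rewrite (bigD1 (Ordinal la)) //= addKn big1 ?addr0.
  by move/eqP; rewrite mulf_eq0 (negbTE fa) (negbTE gb).
move=> i; rewrite -val_eqE /= neq_ltn => /orP[ia|ai].
  rewrite [fps_coef f i](_ : _ = 0) ?mul0r //; apply/eqP.
  by apply: contraTT ia => /mina; rewrite -leqNgt.
rewrite [fps_coef g _](_ : _ = 0) ?mulr0 //; apply/eqP.
have : (a + b - i < b)%N by rewrite ltn_subLR ?ltn_add2r // -ltnS.
by apply: contraTT => /minb; rewrite -leqNgt.
Qed.

HB.instance Definition _ :=
  GRing.ComUnitRing_isIntegral.Build S fps_mulf_eq0.

Definition fps_z : S := FPSeries (fun i => (i == 1%N)%:R).

(** Membership in [k[[z^2]]]. *)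
Definition fps_even f : Prop := forall i, odd i -> fps_coef f i = 0.

End FPSeries.

(** * The field [k((z))], as the fraction field of [k[[z]]] *)

Notation laurent k := {fraction (fpseries k)}.
Local Notation "f %:F" := (@tofrac _ f).

Section Laurent.
Variable k : fieldType.
Implicit Types x : laurent k.

Definition lz : laurent k := (fps_z k)%:F.

Lemma lz_neq0 : lz != 0.
Proof.
rewrite tofrac_eq0; apply/eqP => /(congr1 (fun f => fps_coef f 1)) /= /eqP.
by rewrite oner_eq0.
Qed.

(** Membership in [k((z^2)) = Frac k[[z^2]]]. *)
Definition laurent_even x : Prop :=
  exists f g : fpseries k,
    [/\ fps_even f, fps_even g, g != 0 & x = f%:F / g%:F].

(** Membership in [z^m k[[z]]]. *)
Definition laurent_ge (m : nat) x : Prop :=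
  exists f : fpseries k, x = lz ^+ m * f%:F.

Lemma laurent_geW m m' x : (m <= m')%N -> laurent_ge m' x -> laurent_ge m x.
Proof.
move=> mm' [f ->]; exists (fps_z k ^+ (m' - m) * f).
by rewrite tofracM tofracXn mulrA -exprD subnKC.
Qed.

End Laurent.

(** * The group [GL_N(k((z)))] *)

Record GL (k : fieldType) (N : nat) :=
  MkGL { GLmx :> 'M[laurent k]_N; GLmx_unit : GLmx \in unitmx }.

Section GLgroup.
Variables (k : fieldType) (N : nat).
Local Notation G := (GL k N).
Implicit Types g h : G.

HB.instance Definition _ := [isSub for @GLmx k N].
HB.instance Definition _ := [Choice of G by <:].

Lemma GL_mul_unit g h : GLmx g *m GLmx h \in unitmx.
Proof. by rewrite unitmx_mul !GLmx_unit. Qed.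
Lemma GL_inv_unit g : invmx (GLmx g) \in unitmx.
Proof. by rewrite unitmx_inv GLmx_unit. Qed.

Definition GL_one : G := MkGL (unitmx1 _ N).
Definition GL_mul g h : G := MkGL (GL_mul_unit g h).
Definition GL_inv g : G := MkGL (GL_inv_unit g).

Lemma GL_mulA : associative GL_mul.
Proof. by move=> f g h; apply: val_inj; rewrite /= mulmxA. Qed.
Lemma GL_mul1g : left_id GL_one GL_mul.
Proof. by move=> g; apply: val_inj; rewrite /= mul1mx. Qed.
Lemma GL_mulg1 : right_id GL_one GL_mul.
Proof. by move=> g; apply: val_inj; rewrite /= mulmx1. Qed.
Lemma GL_mulVg : left_inverse GL_one GL_inv GL_mul.
Proof. by move=> g; apply: val_inj; rewrite /= mulVmx ?GLmx_unit. Qed.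
Lemma GL_mulgV : right_inverse GL_one GL_inv GL_mul.
Proof. by move=> g; apply: val_inj; rewrite /= mulmxV ?GLmx_unit. Qed.

HB.instance Definition _ :=
  isGroup.Build G GL_mulA GL_mul1g GL_mulg1 GL_mulVg GL_mulgV.
HB.instance Definition _ := isPointed.Build G GL_one.

(** The topology induced by the [z]-adic topology on the matrix entries. *)
Definition GL_open (U : set G) : Prop :=
  forall g, U g -> exists m : nat,
    forall h, (forall i j, laurent_ge m (GLmx h i j - GLmx g i j)) -> U h.

Lemma GL_openT : GL_open setT.
Proof. by move=> g _; exists 0%N. Qed.

Lemma GL_openI (U V : set G) : GL_open U -> GL_open V -> GL_open (U `&` V).
Proof.
move=> oU oV g [/oU[m mU] /oV[m' mV]]; exists (maxn m m') => h gh.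
split; [apply: mU|apply: mV] => i j; apply: laurent_geW (gh i j).
  exact: leq_maxl.
exact: leq_maxr.
Qed.

Lemma GL_open_bigU (I : Type) (f : I -> set G) :
  (forall i, GL_open (f i)) -> GL_open (\bigcup_i f i).
Proof.
move=> of_ g [i _ /of_[m mf]]; exists m => h gh.
by exists i => //; exact: mf.
Qed.

HB.instance Definition _ :=
  isOpenTopological.Build G GL_openT GL_openI GL_open_bigU.

(** [GL_N(k[[z]])] *)
Definition GL_K : set G :=
  [set g | exists A : 'M[fpseries k]_N,
     A \in unitmx /\ GLmx g = map_mx (@tofrac _) A].

(** [GL_N(k((z^2)))]; since [k((z^2))] is a field, the inverse of such a matrix
    again has entries in [k((z^2))]. *)
Definition GL_H : set G := [set g | forall i j, laurent_even (GLmx g i j)].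

Definition double_coset (A : set G) (x : G) (B : set G) : set G :=
  [set g | exists a b, [/\ A a, B b & g = (a * x * b)%g]].

End GLgroup.

(** [G] with its Borel sigma-algebra. *)
Notation GLborel k N := (g_sigma_algebraType (@open (GL k N))).

Section Hecke.
Variables (k : fieldType) (N : nat).
Local Notation G := (GL k N).

(** A partition [(mu_1 >= ... >= mu_N)] is the sequence [[:: mu_1; ...; mu_N]],
    zeros included. *)
Definition pi_mx (mu : seq int) : 'M[laurent k]_N :=
  diag_mx (\row_(i < N) lz k ^ mu`_(N - i.+1)).

Lemma pi_mx_unit mu : pi_mx mu \in unitmx.
Proof.
rewrite unitmxE det_diag unitfE; apply/prodf_neq0 => i _.
by rewrite mxE expfz_neq0 ?lz_neq0.
Qed.

Definition pi_GL mu : G := MkGL (pi_mx_unit mu).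

Definition sq_block := {d : nat & 'M[laurent k]_d}.
Definition mk_block (d : nat) (A : 'M[laurent k]_d) : sq_block :=
  Tagged (fun d => 'M[laurent k]_d) A.

Fixpoint block_diag (bs : seq sq_block) : sq_block :=
  if bs is b :: bs' then
    mk_block (block_mx (tagged b) 0 0 (tagged (block_diag bs')))
  else @mk_block 0 0.

(** The matrix [[1, z], [0, z^i]]. *)
Definition Pi_block (i : int) : sq_block :=
  mk_block (block_mx (1%:M : 'M[laurent k]_1) (lz k)%:M 0 (lz k ^ i)%:M).

Definition Pi_blocks (lam : seq int) : seq sq_block :=
  let big := [seq i <- lam | 1 < i] in
  nseq (count_mem 0 lam - size big) (mk_block (1%:M : 'M[laurent k]_1))
  ++ nseq (count_mem 1 lam) (mk_block ((lz k)%:M : 'M[laurent k]_1))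
  ++ [seq Pi_block i | i <- rev big].

(** When [lam] has length [N], nonnegative entries and [m_0 >= sum_(i > 1) m_i],
    the block diagonal matrix has size [N]; [conform_mx] only transports it along
    this equality. *)
Definition Pi_mx (lam : seq int) : 'M[laurent k]_N :=
  conform_mx 1%:M (tagged (block_diag (Pi_blocks lam))).

Lemma block_diag_unit (bs : seq sq_block) :
  {in bs, forall b, tagged b \in unitmx} -> tagged (block_diag bs) \in unitmx.
Proof.
elim: bs => [|b bs IH] ubs /=; first by rewrite unitmxE det_mx00 unitr1.
rewrite unitmxE det_ublock unitrM -!unitmxE ubs ?mem_head //=.
by apply: IH => c cbs; apply: ubs; rewrite in_cons cbs orbT.
Qed.

Lemma Pi_mx_unit lam : Pi_mx lam \in unitmx.
Proof.
rewrite /Pi_mx; set B := block_diag _.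
have : tagged B \in unitmx.
  apply: block_diag_unit => b; rewrite !mem_cat !mem_nseq.
  case/or3P => [/andP[_ /eqP->]|/andP[_ /eqP->]|/mapP[i _ ->]] /=.
  - exact: unitmx1.
  - by rewrite unitmxE det_scalar unitfE expf_neq0 ?lz_neq0.
  - rewrite unitmxE det_ublock !det_scalar unitfE mulf_neq0 ?expf_neq0 //.
      exact: oner_neq0.
    by rewrite expfz_neq0 ?lz_neq0.
case: B => d A /= uA; have [dN|dN] := eqVneq d N.
  by move: A uA; rewrite dN => A uA; rewrite conform_mx_id.
by rewrite nonconform_mx ?unitmx1 // dN.
Qed.

Definition Pi_GL lam : G := MkGL (Pi_mx_unit lam).

Variable R : realType.

Definition c_fun (mu : seq int) : G -> R :=
  \1_(double_coset (@GL_K k N) (pi_GL mu) (@GL_K k N)).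
Definition d_fun (lam : seq int) : G -> R :=
  \1_(double_coset (@GL_K k N) (Pi_GL lam) (@GL_H k N)).

(** The normalised Haar measure; regularity is automatic, the topology of [G]
    being second countable and locally compact for [k] finite. *)
Definition normalised_haar (m : {measure set (GLborel k N) -> \bar R}) : Prop :=
  (forall (g : G) (A : set (GLborel k N)), measurable A ->
     m [set (g * x)%g | x in (A : set G)] = m A)
  /\ m (@GL_K k N) = 1%E.

Definition convolution (m : {measure set (GLborel k N) -> \bar R})
    (f g : G -> R) (x : G) : \bar R :=
  \int[m]_(y in [set: GLborel k N]) (g ((y : G)^-1 * x)%g * f y)%:E.

Definition hconst m (mu nu lam : seq int) : \bar R :=
  convolution m (c_fun mu) (d_fun lam) (Pi_GL nu).

End Hecke.

Definition qnum (R : realType) (q : R) (m : nat) : R := (q ^+ m - 1) / (q - 1).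

(** [p_l^{i,j}], the structure constant for [mu = (0^{2n-1}, -l)],
    [nu = (a^n, 0^n)] and [lambda = (a+i, a^{n-2}, a-j, 0^n)]. *)
Definition pconst (k : fieldType) (R : realType) (n : nat)
    (m : {measure set (GLborel k (2 * n)) -> \bar R})
    (l : nat) (a : int) (i j : nat) : \bar R :=
  hconst m
    (rcons (nseq (2 * n - 1) 0) (- l%:Z))
    (nseq n a ++ nseq n 0)
    ((a + i%:Z) :: nseq (n - 2) a ++ (a - j%:Z) :: nseq n 0).

(* Main.v *)
Require Import Defs.
From HB Require Import structures.
From mathcomp Require Import fingroup perm all_boot all_order all_algebra.
From mathcomp Require Import all_classical all_reals all_analysis.
From mathcomp Require Import ring zify.

(** Write s for the involution z -> -z of F = k((z)) and O = k[[z]].  By left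
invariance p is the number of cosets yK inside K pi^mu K with
y^-1 Pi^nu in K Pi^lambda H, that is, the number of lattices M = O^N + z^-l v O,
v primitive, in a given H-orbit.  If all nonzero entries of the partition are > 1
and there are n of them, K Pi^lambda H contains some g whose lattice g^-1 O^N has a
basis f_1, ..., f_n, z^beta_1 s(f_1), ..., z^beta_n s(f_n) with beta = lambda - 1,
and beta is determined by the elementary divisors z^beta_t, z^-beta_t of g s(g)^-1.

Write v = (x, y) in coordinates adapted to Pi^nu, with val x = r.  Since
a - 1 > l, a unipotent element commuting with s splits M into its
projection O^n + z^-l x O and its intersection O^n + z^-r y O with the two
halves, and the exponents beta_t - (a - 1) are the elementary divisors of these
two lattices of F^n relative to each other.  For y primitive, write s(x) = C u
where C is invertible with first column y; if w denotes the coordinates of u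
after the first and d = min (val w, 2 r), these divisors are z^(l - d), 1, ..., 1
and z^(d - 2 r).  Otherwise they are z^l, 1, ..., 1.  It remains to count the
normalised v with prescribed valuations. *)

Set Implicit Arguments.
Unset Strict Implicit.
Unset Printing Implicit Defensive.

Import Order.TTheory GRing.Theory Num.Theory.

Local Open Scope ring_scope.

(** * Power series and Laurent series *)

(** Conjugation by [Theta] sends every diag(g, s(g)) into H. A lattice that is the sum of two
    lattices P and Q of F^n, one in each half, therefore matters only through the relative position
    of P and s(Q), and this is where the exponents beta come from. It is also the reason for writing
    s(x) = C u: after applying s, both halves carry the factor C, which cancels, and the position
    depends on u alone.

    The divisors z^beta_t, z^-beta_t hide the signs of the beta_t; l < a - 1 makes all beta_t
    positive.

    With i = l - d and j = 2 r - d one gets l - (i + j) = 2 (d - r), hence the parity condition. The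
    normalised y are the points of P^(n-1) over O/z^l, whence q^((l-1)(n-1)) [n], and u varies
    independently of y. Up to powers of q, an exact valuation of w contributes q^(n-1) - 1 = (q - 1)
    [n-1], and an exact valuation of the first coordinate of u contributes q - 1. The vectors with y
    = 0 modulo z count only for i = l and j = 0, where they complete the number of u to q^(l n). *)

Section Series.
Variable k : fieldType.
Local Notation O := (fpseries k).
Implicit Types f g : O.

Lemma fps_coef_z i : fps_coef (fps_z k) i = (i == 1%N)%:R. Proof. by []. Qed.
Lemma fps_coef1 i : fps_coef (1 : O) i = (i == 0%N)%:R. Proof. by []. Qed.
Lemma fps_coefD f g i : fps_coef (f + g) i = fps_coef f i + fps_coef g i.
Proof. by []. Qed.
Lemma fps_coefN f i : fps_coef (- f) i = - fps_coef f i.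
Proof. by []. Qed.
Lemma fps_coefM f g n :
  fps_coef (f * g) n = \sum_(i < n.+1) fps_coef f i * fps_coef g (n - i).
Proof. by []. Qed.

Lemma fps_coef_sum (I : Type) (r : seq I) (P : pred I) (F : I -> O) i :
  fps_coef (\sum_(x <- r | P x) F x) i = \sum_(x <- r | P x) fps_coef (F x) i.
Proof. by apply: (big_morph (fun f => fps_coef f i)). Qed.

Definition fps_ev0 f : k := fps_coef f 0.

Lemma fps_ev0_zmod : zmod_morphism fps_ev0.
Proof. by []. Qed.
Lemma fps_ev0_monoid : monoid_morphism fps_ev0.
Proof. by split=> // f g; rewrite /fps_ev0 fps_coefM big_ord1. Qed.
HB.instance Definition _ := GRing.isZmodMorphism.Build O k fps_ev0 fps_ev0_zmod.
HB.instance Definition _ := GRing.isMonoidMorphism.Build O k fps_ev0 fps_ev0_monoid.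

Definition fps_sg f : O := FPSeries (fun i => (-1) ^+ i * fps_coef f i).

Lemma fps_sg_zmod : zmod_morphism fps_sg.
Proof. by move=> f g; apply: fpsP => i /=; rewrite mulrDr mulrN. Qed.
Lemma fps_sg_monoid : monoid_morphism fps_sg.
Proof.
split=> [|f g]; apply: fpsP => i /=.
  by case: i => [|i] /=; rewrite ?mulr1 ?mulr0.
rewrite mulr_sumr; apply: eq_bigr => j _.
have ji : (j <= i)%N by rewrite -ltnS.
by rewrite -{1}(subnKC ji) exprD; ring.
Qed.
HB.instance Definition _ := GRing.isZmodMorphism.Build O O fps_sg fps_sg_zmod.
HB.instance Definition _ := GRing.isMonoidMorphism.Build O O fps_sg fps_sg_monoid.

Lemma fps_sgK : involutive fps_sg.
Proof. by move=> f; apply: fpsP => i /=; rewrite mulrA -expr2 sqrr_sign mul1r. Qed.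

Lemma fps_sg_eq0 f : (fps_sg f == 0) = (f == 0).
Proof. by rewrite -(inj_eq (inv_inj fps_sgK)) fps_sgK rmorph0. Qed.

Lemma fps_sg_z : fps_sg (fps_z k) = - fps_z k.
Proof.
apply: fpsP => i /=; case: eqVneq => [->|_]; first by rewrite expr1 mulr1.
by rewrite mulr0 oppr0.
Qed.

Lemma fps_ev0_sg f : fps_ev0 (fps_sg f) = fps_ev0 f.
Proof. by rewrite /fps_ev0 /= expr0 mul1r. Qed.

Lemma fps_ev0_z : fps_ev0 (fps_z k) = 0. Proof. by []. Qed.

Lemma fps_coef_Xz r f n :
  fps_coef (fps_z k ^+ r * f) n = if (n < r)%N then 0 else fps_coef f (n - r).
Proof.
elim: r f n => [|r IH] f n; first by rewrite expr0 mul1r subn0.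
rewrite exprS -mulrA fps_coefM; case: n => [|n].
  by rewrite big_ord1 fps_coef_z mul0r.
rewrite 2!big_ord_recl !fps_coef_z mul0r add0r mul1r big1 ?addr0; last first.
  by move=> i _; rewrite fps_coef_z mul0r.
by rewrite lift0 !subSS subn0 IH ltnS.
Qed.

Definition fps_shift r f : O := FPSeries (fun i => fps_coef f (i + r)).

Lemma fps_shiftP r f : (forall i, (i < r)%N -> fps_coef f i = 0) ->
  f = fps_z k ^+ r * fps_shift r f.
Proof.
move=> f0; apply: fpsP => i; rewrite fps_coef_Xz.
by case: ltnP => [/f0//|ri] /=; rewrite subnK.
Qed.

Lemma fps_unit_ev0 f : (f \is a GRing.unit) = (fps_ev0 f != 0).
Proof.
apply/idP/idP => [uf|f0]; first by rewrite -unitfE rmorph_unit.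
pose c := fps_ev0 f.
pose x : O := 1 - FPSeries (fun i => c^-1 * fps_coef f i).
have x0 : fps_coef x 0 = 0 by rewrite /= mulVf // subrr.
have xX m i : (i < m)%N -> fps_coef (x ^+ m) i = 0.
  have -> : x = fps_z k ^+ 1 * fps_shift 1 x.
    by apply: fps_shiftP => -[|//] _.
  by move=> im; rewrite expr1 exprMn fps_coef_Xz im.
(* The geometric series of x: as x^m is divisible by z^m, the coefficient of index n is already that
   of the partial sum up to m = n. *)
pose g : O := FPSeries (fun n => fps_coef (\sum_(m < n.+1) x ^+ m) n).
have gE n i : (i <= n)%N -> fps_coef g i = fps_coef (\sum_(m < n.+1) x ^+ m) i.
  move=> ile; rewrite [LHS]/= !fps_coef_sum.
  rewrite -!(big_mkord xpredT (fun m => fps_coef (x ^+ m) i)).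
  rewrite [RHS](@big_cat_nat _ _ _ i.+1) //=.
  rewrite [X in _ = _ + X]big_nat_cond [X in _ = _ + X]big1 ?addr0 //.
  by move=> m; rewrite andbT => /andP[im _]; exact: xX.
have gx : (1 - x) * g = 1.
  apply: fpsP => n; rewrite fps_coefM.
  transitivity (fps_coef ((1 - x) * (\sum_(m < n.+1) x ^+ m)) n).
    by rewrite fps_coefM; apply: eq_bigr => i _; rewrite (gE n) ?leq_subr.
  rewrite -(opprB x) mulNr -subrX1 opprB.
  by rewrite fps_coefD fps_coefN xX // subr0.
have cK : c * c^-1 = 1 by rewrite mulfV.
apply/unitrPr; exists (FPSeries (fun i => c^-1 * fps_coef g i)).
rewrite -[RHS]gx; apply: fpsP => n; rewrite !fps_coefM; apply: eq_bigr => i _.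
by rewrite /x opprB addrC subrK /= mulrCA mulrA.
Qed.

End Series.


(** * The involution z -> -z on Laurent series and its fixed field *)

Section Involution.
Variable k : fieldType.
Local Notation "f %:F" := (@tofrac _ f).
Local Notation O := (fpseries k).
Local Notation F := (laurent k).
Implicit Types (f g : O) (x y : F).

Lemma frac_repr (D : idomainType) (x : {fraction D}) :
  x = ((frac (repr x)).1)%:F / ((frac (repr x)).2)%:F.
Proof.
rewrite -{1}[x]reprK; set r := repr x.
have d0 : (frac r).2 != 0 by exact: denom_ratioP.
apply: (canRL (mulfK _)); first by rewrite tofrac_eq0.
rewrite /tofrac; unlock FracField.tofrac.
etransitivity; first by symmetry; exact: (FracField.pi_mul r (Ratio _ 1)).
apply/eqP; rewrite FracField.equivf_def.
rewrite /FracField.mulf !numden_Ratio ?mulf_neq0 ?oner_neq0 //.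
by rewrite !mulr1 mulrC.
Qed.

#[local] Strategy opaque [FracField.add FracField.mul FracField.opp FracField.inv FracField.tofrac].

Lemma laurentP x : exists f g, g != 0 /\ x = f%:F / g%:F.
Proof.
exists ((frac (repr x)).1), ((frac (repr x)).2); split; first exact: denom_ratioP.
exact: frac_repr.
Qed.

Definition lsg x : F := (fps_sg (frac (repr x)).1)%:F / (fps_sg (frac (repr x)).2)%:F.

(** Independence of the chosen fraction: the ring morphism [fps_sg] preserves the cross-multiplied
    equality of two fractions. *)
Lemma lsgE f g : g != 0 -> lsg (f%:F / g%:F) = (fps_sg f)%:F / (fps_sg g)%:F.
Proof.
move=> g0; rewrite /lsg; set r := repr _.
have d0 : (frac r).2 != 0 by exact: denom_ratioP.
have := frac_repr (f%:F / g%:F); rewrite -/r => /eqP.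
rewrite eqr_div ?tofrac_eq0 // -!tofracM tofrac_eq => /eqP e.
apply/eqP; rewrite eqr_div ?tofrac_eq0 ?fps_sg_eq0 // -!tofracM tofrac_eq.
by rewrite -!rmorphM -e.
Qed.

Lemma lsg_tofrac f : lsg f%:F = (fps_sg f)%:F.
Proof.
have := @lsgE f 1 (oner_neq0 _).
by rewrite !rmorph1 !divr1.
Qed.

Lemma lsg_zmod : zmod_morphism lsg.
Proof.
move=> x y; have [f [g [g0 ->]]] := laurentP x; have [f' [g' [g0' ->]]] := laurentP y.
have gF : g%:F != 0 by rewrite tofrac_eq0.
have gF' : g'%:F != 0 by rewrite tofrac_eq0.
rewrite -mulNr (addf_div _ _ gF gF') -tofracN.
rewrite -!tofracM -tofracD.
rewrite !lsgE ?mulf_neq0 //.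
rewrite -mulNr -tofracN -rmorphN.
rewrite addf_div ?tofrac_eq0 ?fps_sg_eq0 //.
rewrite -!tofracM -tofracD -!rmorphM -rmorphD //.
Qed.

Lemma lsg_monoid : monoid_morphism lsg.
Proof.
split; first by rewrite -tofrac1 lsg_tofrac rmorph1.
move=> x y; have [f [g [g0 ->]]] := laurentP x; have [f' [g' [g0' ->]]] := laurentP y.
rewrite mulf_div -!tofracM.
by rewrite !lsgE ?mulf_neq0 // mulf_div -!tofracM -!rmorphM.
Qed.
HB.instance Definition _ := GRing.isZmodMorphism.Build F F lsg lsg_zmod.
HB.instance Definition _ := GRing.isMonoidMorphism.Build F F lsg lsg_monoid.

Lemma lsgK : involutive lsg.
Proof.
move=> x; have [f [g [g0 ->]]] := laurentP x.
by rewrite !lsgE ?fps_sg_eq0 // !fps_sgK.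
Qed.

Lemma fps_even_sg f : fps_even f -> fps_sg f = f.
Proof.
move=> ef; apply: fpsP => i /=; have [oi|ei] := boolP (odd i).
  by rewrite ef // mulr0.
by rewrite -signr_odd (negbTE ei) mul1r.
Qed.

Lemma sg_fps_even f : 2%N \notin [pchar k] -> fps_sg f = f -> fps_even f.
Proof.
move=> k2 sf i oi; have := congr1 (fun h => fps_coef h i) sf.
rewrite /= -signr_odd oi expr1 mulN1r => /eqP; rewrite eq_sym -addr_eq0 -mulr2n.
by rewrite -mulr_natl mulf_eq0 => /orP[c2|/eqP//]; move: k2; rewrite inE /= c2.
Qed.

Lemma laurent_even_lsg x : laurent_even x -> lsg x = x.
Proof. by move=> [f [g [ef eg g0 ->]]]; rewrite lsgE // !fps_even_sg. Qed.

(* Multiplying numerator and denominator by the conjugate of the denominator. *)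
Lemma lsg_laurent_even x : 2%N \notin [pchar k] -> lsg x = x -> laurent_even x.
Proof.
move=> k2 sx; have [f [g [g0 xE]]] := laurentP x.
have gF : g%:F != 0 by rewrite tofrac_eq0.
have sgF : (fps_sg g)%:F != 0 by rewrite tofrac_eq0 fps_sg_eq0.
have eg : fps_sg (g * fps_sg g) = g * fps_sg g by rewrite rmorphM /= fps_sgK mulrC.
exists (f * fps_sg g), (g * fps_sg g); split.
- apply: (sg_fps_even k2); apply/eqP; rewrite -tofrac_eq -lsg_tofrac.
  have -> : (f * fps_sg g)%:F = x * (g * fps_sg g)%:F.
    by rewrite !tofracM xE mulrA (divfK gF).
  by rewrite rmorphM /= sx lsg_tofrac eg.
- exact: sg_fps_even.
- by rewrite mulf_neq0 // fps_sg_eq0.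
- by rewrite xE !tofracM -mulf_div divff // mulr1.
Qed.

End Involution.

(* The computations below only use this interface, which keeps the quotient
   construction of the fraction field out of the conversion problems. *)
Record series_field (k : fieldType) := SeriesField {
  sf_sort :> fieldType;
  sf_of : {rmorphism fpseries k -> sf_sort};
  sf_of_inj : injective sf_of;
  sf_sg : {rmorphism sf_sort -> sf_sort};
  sf_sg_of : forall f, sf_sg (sf_of f) = sf_of (fps_sg f);
  sf_sgK : involutive sf_sg;
  sf_denom : forall x : sf_sort, exists f g, g != 0 /\ x = sf_of f / sf_of g
}.

Lemma tofrac_inj (D : idomainType) : injective (@tofrac D).
Proof. by move=> f g /eqP; rewrite tofrac_eq => /eqP. Qed.

Definition laurent_sf (k : fieldType) : series_field k :=
  @SeriesField k (laurent k) (@tofrac (fpseries k)) (@tofrac_inj _)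
    (@lsg k) (@lsg_tofrac k) (@lsgK k) (@laurentP k).

(** * Integral matrices and double cosets *)

Section Matrices.
Variables (k : fieldType) (L : series_field k).
Local Notation O := (fpseries k).
Local Notation F := (sf_sort L).
Local Notation "f %:F" := (sf_of L f) (format "f %:F").
Implicit Types (f g : O) (x y : F).

Lemma sf_of_eq f g : (f%:F == g%:F) = (f == g).
Proof. exact: (inj_eq (@sf_of_inj _ L)). Qed.

Lemma sf_of_eq0 f : (f%:F == 0) = (f == 0).
Proof. by rewrite -(rmorph0 (sf_of L)) sf_of_eq. Qed.

Definition sf_z : F := (fps_z k)%:F.

Lemma sf_z_neq0 : sf_z != 0.
Proof.
rewrite sf_of_eq0; apply/eqP => /(congr1 (fun f => fps_coef f 1)) /= /eqP.
by rewrite oner_eq0.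
Qed.

Lemma sf_sg_z : sf_sg L sf_z = - sf_z.
Proof. by rewrite sf_sg_of fps_sg_z rmorphN. Qed.

Definition lint x := exists f, x = f%:F.

Lemma lint_of f : lint f%:F. Proof. by exists f. Qed.
Lemma lint0 : lint 0. Proof. by exists 0; rewrite rmorph0. Qed.
Lemma lint1 : lint 1. Proof. by exists 1; rewrite rmorph1. Qed.
Lemma lintD x y : lint x -> lint y -> lint (x + y).
Proof. by move=> [f ->] [g ->]; exists (f + g); rewrite rmorphD. Qed.
Lemma lintN x : lint x -> lint (- x).
Proof. by move=> [f ->]; exists (- f); rewrite rmorphN. Qed.
Lemma lintM x y : lint x -> lint y -> lint (x * y).
Proof. by move=> [f ->] [g ->]; exists (f * g); rewrite rmorphM. Qed.
Lemma lint_sum (I : Type) (r : seq I) (P : pred I) (X : I -> F) :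
  (forall i, P i -> lint (X i)) -> lint (\sum_(i <- r | P i) X i).
Proof. by move=> h; apply: big_ind => //; [exact: lint0|exact: lintD]. Qed.
Lemma lint_natr n : lint n%:R.
Proof. by exists n%:R; rewrite rmorph_nat. Qed.
Lemma lint_zX n : lint (sf_z ^+ n).
Proof. by exists (fps_z k ^+ n); rewrite rmorphXn. Qed.
Lemma lint_zXz (n : int) : 0 <= n -> lint (sf_z ^ n).
Proof. by case: n => // n _; exact: lint_zX. Qed.
Lemma lint_sg x : lint x -> lint (sf_sg L x).
Proof. by move=> [f ->]; exists (fps_sg f); rewrite sf_sg_of. Qed.

Lemma sf_sg_zX (n : int) : sf_sg L (sf_z ^ n) = (-1) ^ n * sf_z ^ n.
Proof. by rewrite fmorphXz /= sf_sg_z expNrz. Qed.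

Lemma sf_denom_z x : exists c : nat, lint (sf_z ^+ c * x).
Proof.
have [f [g [g0 ->]]] := sf_denom x.
have [e ge mine] := ex_minnP (fps_neq0 g0).
exists e, (f * (fps_shift e g)^-1).
have gE : g = fps_z k ^+ e * fps_shift e g.
  apply: fps_shiftP => i ie; apply/eqP; apply: contraTT ie => /mine.
  by rewrite -leqNgt.
have ug : fps_shift e g \is a GRing.unit by rewrite fps_unit_ev0.
rewrite rmorphM /= rmorphV //= {1}gE rmorphM rmorphXn /= -/sf_z.
have z0 := sf_z_neq0.
by rewrite invfM mulrCA mulVKf // expf_neq0.
Qed.

Definition mxint (m n : nat) (A : 'M[F]_(m, n)) := forall i j, lint (A i j).

Lemma mxintP m n (A : 'M[F]_(m, n)) :
  mxint A <-> exists B : 'M[O]_(m, n), A = map_mx (sf_of L) B.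
Proof.
split=> [iA|[B ->] i j]; last by rewrite mxE; exact: lint_of.
exists (\matrix_(i, j) projT1 (cid (iA i j))); apply/matrixP => i j.
by rewrite !mxE; case: cid.
Qed.

Lemma mxint_map m n (B : 'M[O]_(m, n)) : mxint (map_mx (sf_of L) B).
Proof. by apply/mxintP; exists B. Qed.

Lemma mxint0 m n : mxint (0 : 'M[F]_(m, n)).
Proof. by move=> i j; rewrite mxE; exact: lint0. Qed.

Lemma mxint1 n : mxint (1%:M : 'M[F]_n).
Proof. by move=> i j; rewrite mxE; case: (_ == _); [exact: lint1|exact: lint0]. Qed.

Lemma mxintN m n (A : 'M[F]_(m, n)) : mxint A -> mxint (- A).
Proof. by move=> iA i j; rewrite mxE; exact: lintN. Qed.

Lemma mxintD m n (A B : 'M[F]_(m, n)) : mxint A -> mxint B -> mxint (A + B).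
Proof. by move=> iA iB i j; rewrite mxE; exact: lintD. Qed.

Lemma mxintM m n p (A : 'M[F]_(m, n)) (B : 'M[F]_(n, p)) :
  mxint A -> mxint B -> mxint (A *m B).
Proof. by move=> iA iB i j; rewrite mxE; apply: lint_sum => l _; exact: lintM. Qed.

Lemma mxintZ m n a (A : 'M[F]_(m, n)) : lint a -> mxint A -> mxint (a *: A).
Proof. by move=> ia iA i j; rewrite mxE; exact: lintM. Qed.

Lemma mxint_sg m n (A : 'M[F]_(m, n)) : mxint A -> mxint (map_mx (sf_sg L) A).
Proof. by move=> iA i j; rewrite mxE; exact: lint_sg. Qed.

Lemma mxint_block m1 m2 n1 n2 (A : 'M[F]_(m1, n1)) (B : 'M[F]_(m1, n2))
    (C : 'M[F]_(m2, n1)) (D : 'M[F]_(m2, n2)) :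
  mxint A -> mxint B -> mxint C -> mxint D -> mxint (block_mx A B C D).
Proof.
move=> iA iB iC iD i j; rewrite mxE.
by case: (fintype.split i) => i'; rewrite mxE; case: (fintype.split j).
Qed.

Lemma map_mx_sgK m n : involutive (@map_mx F F (sf_sg L) m n).
Proof. by move=> A; apply/matrixP => i j; rewrite !mxE sf_sgK. Qed.

Definition mxK n (A : 'M[F]_n) :=
  exists B : 'M[O]_n, B \in unitmx /\ A = map_mx (sf_of L) B.

Lemma mxK_int n (A : 'M[F]_n) : mxK A -> mxint A.
Proof. by move=> [B [_ ->]]; exact: mxint_map. Qed.

Lemma mxK_det n (A : 'M[F]_n) :
  mxK A <-> mxint A /\ exists2 f : O, f \is a GRing.unit & \det A = f%:F.
Proof.
split=> [[B [uB ->]]|[/mxintP[B ->] [f uf]]].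
  by split; [exact: mxint_map|exists (\det B); rewrite -?unitmxE // det_map_mx].
rewrite det_map_mx => /eqP; rewrite sf_of_eq => /eqP fE.
by exists B; split; rewrite // unitmxE fE.
Qed.

Lemma mxK_of_inv n (A B : 'M[F]_n) : mxint A -> mxint B -> A *m B = 1%:M -> mxK A.
Proof.
move=> /mxintP[A' ->] /mxintP[B' ->]; rewrite -map_mxM -(map_mx1 (sf_of L)).
move=> /matrixP AB; exists A'; split=> //.
suff /mulmx1_unit[//] : A' *m B' = 1%:M.
by apply/matrixP => i j; move/eqP: (AB i j); rewrite !mxE sf_of_eq => /eqP.
Qed.

Lemma mxK1 n : mxK (1%:M : 'M[F]_n).
Proof. by exists 1%:M; rewrite unitmx1 map_mx1. Qed.

Lemma mxKM n (A B : 'M[F]_n) : mxK A -> mxK B -> mxK (A *m B).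
Proof.
move=> [A' [uA ->]] [B' [uB ->]]; exists (A' *m B').
by rewrite unitmx_mul uA uB map_mxM.
Qed.

Lemma mxK_unit n (A : 'M[F]_n) : mxK A -> A \in unitmx.
Proof.
by move=> [A' [uA ->]]; rewrite unitmxE det_map_mx rmorph_unit // -unitmxE.
Qed.

Lemma mxKV n (A : 'M[F]_n) : mxK A -> mxK (invmx A).
Proof.
move=> kA; have uA := mxK_unit kA; case: kA uA => A' [uA ->] uFA.
exists (invmx A'); rewrite unitmx_inv; split=> //.
rewrite -[LHS]mulmx1 -[X in _ *m X](map_mx1 (sf_of L)) -(mulmxV uA) map_mxM.
by rewrite mulKmx.
Qed.

Lemma mxK_sg n (A : 'M[F]_n) : mxK A -> mxK (map_mx (sf_sg L) A).
Proof.
move=> kA; apply: (@mxK_of_inv _ _ (map_mx (sf_sg L) (invmx A))).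
- exact/mxint_sg/mxK_int.
- exact/mxint_sg/mxK_int/mxKV.
- by rewrite -map_mxM mulmxV ?mxK_unit // map_mx1.
Qed.

Definition mxH n (A : 'M[F]_n) := A \in unitmx /\ map_mx (sf_sg L) A = A.

Lemma mxHM n (A B : 'M[F]_n) : mxH A -> mxH B -> mxH (A *m B).
Proof. by move=> [uA sA] [uB sB]; split; rewrite ?unitmx_mul ?uA // map_mxM sA sB. Qed.

Lemma mxHV n (A : 'M[F]_n) : mxH A -> mxH (invmx A).
Proof.
move=> [uA sA]; split; rewrite ?unitmx_inv //.
rewrite -[LHS]mulmx1 -(mulmxV uA) mulmxA -{2}sA.
by rewrite -map_mxM mulVmx // map_mx1 mul1mx.
Qed.

Definition dcos n (X Y : 'M[F]_n) :=
  exists A B, [/\ mxK A, mxH B & X = A *m Y *m B].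

Lemma dcos_sym n (X Y : 'M[F]_n) : dcos X Y -> dcos Y X.
Proof.
move=> [A [B [kA hB ->]]]; exists (invmx A), (invmx B).
split; [exact: mxKV|exact: mxHV|].
by rewrite !mulmxA mulVmx ?mxK_unit // mul1mx mulmxK //; case: hB.
Qed.

Lemma dcos_trans n (X Y Z : 'M[F]_n) : dcos X Y -> dcos Y Z -> dcos X Z.
Proof.
move=> [A [B [kA hB ->]]] [A' [B' [kA' hB' ->]]].
exists (A *m A'), (B' *m B); split; [exact: mxKM|exact: mxHM|].
by rewrite !mulmxA.
Qed.

End Matrices.

(* The matrix sending the p-th basis vector to v and fixing the other ones,
   composed with a transposition. *)
Lemma unimodular_column (R : comUnitRingType) n (v : 'cV[R]_n.+1) p :
  v p 0 \is a GRing.unit ->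
  exists2 A : 'M[R]_n.+1, A \in unitmx & A *m delta_mx 0 0 = v.
Proof.
move=> vp; pose d : 'cV[R]_n.+1 := delta_mx p 0.
pose a := v - d; pose b := - (v p 0)^-1 *: a; pose dT : 'rV[R]_n.+1 := delta_mx 0 p.
have dTa (w : 'cV[R]_n.+1) : dT *m w = (w p 0)%:M.
  apply/matrixP => i j; rewrite !ord1 mxE (bigD1 p) //= big1 ?addr0.
    by rewrite !mxE !eqxx mul1r mulr1n.
  by move=> x /negbTE xp; rewrite mxE xp andbF mul0r.
exists ((1%:M + a *m dT) *m tperm_mx 0 p).
  rewrite unitmx_mul unitmx_perm andbT.
  have /mulmx1_unit[//] : (1%:M + a *m dT) *m (1%:M + b *m dT) = 1%:M.
  rewrite mulmxDl !mulmxDr !mul1mx mulmx1 mulmxA -(mulmxA a) dTa mul_mx_scalar.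
  rewrite -addrA -!mulmxDl.
  rewrite (_ : b + (a + _) = 0) ?mul0mx ?addr0 //.
  rewrite /b mxE addrA -[X in _ + X + _]scale1r -!scalerDl.
  rewrite (_ : _ + _ + _ = 0) ?scale0r //.
  rewrite !mxE !eqxx mulr1n mulrBr mulr1 mulNr mulVr //; ring.
rewrite -mulmxA (_ : tperm_mx 0 p *m delta_mx 0 0 = d).
  by rewrite mulmxDl mul1mx -mulmxA dTa !mxE !eqxx mulmx1 /a addrC subrK.
rewrite /tperm_mx /perm_mx -row_permE.
apply/matrixP => i j; rewrite !mxE !ord1 eqxx !andbT.
by rewrite -(inj_eq (@perm_inj _ (tperm 0 p))) tpermK tpermL.
Qed.

(** * Diagonal matrices of powers of z, and valuations of determinants *)

Section Diagonal.
Variables (k : fieldType) (L : series_field k).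
Local Notation O := (fpseries k).
Local Notation F := (sf_sort L).
Local Notation z := (sf_z L).
Local Notation "f %:F" := (sf_of L f) (format "f %:F").

Definition dg n (e : 'I_n -> int) : 'M[F]_n := diag_mx (\row_i z ^ e i).

Lemma dgE n (e : 'I_n -> int) : dg e = diag_mx (\row_i z ^ e i).
Proof. by []. Qed.

Lemma dgM n (e f : 'I_n -> int) : dg e *m dg f = dg (fun i => e i + f i).
Proof.
rewrite mulmx_diag; congr diag_mx; apply/rowP => i.
by rewrite !mxE expfzDr ?sf_z_neq0.
Qed.

Lemma eq_dg n (e f : 'I_n -> int) : e =1 f -> dg e = dg f.
Proof. by move=> ef; congr diag_mx; apply/rowP => i; rewrite !mxE ef. Qed.

Lemma dg0 n : dg (fun=> 0) = 1%:M :> 'M[F]_n.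
Proof.
by apply/matrixP => i j; rewrite !mxE expr0z.
Qed.

Lemma dgMN n (e : 'I_n -> int) : dg e *m dg (fun i => - e i) = 1%:M.
Proof. by rewrite dgM -dg0; apply: eq_dg => i; rewrite subrr. Qed.

Lemma dg_unit n (e : 'I_n -> int) : dg e \in unitmx.
Proof. by have /mulmx1_unit[] := dgMN e. Qed.

Lemma dgV n (e : 'I_n -> int) : invmx (dg e) = dg (fun i => - e i).
Proof. by rewrite -[LHS]mulmx1 -(dgMN e) mulKmx ?dg_unit. Qed.

Lemma dgEl n m (e : 'I_n -> int) (A : 'M[F]_(n, m)) i j :
  (dg e *m A) i j = z ^ e i * A i j.
Proof. by rewrite mul_diag_mx !mxE. Qed.

Lemma dgEr n m (e : 'I_n -> int) (A : 'M[F]_(m, n)) i j :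
  (A *m dg e) i j = A i j * z ^ e j.
Proof. by rewrite mul_mx_diag !mxE. Qed.

Lemma mxint_dg n (e : 'I_n -> int) : (forall i, 0 <= e i) -> mxint (dg e).
Proof.
move=> e0 i j; rewrite !mxE; case: (_ == _); last exact: lint0.
exact/lint_zXz/e0.
Qed.

Definition sgmx n (e : 'I_n -> int) : 'M[F]_n := diag_mx (\row_i (-1) ^ e i).

Lemma sg_dg n (e : 'I_n -> int) : map_mx (sf_sg L) (dg e) = dg e *m sgmx e.
Proof.
rewrite map_diag_mx mulmx_diag; congr diag_mx; apply/rowP => i.
by rewrite !mxE sf_sg_zX mulrC.
Qed.

Lemma lint_signz (e : int) : lint ((-1) ^ e : F).
Proof.
have h (n : nat) : lint ((-1) ^+ n : F).
  by exists ((-1) ^+ n); rewrite rmorphXn rmorphN1.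
by case: e => n; rewrite ?NegzE -?exprz_inv ?invrN1; exact: h.
Qed.

Lemma signz_sq (e : int) : (-1) ^ e * (-1) ^ e = 1 :> F.
Proof. by rewrite -expfzMl mulrNN mulr1 exp1rz. Qed.

Lemma mxK_sgmx n (e : 'I_n -> int) : mxK (sgmx e).
Proof.
have i1 : mxint (sgmx e).
  by move=> i j; rewrite !mxE; case: (_ == _); [exact: lint_signz|exact: lint0].
apply: (mxK_of_inv i1 i1); rewrite mulmx_diag.
by apply/matrixP => i j; rewrite !mxE signz_sq.
Qed.

Definition mxdet n (e : int) (A : 'M[F]_n) :=
  exists2 f : O, f \is a GRing.unit & \det A = z ^ e * f%:F.

Lemma mxdetM n e e' (A B : 'M[F]_n) :
  mxdet e A -> mxdet e' B -> mxdet (e + e') (A *m B).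
Proof.
move=> [f uf dA] [g ug dB]; exists (f * g); first by rewrite unitrM uf.
by rewrite det_mulmx dA dB mulrACA -expfzDr ?sf_z_neq0 // -rmorphM.
Qed.

Lemma mxdet_block n e e' (A : 'M[F]_n) (B : 'M[F]_n) :
  mxdet e A -> mxdet e' B -> mxdet (e + e') (block_mx A 0 0 B).
Proof.
move=> [f uf dA] [g ug dB]; exists (f * g); first by rewrite unitrM uf.
by rewrite det_ublock dA dB mulrACA -expfzDr ?sf_z_neq0 // -rmorphM.
Qed.

Lemma mxdet_dg n (e : 'I_n -> int) : mxdet (\sum_i e i) (dg e).
Proof.
exists 1; rewrite ?unitr1 // rmorph1 mulr1 det_diag.
rewrite (big_morph (fun c => z ^ c) (fun a b => expfzDr a b (sf_z_neq0 L)) (expr0z _)).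
by apply: eq_bigr => i _; rewrite mxE.
Qed.

(** The valuation of the determinant is additive on products, so this criterion gives membership in
    GL_n(O) without exhibiting an inverse. *)
Lemma mxK_intdet n (A : 'M[F]_n) : mxK A <-> mxint A /\ mxdet 0 A.
Proof.
rewrite mxK_det; split=> -[iA [f uf fE]]; split=> //; exists f => //.
  by rewrite expr0z mul1r.
by rewrite fE expr0z mul1r.
Qed.

End Diagonal.

(** * Lattices stable under the splitting *)

Lemma invmxM (R : comUnitRingType) n (A B : 'M[R]_n) :
  A \in unitmx -> B \in unitmx -> invmx (A *m B) = invmx B *m invmx A.
Proof.
move=> uA uB; have uAB : A *m B \in unitmx by rewrite unitmx_mul uA.
apply: (can_inj (mulKmx uAB)).
by rewrite mulmxV // mulmxA mulmxK // mulmxV.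
Qed.

Section Normal.
Variables (k : fieldType) (L : series_field k).
Local Notation O := (fpseries k).
Local Notation F := (sf_sort L).
Local Notation z := (sf_z L).
Local Notation dg := (dg L).
Local Notation "A ^s" := (map_mx (sf_sg L) A) (at level 2, format "A ^s").

Lemma mxK_near1 n (E : 'M[F]_n) : mxint E -> mxK (1%:M + z *: E).
Proof.
move=> /mxintP[E' ->]; exists (1%:M + fps_z k *: E'); split.
  rewrite unitmxE fps_unit_ev0 -det_map_mx map_mxD map_mx1 map_mxZ.
  by rewrite [X in X *: _](fps_ev0_z k) scale0r addr0 det1 oner_neq0.
by rewrite map_mxD map_mx1 map_mxZ.
Qed.

(** The columns of X span a lattice: K on the right changes the basis, H on the left moves the
    lattice, and inversion turns lattices up to H into double cosets K X^-1 H. *)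
Lemma dcosV n (X Y h g : 'M[F]_n) : X \in unitmx -> Y \in unitmx ->
  mxH h -> mxK g -> h *m X = Y *m g -> dcos (invmx X) (invmx Y).
Proof.
move=> uX uY hh kg e; exists (invmx g), h; split=> //; first exact: mxKV.
have -> : h = Y *m g *m invmx X by rewrite -e mulmxK.
by rewrite !mulmxA mulmxKV // mulVmx ?mxK_unit // mul1mx.
Qed.

Section Theta.
Variable n : nat.

(* The columns of Theta have the form f_1, ..., f_n, s(f_1), ..., s(f_n); any other
   invertible matrix of this form is h *m Theta with h in H. *)
Definition Theta : 'M[F]_(n + n) := block_mx 1%:M 1%:M z%:M (- z)%:M.
Definition Jmx : 'M[F]_(n + n) := block_mx 0 1%:M 1%:M 0.
Definition Dm (p q : 'M[F]_n) : 'M[F]_(n + n) := block_mx p 0 0 q.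

Lemma JmxK : Jmx *m Jmx = 1%:M.
Proof.
rewrite /Jmx mulmx_block !mul0mx !mulmx0 !mul1mx !add0r !addr0.
by rewrite -scalar_mx_block.
Qed.

Lemma sg_Theta : Theta^s = Theta *m Jmx.
Proof.
rewrite /Theta /Jmx map_block_mx !map_mx1 !map_scalar_mx rmorphN /= sf_sg_z opprK.
by rewrite mulmx_block !mulmx0 !mulmx1 !add0r !addr0.
Qed.

Lemma DmM p q p' q' : Dm p q *m Dm p' q' = Dm (p *m p') (q *m q').
Proof. by rewrite /Dm mulmx_block !mul0mx !mulmx0 !addr0 !add0r. Qed.

Lemma Dm_unit p q : p \in unitmx -> q \in unitmx -> Dm p q \in unitmx.
Proof. by move=> up uq; rewrite unitmxE det_ublock unitrM -!unitmxE up. Qed.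

Lemma mxK_Dm p q : mxK p -> mxK q -> mxK (Dm p q).
Proof.
move=> kp kq; apply: (@mxK_of_inv _ _ _ _ (Dm (invmx p) (invmx q))).
- by apply: mxint_block; try exact: mxint0; exact: mxK_int.
- by apply: mxint_block; try exact: mxint0; apply/mxK_int/mxKV.
- by rewrite DmM !mulmxV ?mxK_unit // /Dm -scalar_mx_block.
Qed.

Hypothesis k2 : 2%N \notin [pchar k].

Lemma two_neq0 : 2%:R != 0 :> F.
Proof.
rewrite -(rmorph_nat (sf_of L)) sf_of_eq0; apply: contra k2 => /eqP e.
rewrite inE /=; apply/eqP; transitivity (fps_ev0 (2%:R : O)).
  by rewrite rmorph_nat.
by rewrite e rmorph0.
Qed.

Lemma Theta_unit : Theta \in unitmx.
Proof.
have /mulmx1_unit[//] :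
    Theta *m (2%:R^-1 *: block_mx 1%:M (z^-1)%:M 1%:M (- z^-1)%:M) = 1%:M.
rewrite -scalemxAr /Theta mulmx_block !mul1mx !mulmx1 -!scalar_mxM -!raddfD /=.
rewrite mulrNN mulfV ?sf_z_neq0 // !subrr raddf0.
by rewrite -scalar_mx_block scale_scalar_mx mulVf ?two_neq0 //.
Qed.

(** Since s(Theta) = Theta J, being fixed by s becomes the condition s(S) = J S J after conjugation
    by [Theta]. *)
Lemma mxH_Theta S : S \in unitmx -> S^s = Jmx *m S *m Jmx ->
  mxH (Theta *m S *m invmx Theta).
Proof.
move=> uS sS; have uT := Theta_unit; split.
  by rewrite !unitmx_mul uT uS unitmx_inv.
rewrite !map_mxM sS map_invmx sg_Theta invmxM //; last first.
  by have /mulmx1_unit[] := JmxK.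
rewrite -!mulmxA (mulmxA Jmx Jmx) JmxK mul1mx; congr (_ *m (_ *m _)).
by rewrite mulmxA mulmxV ?mul1mx //; have /mulmx1_unit[] := JmxK.
Qed.

Lemma mxH_Theta_Dm p : p \in unitmx -> mxH (Theta *m Dm p p^s *m invmx Theta).
Proof.
move=> up; apply: mxH_Theta; first by apply: Dm_unit; rewrite ?map_unitmx.
rewrite /Dm /Jmx map_block_mx !map_mx0 map_mx_sgK.
by rewrite !mulmx_block !mul0mx !mulmx0 !mul1mx !mulmx1 !add0r !addr0.
Qed.

(* The representative of the double coset whose lattice has the basis
   f_t, z^beta_t s(f_t). *)
Definition Xm (beta : 'I_n -> int) := invmx (Theta *m Dm 1%:M (dg beta)).

(** The element of H attached to diag(p k1, s(p k1)) moves the first half to O^n, so what remains is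
    the position of s(q) relative to p. The signs [sgmx] in the proof come from s(z^c) = (-1)^c
    z^c. *)
Lemma relative_position p q beta k1 k2' :
  p \in unitmx -> mxK k1 -> mxK k2' -> q = (p *m k1 *m dg beta *m k2')^s ->
  dcos (invmx (Theta *m Dm p q)) (Xm beta).
Proof.
move=> up kk1 kk2 qE; have uT := Theta_unit.
have u1 := mxK_unit kk1; have u2 := mxK_unit kk2.
have uq : q \in unitmx by rewrite qE map_unitmx !unitmx_mul up u1 u2 dg_unit.
apply: dcos_sym.
apply: (@dcosV _ _ _ (Theta *m Dm (p *m k1) (p *m k1)^s *m invmx Theta)
   (Dm k1 (invmx (sgmx L beta *m k2'^s)))).
- by rewrite unitmx_mul uT Dm_unit ?unitmx1 ?dg_unit.
- by rewrite unitmx_mul uT Dm_unit.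
- by apply: mxH_Theta_Dm; rewrite unitmx_mul up.
- by apply: mxK_Dm => //; apply/mxKV/mxKM; [exact: mxK_sgmx|exact: mxK_sg].
rewrite mulmxA mulmxKV // -!mulmxA !DmM mulmx1; congr (_ *m Dm _ _).
rewrite qE !map_mxM sg_dg -!mulmxA (mulmxA (sgmx L beta)) mulmxV ?mulmx1 //.
by rewrite unitmx_mul map_unitmx u2 mxK_unit //; exact: mxK_sgmx.
Qed.

End Theta.

Definition pv n (p : 'I_n) (c : int) i := if i == p then c else 0.

Lemma pvD n (p : 'I_n) c c' i : pv p c i + pv p c' i = pv p (c + c') i.
Proof. by rewrite /pv; case: eqP. Qed.

Lemma pvN n (p : 'I_n) c i : - pv p c i = pv p (- c) i.
Proof. by rewrite /pv; case: eqP; rewrite ?oppr0. Qed.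

Lemma pv_ge0 n (p : 'I_n) c i : 0 <= c -> 0 <= pv p c i.
Proof. by rewrite /pv; case: eqP. Qed.

Lemma sum_pv n (p : 'I_n) c : \sum_i pv p c i = c.
Proof. by rewrite -big_mkcond big_pred1_eq. Qed.

Lemma dg_pv_delta n (p : 'I_n) c :
  dg (pv p c) *m delta_mx p 0 = z ^ c *: delta_mx p 0 :> 'cV_n.
Proof.
apply/matrixP => i j; rewrite dgEl !mxE /pv.
by case: (i == p) => //=; rewrite !mulr0.
Qed.

Section Split.
Variable n : nat.
Local Notation N := (n.+1 + n.+1)%N.
Hypothesis k2 : 2%N \notin [pchar k].

(* The unipotent matrix T splits the lattice spanned by the columns of A z^(-l)
   into its projection and its intersection with the two coordinate spaces. *)
Lemma split_lattice (b : int) (l r : nat) (A : 'M[F]_N) (u y0 : 'cV[F]_n.+1)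
    (B C : 'M[F]_n.+1) (w : 'cV[F]_N) :
  (r <= l)%N -> l%:Z < b -> mxK A -> mxint w -> mxint y0 ->
  A *m delta_mx (lshift _ 0) 0 = col_mx (z ^ r *: u) y0 + z ^ l *: w ->
  mxK B -> B *m delta_mx 0 0 = u -> mxK C ->
  r = 0%N \/ C *m delta_mx 0 0 = y0 ->
  dcos (invmx (Theta n.+1 *m Dm 1%:M (dg (fun=> b))
               *m (A *m dg (pv (lshift _ 0) (- l%:Z)))))
       (invmx (Theta n.+1 *m Dm (B *m dg (pv 0 (r%:Z - l%:Z)))
                 (z ^ b *: (C *m dg (pv 0 (- r%:Z)))))).
Proof.
move=> rl lb kA iw iy0 Ae kB Be kC Ce.
have uB := mxK_unit kB; have uC := mxK_unit kC; have uT := Theta_unit n.+1 k2.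
have z0 := sf_z_neq0 L.
have br1 : b - r%:Z = 1 + (b - r%:Z - 1) by lia.
have br2 : 0 <= b - r%:Z - 1 by lia.
have b0 : 0 <= b by lia.
have bl0 : 0 <= b - l%:Z by lia.
have zb0 : z ^ b != 0 by rewrite expfz_neq0.
set p := B *m _; set q := C *m _.
have up : p \in unitmx by rewrite unitmx_mul uB dg_unit.
have uq : q \in unitmx by rewrite unitmx_mul uC dg_unit.
have zbq : z ^ b *: q \in unitmx by rewrite unitmxZ ?unitfE.
(* A linear form with value 1 at u; it is integral because u is the first column of a matrix in
   GL(O). *)
pose xi : 'rV[F]_n.+1 := delta_mx 0 0 *m invmx B.
have xiu : xi *m u = 1%:M.
  rewrite -Be mulmxA mulmxKV // mul_delta_mx.
  by apply/matrixP => i j; rewrite !mxE !ord1.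
have ixi : mxint xi.
  apply: mxintM; last exact/mxK_int/mxKV.
  by move=> i j; rewrite mxE; case: (_ && _); [exact: lint1|exact: lint0].
(* Chosen so that [T] cancels the second half of the generator: up to the contribution of [w], its
   halves are z^(r-l) u and z^(b-l) y0. As r <= l < b, the coefficient is divisible by z. *)
pose sD := - z ^ (b - r%:Z) *: (y0 *m xi).
pose sD1 := - z ^ (b - r%:Z - 1) *: (y0 *m xi).
have sDE : sD = z *: sD1.
  rewrite /sD /sD1 scalerA mulrN -[X in X * _]expr1z -expfzDr //.
  by rewrite -br1.
have isD1 : mxint sD1.
  by apply: mxintZ (mxintM _ _) => //; apply/lintN/lint_zXz.
have isD : mxint sD by rewrite sDE; apply: mxintZ => //; exact: lint_of.
(* The upper right block is imposed by the condition s(T) = J T J. It changes the first half of the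
   generator by z^(b-l) times an integral vector only. *)
pose T := block_mx 1%:M sD^s sD 1%:M.
have kT : mxK T.
  have -> : T = 1%:M + z *: block_mx 0 (- sD1^s) sD1 0.
    rewrite scale_block_mx !scaler0 scalar_mx_block add_block_mx !addr0 !add0r.
    by rewrite /T sDE map_mxZ /= sf_sg_z scalerN scaleNr.
  apply/mxK_near1/mxint_block => //; try exact: mxint0.
  exact/mxintN/mxint_sg.
pose V := Dm 1%:M (dg (fun=> b)) : 'M[F]_N.
have uV : V \in unitmx by rewrite Dm_unit ?unitmx1 ?dg_unit.
have VE : V = block_mx 1%:M 0 0 (z ^ b)%:M.
  rewrite /V /Dm; congr block_mx; apply/matrixP => i j; rewrite !mxE.
  by [].
pose y := A *m dg (pv (lshift n.+1 0) (- l%:Z)) : 'M[F]_N.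
have uy : y \in unitmx by rewrite unitmx_mul mxK_unit ?dg_unit.
have pV : invmx p = dg (pv 0 (l%:Z - r%:Z)) *m invmx B.
  rewrite invmxM ?dg_unit // dgV; congr (_ *m _); apply: eq_dg => i.
  by rewrite pvN opprB.
have qV : invmx q = dg (pv 0 r%:Z) *m invmx C.
  rewrite invmxM ?dg_unit // dgV; congr (_ *m _); apply: eq_dg => i.
  by rewrite pvN opprK.
have ipV : mxint (invmx p).
  rewrite pV; apply: mxintM; last exact/mxK_int/mxKV.
  by apply: mxint_dg => i; rewrite pv_ge0 // subr_ge0 lez_nat.
have iqV : mxint (invmx q).
  rewrite qV; apply: mxintM; last exact/mxK_int/mxKV.
  by apply: mxint_dg => i; rewrite pv_ge0.
(* the negative power of z in [z^(-b) q^-1 sD] is compensated by [q^-1 y0] *)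
have [t [it tE]] : exists t, mxint t /\ invmx q *m y0 = z ^ r%:Z *: t.
  rewrite qV; case: Ce => [r0|Ce].
    exists (invmx C *m y0); split; first by apply: mxintM => //; exact/mxK_int/mxKV.
    rewrite r0 expr0z scale1r; congr (_ *m _).
    rewrite -[RHS]mul1mx -dg0; congr (_ *m _); apply: eq_dg => i.
    by rewrite /pv; case: eqP.
  exists (delta_mx 0 0); split.
    by move=> i j; rewrite mxE; case: (_ && _); [exact: lint1|exact: lint0].
  by rewrite -Ce -mulmxA mulKmx // dg_pv_delta.
pose R := block_mx (invmx p) (z ^ b *: (invmx p *m sD^s)) (- (t *m xi)) (invmx q).
have RE : block_mx (invmx p) 0 0 (z ^ (- b) *: invmx q) *m T *m V = R.
  rewrite VE /T !mulmx_block !mul0mx !mulmx0 !mulmx1 !add0r !addr0 !mul_mx_scalar.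
  rewrite scalerA -expfzDr // subrr expr0z scale1r; congr block_mx.
  rewrite /sD -scalemxAl -scalemxAr mulmxA tE -scalemxAl !scalerA.
  by rewrite mulNr mulrN -!expfzDr // subrK addNr expr0z scaleN1r.
have iR : mxint R.
  apply: mxint_block => //.
    by apply: mxintZ; [exact: lint_zXz|apply: mxintM => //; exact: mxint_sg].
  by apply/mxintN/mxintM.
pose e0 : 'cV[F]_N := delta_mx (lshift n.+1 0) 0.
have [s [is_ sE]] : exists s : 'cV[F]_N, mxint s /\ R *m (A *m e0) = z ^ l *: s.
  pose s1 : 'cV[F]_N := col_mx (delta_mx 0 0 + z ^ (b - l%:Z) *: (invmx p *m sD^s *m y0)) 0.
  exists (s1 + R *m w); split.
    apply: mxintD; last exact: mxintM.
    move=> i j; rewrite mxE; case: (fintype.split i) => i'; last by rewrite mxE; exact: lint0.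
    rewrite mxE; apply: lintD.
      by rewrite mxE; case: (_ && _); [exact: lint1|exact: lint0].
    apply: mxintZ; first exact: lint_zXz.
    by do 2![apply: mxintM => //]; exact: mxint_sg.
  rewrite Ae mulmxDr -scalemxAr scalerDr; congr (_ + _).
  rewrite mul_block_col scale_col_mx scaler0; congr col_mx.
    rewrite scalerDr scalerA -expfzDr // -scalemxAl; congr (_ + _ *: _).
      rewrite -Be -scalemxAr pV mulmxA mulmxKV // dg_pv_delta scalerA -expfzDr //.
      by rewrite addrC subrK.
    by rewrite addrC subrK.
  rewrite -scalemxAr mulNmx -mulmxA xiu mulmx1 tE scalerN addrC subrr //.
pose g := R *m y.
(* Only one column of [g] involves z^-l, and there [sE] supplies z^l; the valuations of the
   determinants of the factors add up to 0. *)
have kg : mxK g.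
  apply/mxK_intdet; split.
    move=> i j; rewrite /g /y mulmxA dgEr /pv; case: eqP => [->|_]; last first.
      rewrite expr0z mulr1; apply: mxintM => //; exact: mxK_int.
    have -> : (R *m A) i (lshift n.+1 0) = (R *m (A *m e0)) i 0.
      by rewrite /e0 mulmxA -colE [RHS]mxE.
    rewrite sE mxE mulrC mulrA -expfzDr // addNr expr0z mul1r; exact: is_.
  have -> : (0 : int) = (l%:Z - r%:Z) + (- b *+ n.+1 + r%:Z) + 0 + (0 + b *+ n.+1)
      + (0 - l%:Z) by rewrite mulNrn; ring.
  rewrite /g -RE; apply: mxdetM.
    apply: mxdetM; last first.
      apply: mxdet_block; first by have /mxK_intdet[] := mxK1 L n.+1.
      by have := mxdet_dg L (fun _ : 'I_n.+1 => b); rewrite sumr_const card_ord.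
    apply: mxdetM; last by have /mxK_intdet[] := kT.
    apply: mxdet_block.
      rewrite -[_ - _]addr0 pV; apply: mxdetM; last by have /mxK_intdet[] := mxKV kB.
      by have := mxdet_dg L (pv (0 : 'I_n.+1) (l%:Z - r%:Z)); rewrite sum_pv.
    rewrite -mul_scalar_mx; apply: mxdetM.
      have := mxdet_dg L (fun _ : 'I_n.+1 => - b); rewrite sumr_const card_ord.
      congr mxdet; apply/matrixP => i j; rewrite !mxE //.
    rewrite -[r%:Z]addr0 qV; apply: mxdetM; last by have /mxK_intdet[] := mxKV kC.
    by have := mxdet_dg L (pv (0 : 'I_n.+1) r%:Z); rewrite sum_pv.
  apply: mxdetM; first by have /mxK_intdet[] := kA.
  by have := mxdet_dg L (pv (lshift n.+1 (0 : 'I_n.+1)) (- l%:Z)); rewrite sum_pv.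
apply: (@dcosV _ _ _ (Theta n.+1 *m T *m invmx (Theta n.+1)) g).
- by rewrite -/V -/y 2!unitmx_mul uT uV uy.
- by rewrite !unitmx_mul uT Dm_unit.
- apply: mxH_Theta => //; first exact: mxK_unit.
  rewrite /T /Jmx map_block_mx !map_mx1 map_mx_sgK.
  by rewrite !mulmx_block !mul0mx !mulmx0 !mul1mx !mulmx1 !add0r !addr0.
- exact: kg.
rewrite -!mulmxA mulKmx //; congr (_ *m _).
rewrite /g -RE -/V -/y !mulmxA.
have -> : Dm p (z ^ b *: q) *m block_mx (invmx p) 0 0 (z ^ (- b) *: invmx q) = 1%:M.
  rewrite /Dm mulmx_block !mul0mx !mulmx0 !add0r !addr0 mulmxV //.
  rewrite -scalemxAl -scalemxAr scalerA -expfzDr // subrr expr0z scale1r mulmxV //.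
  by rewrite -scalar_mx_block.
by rewrite mul1mx.
Qed.

End Split.
End Normal.

(** * Elementary divisors of two lattices, each with one distinguished generator *)

Section Relative.
Variables (k : fieldType) (L : series_field k).
Local Notation O := (fpseries k).
Local Notation F := (sf_sort L).
Local Notation z := (sf_z L).
Local Notation dg := (dg L).
Local Notation "A ^s" := (map_mx (sf_sg L) A) (at level 2, format "A ^s").

Definition mx2 (a b c d : F) : 'M[F]_2 :=
  (block_mx a%:M b%:M c%:M d%:M : 'M[F]_(1 + 1)).

Lemma mx2M a b c d a' b' c' d' :
  mx2 a b c d *m mx2 a' b' c' d' =
  mx2 (a * a' + b * c') (a * b' + b * d') (c * a' + d * c') (c * b' + d * d').
Proof. by rewrite /mx2 [LHS](@mulmx_block _ 1 1 1 1 1 1) -!scalar_mxM -!raddfD. Qed.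

Lemma mx2_1 : mx2 1 0 0 1 = 1%:M.
Proof. by rewrite /mx2 !raddf0 [RHS](@scalar_mx_block _ 1 1). Qed.

Lemma mxint_mx2 a b c d : lint a -> lint b -> lint c -> lint d -> mxint (mx2 a b c d).
Proof.
move=> ia ib ic id; apply: (@mxint_block _ _ 1 1 1 1) => i j; rewrite !ord1 mxE eqxx mulr1n //.
Qed.

Lemma mxK_mx2 a b c d e : lint a -> lint b -> lint c -> lint d -> lint e ->
  (a * d - b * c) * e = 1 -> mxK (mx2 a b c d).
Proof.
move=> ia ib ic id ie e1.
apply: (@mxK_of_inv _ _ _ _ (mx2 (d * e) (- (b * e)) (- (c * e)) (a * e))).
- exact: mxint_mx2.
- by apply: mxint_mx2; rewrite -?mulNr; apply: lintM => //; exact: lintN.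
- by rewrite mx2M -mx2_1; congr mx2; rewrite -?e1; ring.
Qed.

Section Embed.
Variable m : nat.

Definition emb (A : 'M[F]_2) : 'M[F]_m.+2 := (block_mx A 0 0 1%:M : 'M[F]_(2 + m)).

Lemma embM A B : emb A *m emb B = emb (A *m B).
Proof. by rewrite /emb [LHS](@mulmx_block _ 2 m 2 m 2 m) !mul0mx !mulmx0 mulmx1 !addr0 !add0r. Qed.

Lemma emb1 : emb 1%:M = 1%:M.
Proof. by rewrite /emb [RHS](@scalar_mx_block _ 2 m). Qed.

Lemma mxK_emb A : mxK A -> mxK (emb A).
Proof.
move=> kA; apply: (@mxK_of_inv _ _ _ _ (emb (invmx A))).
- apply: (@mxint_block _ _ 2 m 2 m); try exact: mxint0; last exact: mxint1.
  exact: mxK_int.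
- apply: (@mxint_block _ _ 2 m 2 m); try exact: mxint0; last exact: mxint1.
  exact/mxK_int/mxKV.
- by rewrite embM mulmxV ?mxK_unit // emb1.
Qed.

Definition d2 (a b : int) (i : 'I_m.+2) : int :=
  if val i == 0%N then a else if val i == 1%N then b else 0.

Lemma d2_pv a : d2 a 0 =1 pv 0 a.
Proof. by move=> i; rewrite /d2 /pv -val_eqE /=; do 2![case: eqP => //]. Qed.

Lemma dg_d2 a b : dg (d2 a b) = emb (mx2 (z ^ a) 0 0 (z ^ b)).
Proof.
have -> : dg (d2 a b) =
    diag_mx (row_mx (row_mx (const_mx (z ^ a)) (const_mx (z ^ b)) : 'rV_(1 + 1))
                    (const_mx 1)).
  congr diag_mx; apply/rowP => i; rewrite mxE.
  case: (@fintype.split_ordP 2 m i) => j ->; rewrite ?(@row_mxEl _ 1 2 m) ?(@row_mxEr _ 1 2 m).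
    case: (@fintype.split_ordP 1 1 j) => j' ->;
      rewrite ?(@row_mxEl _ 1 1 1) ?(@row_mxEr _ 1 1 1) !ord1.
      by rewrite /d2 /= mxE.
    by rewrite /d2 /= mxE.
  by rewrite /d2 /= mxE expr0z.
by rewrite diag_mx_row /emb /mx2 diag_mx_row !diag_const_mx !raddf0.
Qed.

(* The lattice spanned by z^(-r) e_0, e_1, ... has elementary divisors delta relative
   to the lattice spanned by z^(r - l) d, e_1, ..., where d is the first column of D
   and e_1, ... stand for its other columns. *)
Definition relpos (D : 'M[F]_m.+2) (l r : nat) (delta : 'I_m.+2 -> int) :=
  exists K1 K2, [/\ mxK K1, mxK K2 &
    dg (pv 0 (- r%:Z)) = D *m dg (pv 0 (r%:Z - l%:Z)) *m K1 *m dg delta *m K2].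

Lemma relpos0 D l : mxK D -> relpos D l 0 (d2 l%:Z 0).
Proof.
move=> kD; exists 1%:M, (invmx D); split; [exact: mxK1|exact: mxKV|].
rewrite mulmx1 -(mulmxA D) dgM (_ : dg _ = 1%:M); last first.
  by rewrite -[RHS]dg0; apply: eq_dg => i; rewrite /pv; case: eqP.
rewrite (_ : dg _ = 1%:M); last first.
  by rewrite -[RHS]dg0; apply: eq_dg => i; rewrite d2_pv pvD sub0r addNr /pv; case: eqP.
by rewrite mulmx1 mulmxV ?mxK_unit.
Qed.

Lemma dg_pv_emb a : dg (pv 0 a) = emb (mx2 (z ^ a) 0 0 1).
Proof. by rewrite -(expr0z z) -dg_d2; apply: eq_dg => i; rewrite d2_pv. Qed.

(* The elementary divisors of <z^-r e0, e1> in <z^(r-l) (c e0 + z^t e1), e0, e1>. *)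
Lemma relpos2 (l r t : nat) c : (r <= l)%N -> (t <= l - r)%N -> lint c ->
  t = 0%N \/ (c != 0 /\ lint c^-1) ->
  exists D, [/\ mxK D, D *m delta_mx 0 0 = mx2 c 0 (z ^ t) 0 *m delta_mx 0 0 :> 'cV_2 &
    exists K1 K2, [/\ mxK K1, mxK K2 & mx2 (z ^ (- r%:Z)) 0 0 1 =
      D *m mx2 (z ^ (r%:Z - l%:Z)) 0 0 1 *m K1
        *m mx2 (z ^ ((l - r - minn t r)%N%:Z)) 0 0 (z ^ (- (r - minn t r)%N%:Z)) *m K2]].
Proof.
move=> rl tl ic ht; have z0 := sf_z_neq0 L.
have zX (e : nat) : z ^+ e != 0 by rewrite expf_neq0.
have ze (e : nat) : lint (z ^+ e) by exact: lint_zX.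
suff [D [kD De [K1 [K [kK1 kK e]]]]] : exists D,
    [/\ mxK D, D *m delta_mx 0 0 = mx2 c 0 (z ^ t) 0 *m delta_mx 0 0 :> 'cV_2 &
    exists K1 K, [/\ mxK K1, mxK K & D *m mx2 (z ^ (r%:Z - l%:Z)) 0 0 1 *m K1
      *m mx2 (z ^ ((l - r - minn t r)%N%:Z)) 0 0 (z ^ (- (r - minn t r)%N%:Z))
      = mx2 (z ^ (- r%:Z)) 0 0 1 *m K]].
  exists D; split=> //; exists K1, (invmx K); split=> //; first exact: mxKV.
  by rewrite e mulmxK ?mxK_unit.
have col2 a b d d' : mx2 a b d d' *m delta_mx 0 0 = mx2 a 0 d 0 *m delta_mx 0 0 :> 'cV_2.
  rewrite /mx2 -[delta_mx _ _ in LHS](@vsubmxK _ 1 1) -[delta_mx _ _ in RHS](@vsubmxK _ 1 1).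
  rewrite [LHS](@mul_block_col _ 1 1 1 1) [RHS](@mul_block_col _ 1 1 1 1).
  rewrite (_ : dsubmx _ = 0) ?mulmx0 //.
  by apply/matrixP => i j; rewrite !mxE -val_eqE.
have zN (e : nat) : z ^ (- e%:Z) = (z ^+ e)^-1 by rewrite -exprnN.
have [e le] : exists e, l = (r + t + e)%N by exists (l - r - t)%N; lia.
have i0 := lint0 L; have i1 := lint1 L.
case: ht => [t0|[c0 ic']].
  subst t; exists (mx2 c 1 1 0); split.
  - by apply: (@mxK_mx2 _ _ _ _ (-1)) => //; [exact: lintN|ring].
  - by rewrite col2 expr0z.
  exists 1%:M, (mx2 (z ^+ r * c) 1 1 0); split; first exact: mxK1.
    by apply: (@mxK_mx2 _ _ _ _ (-1)) => //; [exact: lintM|exact: lintN|ring].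
  rewrite min0n !subn0 zN mulmx1 !mx2M.
  have -> : z ^ (r%:Z - l%:Z) = (z ^+ e)^-1 by rewrite -zN le; congr (z ^ _); lia.
  rewrite le addn0 addKn -exprnP.
  by congr mx2; field; rewrite ?zX.
(* Let x be the generator z^(r-l) (c e_0 + z^t e_1). For r <= t, z^(l-2r) x is c z^-r e_0 plus an
   integral multiple of e_1, so x and e_1 form an adapted basis. *)
have [rt|rt] := leqP r t.
  have [f tE] : exists f, t = (r + f)%N by exists (t - r)%N; lia.
  exists (mx2 c 0 (z ^+ t) 1); split.
  - by apply: (@mxK_mx2 _ _ _ _ c^-1) => //; rewrite mulr1 mul0r subr0 mulfV.
  - by rewrite col2.
  exists 1%:M, (mx2 c 0 (z ^+ f) 1); split; first exact: mxK1.
    by apply: (@mxK_mx2 _ _ _ _ c^-1) => //; rewrite mulr1 mul0r subr0 mulfV.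
  rewrite subnn oppr0 expr0z zN mulmx1 !mx2M.
  have -> : z ^ (r%:Z - l%:Z) = (z ^+ r * z ^+ f * z ^+ e)^-1.
    by rewrite -!exprD -zN le tE; congr (z ^ _); lia.
  have -> : (l - r - r)%N = (f + e)%N by lia.
  by rewrite tE -exprnP !exprD; congr mx2; field; rewrite !zX.
have [f rE] : exists f, r = (t + f)%N by exists (r - t)%N; lia.
exists (mx2 c 0 (z ^+ t) 1); split.
- by apply: (@mxK_mx2 _ _ _ _ c^-1) => //; rewrite mulr1 mul0r subr0 mulfV.
- by rewrite col2.
(* The adapted basis is now x and z^e x - e_1 = c z^-t e_0; the other lattice is spanned by z^e x
   and z^-f times the second vector. *)
exists (mx2 1 (z ^+ e) 0 (-1)), (mx2 (z ^+ f * c) c 1 0); split.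
- by apply: (@mxK_mx2 _ _ _ _ (-1)) => //; [exact: lintN|exact: lintN|ring].
- apply: (@mxK_mx2 _ _ _ _ (- c^-1)) => //; [exact: lintM|exact: lintN|].
  by rewrite mulr0 mulr1 sub0r mulrNN mulfV.
rewrite !mx2M.
have -> : z ^ (r%:Z - l%:Z) = (z ^+ t * z ^+ e)^-1.
  by rewrite -!exprD -zN le rE; congr (z ^ _); lia.
have -> : (l - r - t)%N = e by lia.
have -> : (r - t)%N = f by lia.
by rewrite !zN rE -exprnP !exprD; congr mx2; field; rewrite !zX.
Qed.

Lemma relposE (D : 'M[F]_2) (E : 'M[F]_m.+2) (l r i j : nat) :
  mxK E -> (forall x, E *m dg (pv 0 x) = dg (pv 0 x) *m E) ->
  (exists K1 K2, [/\ mxK K1, mxK K2 & mx2 (z ^ (- r%:Z)) 0 0 1 =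
      D *m mx2 (z ^ (r%:Z - l%:Z)) 0 0 1 *m K1
        *m mx2 (z ^ i%:Z) 0 0 (z ^ (- j%:Z)) *m K2]) ->
  relpos (E *m emb D) l r (d2 i%:Z (- j%:Z)).
Proof.
move=> kE Ec [K1 [K2 [kK1 kK2 e]]].
exists (emb K1), (emb K2 *m invmx E); split; first exact: mxK_emb.
  by apply: mxKM; [exact: mxK_emb|exact: mxKV].
apply: (can_inj (mulmxK (mxK_unit kE))).
rewrite !mulmxA mulmxKV ?mxK_unit // -Ec !dg_pv_emb dg_d2 -!mulmxA; congr (_ *m _).
by rewrite !embM e -!mulmxA.
Qed.

Lemma block1_comm (a : 'M[F]_m.+1) x :
  let E := (block_mx 1%:M 0 0 a : 'M[F]_(1 + m.+1)) in
  E *m dg (pv 0 x) = dg (pv 0 x) *m E.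
Proof.
have -> : dg (pv 0 x) = (block_mx (z ^ x)%:M 0 0 1%:M : 'M[F]_(1 + m.+1)).
  apply/matrixP => i j; rewrite /pv.
  case: (@fintype.split_ordP 1 m.+1 i) => i' ->;
  case: (@fintype.split_ordP 1 m.+1 j) => j' ->.
  - by rewrite (@block_mxEul _ 1 m.+1 1 m.+1) !mxE !ord1.
  - by rewrite (@block_mxEur _ 1 m.+1 1 m.+1) !mxE !ord1.
  - by rewrite (@block_mxEdl _ 1 m.+1 1 m.+1) !mxE !ord1.
  - by rewrite (@block_mxEdr _ 1 m.+1 1 m.+1) !mxE (inj_eq (@rshift_inj 1 _)).
rewrite /= [LHS](@mulmx_block _ 1 m.+1 1 m.+1 1 m.+1).
rewrite [RHS](@mulmx_block _ 1 m.+1 1 m.+1 1 m.+1).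
by rewrite !mul0mx !mulmx0 !mul1mx !mulmx1 !addr0 !add0r.
Qed.

Lemma emb_col (D : 'M[F]_2) c y :
  D *m delta_mx 0 0 = mx2 c 0 y 0 *m delta_mx 0 0 :> 'cV_2 ->
  emb D *m delta_mx 0 0 = (col_mx c%:M (y *: delta_mx 0 0) : 'cV_(1 + m.+1)).
Proof.
have o1 : (0 : 'I_m.+2) = lshift m (0 : 'I_2) by apply: val_inj.
have o2 : (0 : 'I_2) = lshift 1 (0 : 'I_1) by apply: val_inj.
rewrite -!colE => /colP De; apply/colP => i; rewrite mxE o1.
case: (@fintype.split_ordP 2 m i) => i' ->.
  rewrite (@block_mxEul _ 2 m 2 m).
  have := De i'; rewrite mxE [in X in _ = X]mxE => ->; rewrite {1}o2.
  case: (@fintype.split_ordP 1 1 i') => i1 ->; rewrite !ord1.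
    have -> : lshift m (lshift 1 (0 : 'I_1)) = lshift m.+1 (0 : 'I_1) :> 'I_(1 + m.+1).
      exact: val_inj.
    by rewrite (@block_mxEul _ 1 1 1 1) (@col_mxEu _ 1 m.+1 1).
  have -> : lshift m (rshift 1 (0 : 'I_1)) = rshift 1 (0 : 'I_m.+1) :> 'I_(1 + m.+1).
    exact: val_inj.
  by rewrite (@block_mxEdl _ 1 1 1 1) (@col_mxEd _ 1 m.+1 1) !mxE !eqxx mulr1 mulr1n.
have im : (i'.+1 < m.+1)%N by rewrite ltnS.
have -> : rshift 2 i' = rshift 1 (Ordinal im) :> 'I_(1 + m.+1) by exact: val_inj.
rewrite (@col_mxEd _ 1 m.+1 1).
have -> : rshift 1 (Ordinal im) = rshift 2 i' :> 'I_(2 + m) by exact: val_inj.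
by rewrite (@block_mxEdl _ 2 m 2 m) !mxE -val_eqE /= mulr0.
Qed.

(** The prescribed first column lies in the plane of e_0 and the image under [a] of the next basis
    vector. The change of basis diag(1, a) commutes with the matrices [dg (pv 0 x)], which leaves a
    2 by 2 problem. *)
Lemma relpos_exists (l r t : nat) c (a : 'M[F]_m.+1) :
  (r <= l)%N -> (t <= l - r)%N -> lint c -> mxK a ->
  t = 0%N \/ (c != 0 /\ lint c^-1) ->
  exists D, [/\ mxK D,
    D *m delta_mx 0 0 = (col_mx c%:M (z ^+ t *: (a *m delta_mx 0 0)) : 'cV_(1 + m.+1)) &
    relpos D l r (d2 (l - r - minn t r)%N%:Z (- (r - minn t r)%N%:Z))].
Proof.
move=> rl tl ic ka ht; have [D [kD De e]] := relpos2 rl tl ic ht.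
pose E : 'M[F]_(1 + m.+1) := block_mx 1%:M 0 0 a.
have kE : mxK (E : 'M[F]_m.+2).
  apply: (@mxK_of_inv _ _ m.+2 _ (block_mx 1%:M 0 0 (invmx a) : 'M[F]_(1 + m.+1))).
  - apply: (@mxint_block _ _ 1 m.+1 1 m.+1); try exact: mxint0; try exact: mxint1.
    exact: mxK_int.
  - apply: (@mxint_block _ _ 1 m.+1 1 m.+1); try exact: mxint0; try exact: mxint1.
    exact/mxK_int/mxKV.
  - rewrite [LHS](@mulmx_block _ 1 m.+1 1 m.+1 1 m.+1).
    rewrite !mul0mx !mulmx0 !mul1mx !addr0 !add0r mulmxV ?mxK_unit //.
    by rewrite [RHS](@scalar_mx_block _ 1 m.+1).
exists (E *m emb D); split; first by apply: mxKM => //; exact: mxK_emb.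
  rewrite -mulmxA (emb_col De) [LHS](@mul_block_col _ 1 m.+1 1 m.+1).
  by rewrite !mul0mx mul1mx addr0 add0r scalemxAr.
by apply: relposE => // x; exact: block1_comm.
Qed.

End Embed.

End Relative.

(** * The H-orbit of a lattice O^N + z^-l v O *)

Section LatticeClass.
Variables (k : fieldType) (L : series_field k).
Local Notation O := (fpseries k).
Local Notation F := (sf_sort L).
Local Notation z := (sf_z L).
Local Notation dg := (dg L).
Local Notation "A ^s" := (map_mx (sf_sg L) A) (at level 2, format "A ^s").

Lemma sgmxK n (e : 'I_n -> int) : sgmx L e *m sgmx L e = 1%:M.
Proof.
by rewrite mulmx_diag; apply/matrixP => i j; rewrite !mxE signz_sq.
Qed.

Lemma dg_const n b : dg (fun _ : 'I_n => b) = (z ^ b)%:M.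
Proof. by apply/matrixP => i j; rewrite !mxE. Qed.

Lemma sg_signz (e : int) : sf_sg L ((-1) ^ e) = (-1) ^ e.
Proof. by rewrite fmorphXz rmorphN rmorph1. Qed.

Lemma mxK_signz n (A : 'M[F]_n) (e : int) : mxK A -> mxK ((-1) ^ e *: A).
Proof.
move=> kA; apply: (@mxK_of_inv _ _ _ _ ((-1) ^ e *: invmx A)).
- by apply: mxintZ; [exact: lint_signz|exact: mxK_int].
- by apply: mxintZ; [exact: lint_signz|exact/mxK_int/mxKV].
- by rewrite -scalemxAl -scalemxAr scalerA signz_sq scale1r mulmxV ?mxK_unit.
Qed.

Variable m : nat.
Local Notation n := m.+2.
Hypothesis k2 : 2%N \notin [pchar k].

(** After splitting, the halves are, up to sign and the factor z^b, s(C D) [dg (pv 0 (r - l))] and C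
    [dg (pv 0 (- r))]. Applying s to the first one makes C cancel in the comparison, and the
    position left is that of [relpos]. *)
Lemma lattice_class (b : int) (l r : nat) (A : 'M[F]_(n + n)) (C D : 'M[F]_n)
    (chi y0 w1 : 'cV[F]_n) (w : 'cV[F]_(n + n)) delta :
  (r <= l)%N -> l%:Z < b -> mxK A -> mxK C -> mxK D ->
  mxint w -> mxint w1 -> mxint y0 ->
  chi = z ^ r *: (D *m delta_mx 0 0) + z ^ l *: w1 ->
  A *m delta_mx (lshift _ 0) 0 = col_mx (C *m chi)^s y0 + z ^ l *: w ->
  r = 0%N \/ C *m delta_mx 0 0 = y0 ->
  relpos D l r delta ->
  dcos (invmx (Theta L n *m Dm 1%:M (dg (fun=> b))
               *m (A *m dg (pv (lshift _ 0) (- l%:Z)))))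
       (Xm L (fun i => b + delta i)).
Proof.
move=> rl lb kA kC kD iw iw1 iy0 chiE Ae Ce [K1 [K2 [kK1 kK2 e]]].
(* As s(z^r) = (-1)^r z^r, the first half s(C chi) is z^r B e_0 modulo z^l. *)
pose B := (-1) ^ r *: (C *m D)^s.
have kB : mxK B by apply/mxK_signz/mxK_sg/mxKM.
pose w' := w + col_mx ((-1) ^ l *: (C *m w1)^s) 0.
have iw' : mxint w'.
  apply: mxintD => // i j; rewrite mxE; case: (fintype.split i) => i'.
    by apply: mxintZ; [exact: lint_signz|apply/mxint_sg/mxintM => //; exact: mxK_int].
  by rewrite mxE; exact: lint0.
have Ae' : A *m delta_mx (lshift n 0) 0 =
    col_mx (z ^ r *: (B *m delta_mx 0 0)) y0 + z ^ l *: w'.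
  rewrite Ae chiE /w' scalerDr addrCA [RHS]addrC; congr (_ + _).
    rewrite scale_col_mx scaler0 add_col_mx addr0; congr col_mx.
    rewrite mulmxDr map_mxD -!scalemxAr !map_mxZ !sf_sg_zX /=; congr (_ + _).
      rewrite /B -scalemxAl scalerA mulrC mulmxA; congr (_ *: _).
      by rewrite !map_mxM map_delta_mx.
    by rewrite scalerA mulrC.
apply: dcos_trans (split_lattice k2 rl lb kA iw' iy0 Ae' kB erefl kC Ce) _.
pose S := sgmx L (pv (0 : 'I_n) (r%:Z - l%:Z)).
pose beta i := b + delta i.
apply: (@relative_position _ _ _ k2 _ _ beta (S *m K1)^s
          ((-1) ^ r *: (sgmx L beta *m K2))^s).
- by rewrite unitmx_mul mxK_unit ?dg_unit.
- by apply/mxK_sg/mxKM => //; exact: mxK_sgmx.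
- by apply/mxK_sg/mxK_signz/mxKM => //; exact: mxK_sgmx.
have dgb : dg beta = z ^ b *: dg delta.
  by rewrite -mul_scalar_mx -dg_const dgM.
rewrite !map_mxM !map_mx_sgK !sg_dg -/S /B map_mxZ sg_signz map_mx_sgK.
rewrite -!scalemxAl -!scalemxAr scalerA signz_sq scale1r.
have SS : S *m S = 1%:M by exact: sgmxK.
have bb : sgmx L beta *m sgmx L beta = 1%:M by exact: sgmxK.
rewrite -!mulmxA (mulmxA S S) SS mul1mx (mulmxA (sgmx L beta)) bb mul1mx dgb.
by rewrite e -!(scalemxAl, scalemxAr) !mulmxA.
Qed.

End LatticeClass.

(** * Uniqueness of the elementary divisors *)

Section Divisors.
Variables (k : fieldType) (L : series_field k).
Local Notation O := (fpseries k).
Local Notation F := (sf_sort L).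
Local Notation z := (sf_z L).
Local Notation dg := (dg L).
Local Notation "A ^s" := (map_mx (sf_sg L) A) (at level 2, format "A ^s").

Lemma lint_z_ge0 (c : int) : lint (z ^ c) -> 0 <= c.
Proof.
case: c => // d [f e].
have : (fps_z k ^+ d.+1 * f) = 1.
  apply/eqP; rewrite -(sf_of_eq L) rmorphM rmorphXn rmorph1 -e NegzE -exprnN.
  by rewrite mulfV // expf_neq0 ?sf_z_neq0.
move/(congr1 (@fps_ev0 k)) => /eqP; rewrite rmorphM rmorphXn rmorph1 [X in X ^+ _](fps_ev0_z k).
by rewrite expr0n mul0r eq_sym oner_eq0.
Qed.

(** Modulo z, [K1] has nonzero determinant, so some term of its Leibniz expansion has only nonzero
    factors. At each of the corresponding entries the equation compares valuations. *)
Lemma divisors_le N (e e' : 'I_N -> int) (K1 K2 : 'M[F]_N) :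
  mxK K1 -> mxint K2 -> K1 *m dg e' = dg e *m K2 ->
  exists s : {perm 'I_N}, forall i, e i <= e' (s i).
Proof.
move=> [B [uB K1E]] iK2 eq1.
have : \det (map_mx (@fps_ev0 k) B) != 0.
  by rewrite det_map_mx -fps_unit_ev0 -unitmxE.
have [[s sP]|no] := pselect (exists s : {perm 'I_N}, forall i, fps_ev0 (B i (s i)) != 0).
  move=> _; exists s => i; have ui : B i (s i) \is a GRing.unit by rewrite fps_unit_ev0.
  have := congr1 (fun M : 'M[F]_N => M i (s i)) eq1.
  rewrite dgEr dgEl K1E mxE => eq2.
  rewrite -subr_ge0; apply: lint_z_ge0.
  rewrite expfzDr ?sf_z_neq0 // -invr_expz.
  have Bi0 : sf_of L (B i (s i)) != 0.
    by rewrite sf_of_eq0; apply: contraTneq ui => ->; rewrite unitr0.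
  have -> : z ^ e' (s i) = sf_of L (B i (s i))^-1 * (z ^ e i * K2 i (s i)).
    by rewrite rmorphV // -eq2 mulKf.
  rewrite mulrA mulrAC mulfK ?expfz_neq0 ?sf_z_neq0 //.
  by apply: lintM; [exact: lint_of|].
rewrite /determinant big1 ?eqxx // => s _.
have [i Bi] : exists i, fps_ev0 (B i (s i)) = 0.
  apply: contrapT => h; apply: no; exists s => i; apply/eqP => Bi; apply: h.
  by exists i.
by rewrite (bigD1 i) //= mxE Bi mul0r mulr0.
Qed.

Lemma divisors_perm N (e e' : 'I_N -> int) (K1 K2 : 'M[F]_N) :
  mxK K1 -> mxK K2 -> K1 *m dg e' = dg e *m K2 ->
  exists s : {perm 'I_N}, forall i, e i = e' (s i).
Proof.
move=> kK1 kK2 eq1; have [s sP] := divisors_le kK1 (mxK_int kK2) eq1.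
have eq2 : invmx K1 *m dg e = dg e' *m invmx K2.
  apply: (can_inj (mulmxK (mxK_unit kK2))); rewrite mulmxKV ?mxK_unit // -mulmxA -eq1.
  by rewrite mulKmx ?mxK_unit.
have [t tP] := divisors_le (mxKV kK1) (mxK_int (mxKV kK2)) eq2.
exists s => i; apply/eqP; rewrite eq_le sP /=.
(* The inequalities along [s] and along [t] order the two sums of exponents in opposite ways, so
   every inequality is an equality. *)
have h : \sum_i (e' (s i) - e i) = \sum_i e' i - \sum_i e i.
  by rewrite sumrB; congr (_ - _); rewrite [RHS](reindex_inj (@perm_inj _ s)).
have h0 : \sum_i (e' (s i) - e i) <= 0.
  rewrite h subr_le0 [X in _ <= X](reindex_inj (@perm_inj _ t)).
  by apply: ler_sum => j _; exact: tP.
have nn j : true -> 0 <= e' (s j) - e j by move=> _; rewrite subr_ge0.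
have h1 : \sum_i (e' (s i) - e i) == 0 by rewrite eq_le h0 sumr_ge0.
move: h1; rewrite (psumr_eq0 _ nn) => /allP/(_ i (mem_index_enum i)).
by rewrite subr_eq0 => /eqP ->.
Qed.

Section Class.
Variable n : nat.
Hypothesis k2 : 2%N \notin [pchar k].

Definition pm (beta : 'I_n -> int) (x : 'I_(n + n)) : int :=
  match fintype.split x with inl i => beta i | inr i => - beta i end.

Lemma pm_l beta i : pm beta (lshift n i) = beta i.
Proof. by rewrite /pm (unsplitK (inl i)). Qed.
Lemma pm_r beta i : pm beta (rshift n i) = - beta i.
Proof. by rewrite /pm (unsplitK (inr i)). Qed.

Lemma dg_pm beta : dg (pm beta) = Dm (dg beta) (dg (fun i => - beta i)).
Proof.
rewrite /Dm !dgE -diag_mx_row; congr diag_mx; apply/rowP => i.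
case: (fintype.split_ordP i) => j ->; rewrite ?row_mxEl ?row_mxEr !mxE ?pm_l ?pm_r //.
Qed.

(* X -> X s(X)^-1 maps the double coset K X H into a twisted K-conjugacy class. *)
Lemma Xm_divisors beta beta' : dcos (Xm L beta) (Xm L beta') ->
  exists s : {perm 'I_(n + n)}, forall x, pm beta x = pm beta' (s x).
Proof.
move=> [K1 [h [kK1 [uh sh] XE]]].
have uT := Theta_unit L n k2.
have kJ : mxK (Jmx L n).
  have iJ : mxint (Jmx L n) by apply: mxint_block; (exact: mxint0 || exact: mxint1).
  exact: (mxK_of_inv iJ iJ (JmxK L n)).
have kS b : mxK (Dm 1%:M (sgmx L b) : 'M[F]_(n + n)).
  by apply: mxK_Dm; [exact: mxK1|exact: mxK_sgmx].
pose Y b := Theta L n *m Dm 1%:M (dg b).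
have uY b : Y b \in unitmx by rewrite unitmx_mul uT Dm_unit ?unitmx1 ?dg_unit.
have uX (b : 'I_n -> int) : Xm L b \in unitmx by rewrite unitmx_inv; exact: (uY b).
(* [Y b] is the inverse of [Xm L b], so this is X s(X)^-1: the diagonal matrix of the z^beta_t,
   z^-beta_t times an element of K. *)
have YY (b : 'I_n -> int) : Xm L b *m (Y b)^s = dg (pm b) *m (Jmx L n *m Dm 1%:M (sgmx L b)).
  rewrite /Xm invmxM ?Dm_unit ?unitmx1 ?dg_unit // /Y map_mxM sg_Theta.
  rewrite -!mulmxA (mulmxA (invmx (Theta L n))) mulVmx // mul1mx.
  apply: (can_inj (mulKmx (_ : Dm 1%:M (dg b) \in unitmx))).
    by rewrite Dm_unit ?unitmx1 ?dg_unit.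
  rewrite mulKVmx ?Dm_unit ?unitmx1 ?dg_unit // dg_pm /Dm /Jmx.
  rewrite map_block_mx map_mx1 !map_mx0 sg_dg !mulmx_block.
  by rewrite !(mul0mx, mulmx0, mul1mx, mulmx1, add0r, addr0) dgMN.
have uK1 := mxK_unit kK1.
have Xh : Xm L beta' *m h = invmx K1 *m Xm L beta.
  by rewrite XE -mulmxA mulKmx.
have YE : Y beta' = h *m Y beta *m K1.
  apply: (can_inj (mulKmx (uX beta'))); rewrite -(mulmxA h) [RHS]mulmxA Xh.
  have XY (b : 'I_n -> int) : Xm L b *m Y b = 1%:M by exact: mulVmx (uY b).
  by rewrite -mulmxA (mulmxA _ (Y beta) K1) !XY mul1mx mulVmx.
have K1E : K1 *m (Xm L beta' *m (Y beta')^s) = Xm L beta *m (Y beta)^s *m K1^s.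
  by rewrite YE !map_mxM sh XE !mulmxA.
rewrite !YY in K1E.
pose U b := Jmx L n *m Dm 1%:M (sgmx L b).
have kU b : mxK (U b) by exact: mxKM.
apply: (@divisors_perm _ _ _ K1 (U beta *m K1^s *m invmx (U beta'))) => //.
  by apply: mxKM; [apply: mxKM => //; exact: mxK_sg|exact: mxKV].
apply: (can_inj (mulmxK (mxK_unit (kU beta')))).
rewrite -!mulmxA mulVmx ?mxK_unit // mulmx1 K1E /U.
by rewrite !mulmxA.
Qed.

End Class.

(** The divisors give the multiset of all beta_t and -beta_t. Since j < b, the beta_t are positive:
    the largest divisor exponent is b + i, and the sum of the absolute values then yields j. *)
Lemma Xm_inj m (b : int) (i j i' j' : nat) : 2%N \notin [pchar k] ->
  j%:Z < b -> j'%:Z < b ->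
  dcos (Xm L (fun x : 'I_m.+2 => b + d2 i%:Z (- j%:Z) x))
       (Xm L (fun x : 'I_m.+2 => b + d2 i'%:Z (- j'%:Z) x)) ->
  i = i' /\ j = j'.
Proof.
move=> k2 jb jb' dc.
pose B i j (x : 'I_m.+2) := b + d2 i%:Z (- j%:Z) x.
have d2_0 i1 j1 : B i1 j1 0 = b + i1%:Z by [].
have d2_le i1 j1 (x : 'I_m.+2) : d2 i1%:Z (- j1%:Z) x <= i1%:Z.
  by rewrite /d2; case: ifP => _; [|case: ifP => _]; lia.
have d2_ge i1 j1 (x : 'I_m.+2) : - j1%:Z <= d2 i1%:Z (- j1%:Z) x.
  by rewrite /d2; case: ifP => _; [|case: ifP => _]; lia.
have le i1 j1 i2 j2 : j1%:Z < b -> j2%:Z < b ->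
    dcos (Xm L (B i1 j1)) (Xm L (B i2 j2)) -> (i1 <= i2)%N.
  move=> h1 h2 /(Xm_divisors k2)[s /(_ (lshift _ 0))]; rewrite pm_l d2_0.
  case: (fintype.split_ordP (s (lshift _ 0))) => x ->; rewrite ?pm_l ?pm_r /B.
    by have := d2_le i2 j2 x; lia.
  by have := d2_ge i2 j2 x; lia.
have ii' : i = i'.
  by apply/eqP; rewrite eqn_leq (le _ _ _ _ jb jb' dc) (le _ _ _ _ jb' jb (dcos_sym dc)).
split=> //; have [s sE] := Xm_divisors k2 dc.
have absE i1 j1 : j1%:Z < b -> \sum_x `|pm (B i1 j1) x| =
    (b + i1%:Z + (b - j1%:Z) + b *+ m) *+ 2.
  move=> h1; rewrite big_split_ord /=.
  rewrite (eq_bigr (B i1 j1)); last first.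
    by move=> x _; rewrite pm_l /B; have := d2_ge i1 j1 x; lia.
  rewrite [X in _ + X](eq_bigr (B i1 j1)); last first.
    by move=> x _; rewrite pm_r /B; have := d2_ge i1 j1 x; lia.
  rewrite -mulr2n; congr (_ *+ 2); rewrite 2!big_ord_recl addrA; congr (_ + _ + _).
  by rewrite (eq_bigr (fun=> b)) ?sumr_const ?card_ord // => x _; rewrite /B /d2 /= addr0.
have e : \sum_x `|pm (B i' j') x| = \sum_x `|pm (B i j) x|.
  by rewrite (reindex_inj (@perm_inj _ s)) /=; apply: eq_bigr => x _; rewrite /B -sE.
by move: e; rewrite !absE // ii' => h; lia.
Qed.

End Divisors.

(** * The matrices Pi^lambda *)

Section NormalForm.
Variables (k : fieldType) (L : series_field k).
Local Notation O := (fpseries k).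
Local Notation F := (sf_sort L).
Local Notation z := (sf_z L).
Local Notation dg := (dg L).
Local Notation "A ^s" := (map_mx (sf_sg L) A) (at level 2, format "A ^s").

Lemma mxK_perm n (s : {perm 'I_n}) : mxK (perm_mx s : 'M[F]_n).
Proof.
have ip t : mxint (perm_mx t : 'M[F]_n).
  by move=> i j; rewrite !mxE; case: (_ == _); [exact: lint1|exact: lint0].
by apply: (mxK_of_inv (ip s) (ip s^-1%g)); rewrite -perm_mxM mulgV perm_mx1.
Qed.

Lemma mxH_perm n (s : {perm 'I_n}) : mxH (perm_mx s : 'M[F]_n).
Proof.
split; first exact: unitmx_perm.
by apply/matrixP => i j; rewrite !mxE rmorph_nat.
Qed.

Lemma sg_sgmx n (e : 'I_n -> int) : (sgmx L e)^s = sgmx L e.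
Proof. by apply/matrixP => i j; rewrite !mxE rmorphMn /= sg_signz. Qed.

Lemma dcos_reindex n (s : {perm 'I_n}) (A B : 'M[F]_n) :
  (forall i j, B i j = A (s i) (s j)) -> dcos B A.
Proof.
move=> e; exists (perm_mx s), (perm_mx s^-1%g).
split; [exact: mxK_perm|exact: mxH_perm|].
by rewrite -row_permE -col_permE; apply/matrixP => i j; rewrite !mxE e.
Qed.

Hypothesis k2 : 2%N \notin [pchar k].

Lemma lint_half : lint (2%:R^-1 : F).
Proof.
exists (2%:R^-1); rewrite rmorphV ?rmorph_nat //.
by rewrite fps_unit_ev0 rmorph_nat; apply: contra k2; rewrite inE.
Qed.

Section Dim.
Variable n : nat.

Lemma Xm_perm (beta beta' : 'I_n -> int) (s : {perm 'I_n}) :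
  (forall i, beta' i = beta (s i)) -> dcos (Xm L beta') (Xm L beta).
Proof.
move=> e; apply: (@relative_position _ _ _ k2 _ _ beta (perm_mx s)
                    (sgmx L beta *m perm_mx s^-1%g)).
- exact: unitmx1.
- exact: mxK_perm.
- by apply: mxKM; [exact: mxK_sgmx|exact: mxK_perm].
have sp t : (perm_mx t : 'M[F]_n)^s = perm_mx t by case: (mxH_perm t).
rewrite !map_mxM map_mx1 mul1mx !sp sg_dg sg_sgmx -!mulmxA (mulmxA (sgmx L beta)).
rewrite sgmxK mul1mx mulmxA -row_permE -col_permE.
by apply/matrixP => i j; rewrite !mxE e (inj_eq perm_inj).
Qed.

Definition rho_mx (beta : 'I_n -> int) : 'M[F]_(n + n) :=
  block_mx 1%:M z%:M 0 (dg (fun i => beta i + 1)).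

(** Put f_t = z^-(beta_t+1) (e_(n+t) - z e_t). Then [rho_mx] sends f_t to e_(n+t), and z^beta_t
    s(f_t) to 2 e_t + z^beta_t e_(n+t) up to sign. As 2 is invertible and beta_t >= 0, the images
    form a basis of O^N; the shift by 1 in the exponents comes from the factor z of z e_t. *)
Lemma rho_normal_form (beta : 'I_n -> int) : (forall i, 0 <= beta i) ->
  dcos (rho_mx beta) (Xm L beta).
Proof.
move=> b0; have uT := Theta_unit L n k2.
pose c i := - (beta i + 1).
pose S := sgmx L c.
pose T := block_mx (- z *: dg c) (z *: (dg c *m S)) (dg c) (dg c *m S).
pose Y := Dm 1%:M (dg beta).
pose K := block_mx 0 (2%:R *: S) 1%:M (S *m dg beta).
have uY : Y \in unitmx by rewrite Dm_unit ?unitmx1 ?dg_unit.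
have cb : dg (fun i => beta i + 1) *m dg c = 1%:M by exact: dgMN.
have Sd e : S *m dg e = dg e *m S.
  by rewrite !mulmx_diag; congr diag_mx; apply/rowP => i; rewrite !mxE mulrC.
have SS : S *m S = 1%:M by exact: sgmxK.
have zcb : z *: (dg c *m dg beta) = 1%:M.
  rewrite dgM -mul_scalar_mx -(expr1z z) -dg_const dgM -dg0; apply: eq_dg => i.
  by rewrite /c; ring.
have eK : rho_mx beta *m T *m Y = K.
  rewrite /rho_mx /T /Y /Dm /K !mulmx_block !(mul0mx, mulmx0, mul1mx, mulmx1, add0r, addr0).
  rewrite !mulmxA cb !mul1mx !mul_scalar_mx scaleNr addNr; congr block_mx.
  rewrite -scalemxAl -mulr2n -scaler_nat -!scalemxAl -mulmxA Sd mulmxA.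
  by rewrite (scalemxAl z) zcb mul1mx.
have kK : mxK K.
  apply: (@mxK_of_inv _ _ _ _ (block_mx (- 2%:R^-1 *: dg beta) 1%:M (2%:R^-1 *: S) 0)).
  - apply: mxint_block; [exact: mxint0| |exact: mxint1|].
      by apply: mxintZ; [exact: lint_natr|apply/mxK_int/mxK_sgmx].
    by apply: mxintM; [apply/mxK_int/mxK_sgmx|exact: mxint_dg].
  - apply: mxint_block; [|exact: mxint1| |exact: mxint0].
      by apply: mxintZ; [exact/lintN/lint_half|exact: mxint_dg].
    by apply: mxintZ; [exact: lint_half|apply/mxK_int/mxK_sgmx].
  rewrite /K mulmx_block !(mul0mx, mulmx0, mul1mx, mulmx1, add0r, addr0).
  rewrite -!scalemxAr -!scalemxAl !scalerA SS Sd -mulmxA SS mulmx1.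
  by rewrite mulVf ?two_neq0 // scale1r scaleNr addNr -scalar_mx_block.
have sT : T^s = T *m Jmx L n.
  rewrite /T /Jmx map_block_mx !map_mxZ !map_mxM sg_dg -/S mulmx_block.
  have Ss : S^s = S by exact: sg_sgmx.
  rewrite !(mul0mx, mulmx0, mul1mx, mulmx1, add0r, addr0) Ss -mulmxA SS mulmx1.
  by rewrite rmorphN sf_sg_z opprK scaleNr.
have uT' : T \in unitmx.
  have : rho_mx beta *m T *m Y \in unitmx by rewrite eK mxK_unit.
  by rewrite !unitmx_mul => /andP[/andP[]].
have hH : mxH (T *m invmx (Theta L n)).
  split; first by rewrite unitmx_mul uT' unitmx_inv.
  have uJ : Jmx L n \in unitmx by have /mulmx1_unit[] := JmxK L n.
  by rewrite map_mxM map_invmx sT sg_Theta invmxM // mulmxA mulmxK.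
exists K, (invmx (T *m invmx (Theta L n))); split=> //; first exact: mxHV.
have uD : Theta L n *m Y \in unitmx by rewrite unitmx_mul uT.
rewrite /Xm -/Y -eK (invmxM uT uY) [rho_mx beta *m T *m Y *m _]mulmxA (mulmxK uY).
by rewrite -(mulmxA (rho_mx beta)) mulmxK //; case: hH.
Qed.

End Dim.
End NormalForm.

(** Entry (i, j) of the block diagonal matrix with blocks 1, x, 0, c_t, indexed by natural numbers
    so that the recursively computed sizes of [block_diag] do not interfere. *)
Definition pair_entry (R : pzRingType) (x : R) (c : nat -> R) (i j : nat) : R :=
  if i./2 == j./2 then
    if odd i then (if odd j then c i./2 else 0) else (if odd j then x else 1)
  else 0.

Lemma pair_entry_block (R : pzRingType) d (x y : R) (B : 'M[R]_d) c :
  (forall i j, B i j = pair_entry x c i j) ->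
  forall i j : 'I_(1 + 1 + d),
    block_mx (block_mx 1%:M x%:M 0 y%:M : 'M[R]_(1 + 1)) 0 0 B i j
    = pair_entry x (fun t => if t is t'.+1 then c t' else y) i j.
Proof.
move=> eB i j; case: (@fintype.split_ordP (1 + 1) d i) => i' ->;
  case: (@fintype.split_ordP (1 + 1) d j) => j' ->.
- rewrite block_mxEul; case: (@fintype.split_ordP 1 1 i') => i1 ->;
  by case: (@fintype.split_ordP 1 1 j') => j1 ->;
    rewrite ?(block_mxEul, block_mxEur, block_mxEdl, block_mxEdr) !ord1 mxE.
- rewrite block_mxEur mxE /pair_entry (_ : (rshift (1 + 1) j' : nat)./2 = (j'./2).+1) //.
  by case: i' => -[|[|[]]].
- rewrite block_mxEdl mxE /pair_entry (_ : (rshift (1 + 1) i' : nat)./2 = (i'./2).+1) //.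
  by case: j' => -[|[|[]]].
- rewrite block_mxEdr eB /pair_entry /=.
  by rewrite !negbK.
Qed.

Lemma conform_mx_entry (R : Type) d N (B : 'M[R]_N) (A : 'M[R]_d) (f : nat -> nat -> R) :
  d = N -> (forall i j, A i j = f i j) -> forall i j, conform_mx B A i j = f i j.
Proof. by move=> dN; subst d => eA i j; rewrite conform_mx_id. Qed.

Section PiNormalForm.
Variable k : fieldType.
Local Notation L := (laurent_sf k).

Lemma tag_Pi_blocks (s : seq int) :
  tag (block_diag [seq Pi_block k i | i <- s]) = (size s).*2.
Proof. by elim: s => //= c s ->. Qed.

Lemma Pi_blocks_entry (s : seq int) (i j : 'I_(tag (block_diag [seq Pi_block k i | i <- s]))) :
  tagged (block_diag [seq Pi_block k i | i <- s]) i j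
  = pair_entry (lz k) (fun t => lz k ^ nth 0 s t) i j.
Proof.
elim: s i j => [|c s IH] i j; first by case: i.
rewrite /= (pair_entry_block (lz k ^ c) IH) /pair_entry.
by case: (i./2 == j./2) => //; case: (i./2).
Qed.

(** There are exactly as many zeros as parts larger than 1, and no part equal to 1, so no block of
    size 1 is left. *)
Lemma Pi_blocks_cat (big : seq int) : all (fun c => 1 < c) big ->
  Pi_blocks k (big ++ nseq (size big) 0) = [seq Pi_block k i | i <- rev big].
Proof.
move=> allb; have big1 c : c \in big -> 1 < c by move/allP: allb; exact.
have c0 : count_mem 0 big = 0%N.
  by apply/count_memPn/negP => /big1; rewrite ltr10.
have c1 : count_mem 1 big = 0%N.
  by apply/count_memPn/negP => /big1; rewrite ltxx.
have n0 : count_mem (0 : int) (nseq (size big) 0) = size big.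
  by rewrite count_nseq /= mul1n.
have n1 : count_mem (1 : int) (nseq (size big) 0) = 0%N by rewrite count_nseq.
have ff : [seq c <- nseq (size big) 0 | (1 : int) < c] = [::] by elim: (size big).
rewrite /Pi_blocks filter_cat (all_filterP allb) ff cats0 !count_cat c0 c1 n0 n1.
by rewrite add0n subnn.
Qed.

Hypothesis k2 : 2%N \notin [pchar k].

Lemma Pi_normal_form (n : nat) (big : seq int) : size big = n ->
  all (fun c => 1 < c) big ->
  dcos (L := L) (Pi_mx k (n + n) (big ++ nseq n 0))
       (Xm L (fun t : 'I_n => nth 0 (rev big) t - 1)).
Proof.
move=> sb allb; subst n.
set n := size big.
(* Puts the even rows and columns before the odd ones, which turns the sequence of 2 by 2 blocks
   into the 2 by 2 block form of [rho_mx]. *)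
pose f (x : 'I_(n + n)) : nat :=
  match fintype.split x with inl t => t.*2 | inr t => t.*2.+1 end.
have fl t : f (lshift n t) = t.*2 by rewrite /f (unsplitK (inl t)).
have fr t : f (rshift n t) = t.*2.+1 by rewrite /f (unsplitK (inr t)).
have fn x : (f x < n + n)%N.
  by case: (fintype.split_ordP x) => t ->; rewrite ?fl ?fr addnn ?ltn_Sdouble ?ltn_double.
have f_inj : injective (fun x => Ordinal (fn x)).
  move=> x y /(congr1 val) /=.
  case: (fintype.split_ordP x) => t ->; case: (fintype.split_ordP y) => u ->;
    rewrite ?fl ?fr.
  - by move/double_inj/val_inj ->.
  - by move/(congr1 odd); rewrite /= !odd_double.
  - by move/(congr1 odd); rewrite /= !odd_double.
  - by case=> /double_inj/val_inj ->.
apply: dcos_sym; apply: dcos_trans (dcos_sym (rho_normal_form L k2 _)) _.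
  move=> t; have := allP allb (nth 0 (rev big) t).
  by rewrite -mem_rev mem_nth ?size_rev // => /(_ isT); lia.
apply: (@dcos_reindex _ L _ (perm f_inj)) => x y.
have eP i j : Pi_mx k (n + n) (big ++ nseq n 0) i j =
    pair_entry (lz k) (fun t => lz k ^ nth 0 (rev big) t) i j.
  apply: conform_mx_entry; rewrite Pi_blocks_cat //.
    by rewrite tag_Pi_blocks size_rev addnn.
  exact: Pi_blocks_entry.
rewrite eP !permE /=.
rewrite /rho_mx /pair_entry.
case: (fintype.split_ordP x) => t ->; case: (fintype.split_ordP y) => u ->;
  rewrite ?(block_mxEul, block_mxEur, block_mxEdl, block_mxEdr) ?fl ?fr /=;
  rewrite ?uphalf_double ?doubleK ?odd_double /= !mxE ?(inj_eq val_inj);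
  by case: (t == u); rewrite ?mulr0n ?mulr1n ?subrK.
Qed.
Lemma Xm_eq n (beta beta' : 'I_n -> int) : beta =1 beta' -> Xm L beta = Xm L beta'.
Proof. by move=> e; rewrite /Xm (eq_dg _ e). Qed.

Lemma Pi_nu_normal_form (n : nat) (a : int) : 1 < a ->
  dcos (L := L) (Pi_mx k (n + n) (nseq n a ++ nseq n 0)) (Xm L (fun _ : 'I_n => a - 1)).
Proof.
move=> a1; have h := @Pi_normal_form n (nseq n a) (size_nseq _ _).
rewrite (Xm_eq (beta' := fun t : 'I_n => nth 0 (rev (nseq n a)) t - 1)).
  by apply: h; rewrite all_nseq a1 orbT.
by move=> t; rewrite rev_nseq nth_nseq ltn_ord.
Qed.

Lemma Pi_lambda_normal_form (m : nat) (a : int) (i j : nat) : j%:Z < a - 1 ->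
  let n := m.+2 in
  dcos (L := L) (Pi_mx k (n + n) (((a + i%:Z) :: nseq m a ++ [:: a - j%:Z]) ++ nseq n 0))
    (Xm L (fun t : 'I_n => a - 1 + d2 i%:Z (- j%:Z) t)).
Proof.
move=> ja n; set big := _ :: _.
have sb : size big = n by rewrite /big /= size_cat size_nseq addn1.
apply: dcos_trans (Pi_normal_form sb _) _.
  by rewrite /big /= all_cat all_nseq /= andbT; apply/and3P; split; lia.
(* Reversal puts a - j first and a + i last; the cyclic shift brings a + i to index 0 and a - j to
   index 1, as in [d2]. *)
apply: (@Xm_perm _ _ k2 _ _ _ (perm (@ordS_inj m.+2))) => t.
have -> : rev big = (a - j%:Z) :: rcons (nseq m a) (a + i%:Z).
  by rewrite /big rev_cons rev_cat rev_nseq.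
rewrite permE /d2 /=; case: t => -[|t] tn /=.
  by ring.
rewrite nth_rcons size_nseq nth_nseq.
have [tm|mt] := ltnP t m; first by rewrite modn_small /=; [ring|lia].
have -> : t = m by lia.
by rewrite eqxx modnn /=; ring.
Qed.

End PiNormalForm.

(** * Truncated series and normalised vectors *)

Section FirstIndex.
Variable l : nat.
Implicit Type P : pred nat.

(** Equal to l when [P] holds nowhere below l: this models the valuation in O/z^l, where 0 has
    valuation l. *)
Definition first_index P : nat := find P (iota 0 l).

Lemma first_index_le P : (first_index P <= l)%N.
Proof. by have := find_size P (iota 0 l); rewrite size_iota. Qed.

Lemma first_indexP P : (first_index P < l)%N -> P (first_index P).
Proof.
move=> vl; have hs : has P (iota 0 l) by rewrite has_find size_iota.
by have := nth_find 0%N hs; rewrite nth_iota.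
Qed.

Lemma first_index_geP P r : (r <= l)%N ->
  reflect (forall i, (i < r)%N -> ~~ P i) (r <= first_index P)%N.
Proof.
move=> rl; apply: (iffP idP) => [rv i ir|h].
  have := before_find 0%N (leq_trans ir rv); rewrite nth_iota ?add0n => [->//|].
  exact: leq_trans ir rl.
rewrite leqNgt; apply/negP => vr; move: (h _ vr).
by rewrite first_indexP // (leq_trans vr).
Qed.

Lemma first_index_lt P i : (i < first_index P)%N -> ~~ P i.
Proof. by move: i; apply/first_index_geP; rewrite ?first_index_le. Qed.

End FirstIndex.

Section Truncated.
Variables (k : fieldType) (l : nat).
Local Notation O := (fpseries k).
Local Notation A := {ffun 'I_l -> k}.
Implicit Types (c : A) (f g : O).

Definition ext c : O := FPSeries (fun i => oapp c 0 (insub i)).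
Definition trunc f : A := [ffun i : 'I_l => fps_coef f i].

Lemma ext_coef c (i : 'I_l) : fps_coef (ext c) i = c i.
Proof. by rewrite /= valK. Qed.

Lemma ext_coef_ge c i : (l <= i)%N -> fps_coef (ext c) i = 0.
Proof. by move=> li; rewrite /= insubF // ltnNge li. Qed.

Lemma extK : cancel ext trunc.
Proof. by move=> c; apply/ffunP => i; rewrite ffunE ext_coef. Qed.

Lemma truncP f g : trunc f = trunc g <-> exists h, f = g + fps_z k ^+ l * h.
Proof.
split=> [e|[h ->]]; last first.
  by apply/ffunP => i; rewrite !ffunE fps_coefD fps_coef_Xz ltn_ord addr0.
exists (fps_shift l (f - g)); rewrite -fps_shiftP ?(addrC g) ?subrK //.
move=> i il; have := congr1 (fun c : A => c (Ordinal il)) e.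
by rewrite !ffunE fps_coefD fps_coefN /= => ->; rewrite subrr.
Qed.

Definition val_trunc c : nat := first_index l (fun i => fps_coef (ext c) i != 0).

Lemma ext_val c r : (r <= val_trunc c)%N -> ext c = fps_z k ^+ r * fps_shift r (ext c).
Proof.
move=> rv; apply: fps_shiftP => i ir; apply/eqP/negPn.
exact: first_index_lt (leq_trans ir rv).
Qed.

Lemma val_trunc_unit c : (val_trunc c < l)%N ->
  fps_shift (val_trunc c) (ext c) \is a GRing.unit.
Proof. by move=> vl; rewrite fps_unit_ev0; exact: (first_indexP vl). Qed.

Variable m : nat.
Local Notation n := m.+2.
Local Notation V := {ffun 'I_n -> A}.

Definition extv (v : V) : 'cV[O]_n := \col_i ext (v i).

Definition tail_coef (v : V) (i : nat) : bool :=
  [exists q : 'I_m.+1, fps_coef (ext (v (fintype.lift ord0 q))) i != 0].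

Definition val_tail (v : V) : nat := first_index l (tail_coef v).

Lemma ext_val_tail (v : V) (q : 'I_m.+1) : ext (v (fintype.lift ord0 q)) =
  fps_z k ^+ val_tail v * fps_shift (val_tail v) (ext (v (fintype.lift ord0 q))).
Proof.
apply: fps_shiftP => i ir; apply/eqP/negPn.
by have /existsPn/(_ q) := first_index_lt ir.
Qed.

Definition val_min (v : V) : nat := minn (val_trunc (v ord0)) (val_tail v).

(* v = z^r (c, z^t w) modulo z^l, with w primitive, r = val_min v and
   r + t = val_tail v. *)
Lemma extv_decomposition (v : V) : let r := val_min v in let t := (val_tail v - r)%N in
  exists (c : O) (a : 'M[O]_m.+1) w1,
  [/\ a \in unitmx, t = 0%N \/ c \is a GRing.unit &
    extv v = fps_z k ^+ r *: (col_mx c%:M (fps_z k ^+ t *: (a *m delta_mx 0 0))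
                                : 'cV_(1 + m.+1)) + fps_z k ^+ l *: w1].
Proof.
move=> r t; have rs : (r <= val_tail v)%N by exact: geq_minr.
have rc : (r <= val_trunc (v ord0))%N by exact: geq_minl.
pose c := fps_shift r (ext (v ord0)).
pose s := val_tail v.
have [a [w1 [ua e]]] : exists (a : 'M[O]_m.+1) w1, a \in unitmx /\
    forall q, ext (v (fintype.lift ord0 q)) =
       fps_z k ^+ s * (a *m delta_mx 0 0 : 'cV_m.+1) q 0 + fps_z k ^+ l * w1 q.
  have [sl|ls] := ltnP s l.
    have /existsP[q0 q0P] := first_indexP sl.
    pose w := \col_q fps_shift s (ext (v (fintype.lift ord0 q))).
    have [|a ua ae] := @unimodular_column O m w q0.
      by rewrite mxE fps_unit_ev0; exact: q0P.
    exists a, (fun=> 0); split=> // q.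
    by rewrite mulr0 addr0 ae mxE; exact: ext_val_tail.
  exists 1%:M, (fun q => - (delta_mx 0 0 : 'cV_m.+1) q 0); rewrite unitmx1; split=> // q.
  have sl : s = l by apply/eqP; rewrite eqn_leq first_index_le.
  rewrite mul1mx mulrN sl subrr; apply: fpsP => i.
  have [il|li] := ltnP i l; last exact: ext_coef_ge.
  by rewrite ext_val_tail -/s sl fps_coef_Xz il.
exists c, a, (\col_i if unlift ord0 i is Some q then w1 q else 0); split=> //.
  have [t0|t0] := eqVneq t 0%N; [by left|right].
  have rv : r = val_trunc (v ord0).
    by rewrite /r /val_min; case: ltngtP t0; rewrite /t /r /val_min => //; lia.
  rewrite /c rv; apply: val_trunc_unit; rewrite -rv.
  by apply: leq_trans (first_index_le l (tail_coef v)); rewrite -/(val_tail v); lia.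
apply/colP => i; rewrite [LHS]mxE [RHS]mxE [X in _ = X + _]mxE.
rewrite [X in _ = _ + X]mxE [X in _ = _ + _ * X]mxE.
case: (unliftP ord0 i) => [q|] ->.
  have -> : fintype.lift ord0 q = rshift 1 q :> 'I_(1 + m.+1) by exact: val_inj.
  rewrite (@col_mxEd _ 1 m.+1 1) [X in _ = _ * X + _]mxE mulrA -exprD subnKC //.
  have -> : rshift 1 q = fintype.lift ord0 q :> 'I_m.+2 by exact: val_inj.
  exact: e.
have -> : ord0 = lshift m.+1 (0 : 'I_1) :> 'I_(1 + m.+1) by exact: val_inj.
rewrite (@col_mxEu _ 1 m.+1 1) mxE eqxx mulr0 addr0.
have -> : lshift m.+1 (0 : 'I_1) = ord0 :> 'I_m.+2 by exact: val_inj.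
exact: ext_val.
Qed.

End Truncated.

(** * Orbits read off from vectors over O/z^l *)

Section TruncatedClass.
Variables (k : fieldType) (L : series_field k) (l m : nat).
Hypothesis k2 : 2%N \notin [pchar k].
Local Notation O := (fpseries k).
Local Notation F := (sf_sort L).
Local Notation n := m.+2.
Local Notation V := {ffun 'I_n -> {ffun 'I_l -> k}}.
Local Notation z := (sf_z L).
Local Notation dg := (dg L).
Local Notation toF := (map_mx (sf_of L)).

(* The integers i and j attached to the vector (s(C v), C e_0), see class_of_pair. *)
Definition shift_up (v : V) : nat := l - minn (val_tail v) (val_min v).*2.
Definition shift_down (v : V) : nat := (val_min v).*2 - minn (val_tail v) (val_min v).*2.

Lemma toF_mxK N (B : 'M[O]_N) : B \in unitmx -> mxK (toF B).
Proof. by move=> uB; exists B. Qed.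

Lemma toF_delta N (i : 'I_N) : toF (delta_mx i 0 : 'cV_N) = delta_mx i 0.
Proof. exact: map_delta_mx. Qed.

Lemma toF_sg p N (B : 'M[O]_(p, N)) :
  toF (map_mx (@fps_sg k) B) = map_mx (sf_sg L) (toF B).
Proof. by apply/matrixP => i j; rewrite !mxE sf_sg_of. Qed.

Lemma toF_zX e N (B : 'cV[O]_N) : toF (fps_z k ^+ e *: B) = z ^ e *: toF B.
Proof. by rewrite map_mxZ rmorphXn. Qed.

Lemma class_of_pair (b : int) (X : 'M[O]_(n + n)) (C : 'M[O]_n) (v : V) w :
  l%:Z < b -> X \in unitmx -> C \in unitmx ->
  X *m delta_mx (lshift _ 0) 0 =
    col_mx (map_mx (@fps_sg k) (C *m extv v)) (C *m delta_mx 0 0)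
    + fps_z k ^+ l *: w ->
  dcos (invmx (Theta L n *m Dm 1%:M (dg (fun=> b))
               *m (toF X *m dg (pv (lshift _ 0) (- l%:Z)))))
       (Xm L (fun i => b + d2 (shift_up v)%:Z (- (shift_down v)%:Z) i)).
Proof.
move=> lb uX uC Xe.
have [c [a [w1 [ua ht e]]]] := extv_decomposition v.
set r := val_min v in e; set t := (val_tail v - r)%N in e ht.
have rs : (r <= val_tail v)%N by exact: geq_minr.
have sl : (val_tail v <= l)%N by exact: first_index_le.
have [||||| D [kD De rp]] := @relpos_exists _ L m l r t (sf_of L c) (toF a).
- by lia.
- by rewrite /t; lia.
- by exists c.
- exact: toF_mxK.
- case: ht => [->|uc]; [by left|right; split].
    by rewrite sf_of_eq0; apply: contraTneq uc => ->; rewrite unitr0.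
  by exists c^-1; rewrite rmorphV.
have -> : shift_up v = (l - r - minn t r)%N by rewrite /shift_up -/r /t; lia.
have -> : shift_down v = (r - minn t r)%N by rewrite /shift_down -/r /t; lia.
apply: (lattice_class (C := toF C) (D := D) (r := r) (w1 := toF w1) (w := toF w)
  (chi := toF (extv v)) (y0 := toF (C *m delta_mx 0 0)) k2 _ lb) => //.
- by lia.
- exact: toF_mxK.
- exact: toF_mxK.
- exact: mxint_map.
- exact: mxint_map.
- exact: mxint_map.
- rewrite e map_mxD !toF_zX De; congr (_ *: _ + _).
  rewrite [LHS](@map_col_mx _ _ _ 1 m.+1) map_scalar_mx toF_zX map_mxM toF_delta.
  by [].
- by rewrite -toF_delta -map_mxM Xe map_mxD toF_zX map_col_mx toF_sg -map_mxM.
- by right; rewrite map_mxM toF_delta.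
Qed.

(** For primitive x one has r = 0, so C can be the identity and the lattice of the second half is
    O^n, whatever y is. *)
Lemma class_of_unimodular (b : int) (X : 'M[O]_(n + n)) (x y : 'cV[O]_n) w p :
  l%:Z < b -> X \in unitmx -> x p 0 \is a GRing.unit ->
  X *m delta_mx (lshift _ 0) 0 = col_mx x y + fps_z k ^+ l *: w ->
  dcos (invmx (Theta L n *m Dm 1%:M (dg (fun=> b))
               *m (toF X *m dg (pv (lshift _ 0) (- l%:Z)))))
       (Xm L (fun i => b + d2 l%:Z 0 i)).
Proof.
move=> lb uX ux Xe.
have [|D uD De] := @unimodular_column O m.+1 (map_mx (@fps_sg k) x) p.
  by rewrite mxE fps_unit_ev0 fps_ev0_sg -fps_unit_ev0.
apply: (lattice_class (C := 1%:M) (D := toF D) (r := 0) (w1 := 0) (w := toF w)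
  (chi := toF (map_mx (@fps_sg k) x)) (y0 := toF y) k2 _ lb) => //.
- exact: toF_mxK.
- exact: mxK1.
- exact: toF_mxK.
- exact: mxint_map.
- exact: mxint0.
- exact: mxint_map.
- by rewrite scaler0 addr0 expr0z scale1r -toF_delta -map_mxM De.
- by rewrite mul1mx toF_sg map_mx_sgK -toF_delta -map_mxM Xe map_mxD toF_zX map_col_mx.
- by left.
- exact/relpos0/toF_mxK.
Qed.

End TruncatedClass.

(** * Cosets of K as primitive vectors modulo z^l and units *)

Section Cosets.
Variables (k : fieldType) (L : series_field k) (l N : nat) (p0 : 'I_N).
Local Notation O := (fpseries k).
Local Notation F := (sf_sort L).
Local Notation z := (sf_z L).
Local Notation dg := (dg L).
Local Notation toF := (map_mx (sf_of L)).
Local Notation e0 := (delta_mx p0 0 : 'cV[O]_N).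
Local Notation P := (dg (pv p0 (- l%:Z))).

(** The coset of X P is the lattice O^N + z^-l (X e_0) O, so it depends only on the line of X e_0
    modulo z^l. *)
Lemma unimodular_coset (X X' : 'M[O]_N) e w : X \in unitmx -> X' \in unitmx ->
  X' *m e0 = e *: (X *m e0) + fps_z k ^+ l *: w ->
  exists2 K, mxK K & toF X' *m P = toF X *m P *m K.
Proof.
move=> uX uX' Xe; have z0 := sf_z_neq0 L.
pose Y := invmx X *m X'.
have uY : Y \in unitmx by rewrite unitmx_mul unitmx_inv uX.
have Ye i : Y i p0 = e * (i == p0)%:R + fps_z k ^+ l * (invmx X *m w) i 0.
  have -> : Y i p0 = (Y *m e0) i (0 : 'I_1) by rewrite -colE [RHS]mxE.
  rewrite /Y -mulmxA Xe mulmxDr -!scalemxAr mulKmx //.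
  by rewrite !mxE eqxx andbT.
(* Negative powers of z can appear only in the column [p0] off the diagonal, where [Ye] provides the
   divisibility by z^l. *)
exists (dg (pv p0 l%:Z) *m toF Y *m P).
  apply/mxK_intdet; split.
    move=> i j; rewrite dgEr dgEl mxE /pv.
    have [->|jp] := eqVneq j p0; last first.
      rewrite expr0z mulr1; apply: lintM; last exact: lint_of.
      by case: eqP => _; apply: lint_zXz.
    have [_|ip] := eqVneq i p0.
      by rewrite mulrAC -expfzDr // subrr expr0z mul1r; exact: lint_of.
    rewrite Ye (negbTE ip) mulr0 add0r rmorphM rmorphXn expr0z mul1r mulrAC.
    by rewrite exprnP -expfzDr // subrr expr0z mul1r; exact: lint_of.
  have -> : (0 : int) = l%:Z + 0 + (- l%:Z) by rewrite addr0 subrr.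
  apply: mxdetM; last by have := mxdet_dg L (pv p0 (- l%:Z)); rewrite sum_pv.
  apply: mxdetM; first by have := mxdet_dg L (pv p0 l%:Z); rewrite sum_pv.
  by have /mxK_intdet[] : mxK (toF Y) by exact: toF_mxK.
have PP : P *m dg (pv p0 l%:Z) = 1%:M.
  by rewrite dgM -dg0; apply: eq_dg => i; rewrite pvD addNr /pv if_same.
rewrite !mulmxA -(mulmxA (toF X) P) PP mulmx1.
by rewrite /Y -map_mxM mulmxA mulmxV // mul1mx.
Qed.

Lemma coset_unimodular (X X' : 'M[O]_N) K : (0 < l)%N -> X \in unitmx ->
  X' \in unitmx -> mxK K -> toF X' *m P = toF X *m P *m K ->
  exists e w, e \is a GRing.unit /\
    X' *m e0 = e *: (X *m e0) + fps_z k ^+ l *: w.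
Proof.
move=> l0 uX uX' [B [uB ->]] eq1; have z0 := sf_z_neq0 L.
pose e := B p0 p0.
pose w := X *m (\col_i (if i == p0 then 0 else B i p0)).
have eqX : X' *m e0 = e *: (X *m e0) + fps_z k ^+ l *: w.
  rewrite /w !scalemxAr -mulmxDr.
  apply/colP => i; apply: (@sf_of_inj _ L).
  have := congr1 (fun M : 'M[F]_N => M i p0) eq1.
  rewrite dgEr mxE /pv eqxx -mulmxA => /(congr1 (fun x => x * z ^ l%:Z)).
  rewrite -mulrA -expfzDr // addNr expr0z mulr1.
  have -> : X' i p0 = (X' *m e0) i (0 : 'I_1) by rewrite -colE [RHS]mxE.
  move=> ->; rewrite [X in X * _]mxE [in RHS]mxE mulr_suml rmorph_sum.
  apply: eq_bigr => j _; rewrite rmorphM mxE -mulrA dgEl; congr (_ * _).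
  rewrite !mxE /pv eqxx andbT; have [->|jp] := eqVneq j p0.
    by rewrite mulr1 mulr0 addr0 mulrAC -expfzDr // addNr expr0z mul1r.
  by rewrite mulr0 add0r rmorphM rmorphXn expr0z mul1r mulrC.
exists e, w; split=> //.
(* If e vanished modulo z, so would X' e_0, because l > 0; this contradicts the invertibility of
   X'. *)
rewrite fps_unit_ev0; apply/eqP => ev_e.
have : map_mx (@fps_ev0 k) (X' *m e0) = 0.
  rewrite eqX map_mxD !map_mxZ rmorphXn [X in X ^+ l](fps_ev0_z k) expr0n gtn_eqF //.
  by rewrite [X in X *: _]ev_e !scale0r addr0.
rewrite map_mxM => /(congr1 (mulmx (map_mx (@fps_ev0 k) (invmx X')))).
rewrite mulmxA -map_mxM mulVmx // map_mx1 mul1mx mulmx0 map_delta_mx.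
by move/matrixP/(_ p0 0) => /eqP; rewrite !mxE !eqxx oner_eq0.
Qed.

Lemma unimodular_unit_coord (X : 'M[O]_N) : X \in unitmx ->
  exists i, (X *m e0) i (0 : 'I_1) \is a GRing.unit.
Proof.
move=> uX; apply: contrapT => no.
have : map_mx (@fps_ev0 k) (X *m e0) = 0.
  apply/colP => i; rewrite mxE [RHS]mxE; apply/eqP/negPn/negP => h; apply: no.
  by exists i; rewrite fps_unit_ev0.
rewrite map_mxM => /(congr1 (mulmx (map_mx (@fps_ev0 k) (invmx X)))).
rewrite mulmxA -map_mxM mulVmx // map_mx1 mul1mx mulmx0 map_delta_mx.
by move/matrixP/(_ p0 0) => /eqP; rewrite !mxE !eqxx oner_eq0.
Qed.

End Cosets.

(** * Normalised representatives of the cosets *)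

Section Representatives.
Variables (k : fieldType) (l m : nat).
Hypothesis l0 : (0 < l)%N.
Local Notation O := (fpseries k).
Local Notation A := {ffun 'I_l -> k}.
Local Notation n := m.+2.
Local Notation V := {ffun 'I_n -> A}.
Local Notation ev c := (fps_coef (ext c) 0).

Definition truncv (x : 'cV[O]_n) : V := [ffun i => trunc l (x i 0)].

Lemma truncvP (x y : 'cV[O]_n) :
  truncv x = truncv y <-> exists w, x = y + fps_z k ^+ l *: w.
Proof.
split=> [e|[w ->]]; last first.
  by apply/ffunP => i; rewrite !ffunE; apply/truncP; exists (w i 0); rewrite !mxE.
have h i : exists h, x i 0 = y i 0 + fps_z k ^+ l * h.
  by apply/truncP; move/ffunP/(_ i): e; rewrite !ffunE.
exists (\col_i projT1 (cid (h i))); apply/colP => i; rewrite !mxE.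
by case: cid.
Qed.

Lemma extvK (y : V) : truncv (extv y) = y.
Proof. by apply/ffunP => i; rewrite ffunE mxE extK. Qed.

Lemma extv_truncv (x : 'cV[O]_n) : exists w, extv (truncv x) = x + fps_z k ^+ l *: w.
Proof. by apply/truncvP; rewrite extvK. Qed.

Lemma ev_trunc (f : O) : ev (trunc l f) = fps_ev0 f.
Proof. by rewrite (ext_coef _ (Ordinal l0)) ffunE. Qed.

Lemma ext_trunc1 : ext (trunc l 1) = 1 :> O.
Proof.
apply: fpsP => i; have [il|li] := ltnP i l.
  by rewrite (ext_coef _ (Ordinal il)) ffunE.
by rewrite ext_coef_ge // fps_coef1 gtn_eqF // (leq_trans l0).
Qed.

(* The first invertible coordinate has index p and is equal to 1. *)
Definition normal_at (p q : 'I_n) : pred A :=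
  [pred c | if (q < p)%N then ev c == 0 else (q == p) ==> (c == trunc l 1)].

Definition pivot_normal p : pred V := family (normal_at p).

Lemma normal_lt p (y : V) (q : 'I_n) : y \in pivot_normal p -> (q < p)%N -> ev (y q) = 0.
Proof. by move=> /familyP/(_ q); rewrite inE => + qp; rewrite qp => /eqP. Qed.

Lemma normal_pivot p (y : V) : y \in pivot_normal p -> ext (y p) = 1.
Proof.
by move=> /familyP/(_ p); rewrite inE ltnn eqxx /= => /eqP ->; rewrite ext_trunc1.
Qed.

Lemma normal_exists (x : 'cV[O]_n) q0 : x q0 0 \is a GRing.unit ->
  exists p y e w, [/\ y \in pivot_normal p, e \is a GRing.unit &
    x = e *: extv y + fps_z k ^+ l *: w].
Proof.
move=> uq0; pose U q := x q 0 \is a GRing.unit.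
have [p up minp] := @arg_minnP _ q0 U (fun q => val q) uq0.
pose e := x p 0; exists p, (truncv (e^-1 *: x)), e.
have [w we] := extv_truncv (e^-1 *: x); exists (- e *: w); split=> //.
  apply/familyP => q; rewrite inE ffunE ev_trunc mxE; case: ifP => qp.
    rewrite rmorphM mulf_eq0; apply/orP; right; apply/negPn/negP => h.
    by have := minp q; rewrite /U fps_unit_ev0 h => /(_ isT); rewrite leqNgt qp.
  by apply/implyP => /eqP ->; rewrite mulVr.
rewrite we scalerDr scalerA mulrV // scale1r -addrA !scalerA -scalerDl.
by rewrite mulrN mulrC subrr scale0r addr0.
Qed.

Lemma extv_ev (y y' : V) (e : O) w (q : 'I_n) :
  extv y = e *: extv y' + fps_z k ^+ l *: w -> ev (y q) = fps_ev0 e * ev (y' q).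
Proof.
move=> /colP/(_ q); rewrite !mxE => /(congr1 (@fps_ev0 k)).
rewrite rmorphD !rmorphM rmorphXn.
by rewrite [X in X ^+ l](fps_ev0_z k) expr0n gtn_eqF // mul0r addr0.
Qed.

(** The pivot is the first coordinate invertible modulo z, hence invariant under a unit factor; both
    vectors are 1 there, so e = 1 modulo z^l. *)
Lemma normal_uniq p (y : V) p' (y' : V) e w : y \in pivot_normal p -> y' \in pivot_normal p' ->
  e \is a GRing.unit -> extv y = e *: extv y' + fps_z k ^+ l *: w ->
  [/\ p = p', y = y' & exists h, e = 1 + fps_z k ^+ l * h].
Proof.
move=> ny ny' ue eq1; rewrite fps_unit_ev0 in ue.
have eqq q : ext (y q) = e * ext (y' q) + fps_z k ^+ l * w q 0.
  by move/colP/(_ q): eq1; rewrite !mxE.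
have evq q : ev (y q) = fps_ev0 e * ev (y' q) by exact: extv_ev eq1.
have pp : p = p'.
  apply/val_inj; case: (ltngtP p p') => // h.
    have := evq p; rewrite (normal_pivot ny) (normal_lt ny' h) mulr0 => /eqP.
    by rewrite fps_coef1 oner_eq0.
  have := evq p'; rewrite (normal_pivot ny') (normal_lt ny h) fps_coef1 mulr1.
  by move=> /esym/eqP; rewrite (negbTE ue).
subst p'; have e1 : e = 1 + fps_z k ^+ l * (- w p 0).
  have := eqq p; rewrite (normal_pivot ny) (normal_pivot ny') mulr1 => ->.
  by rewrite mulrN addrK.
split=> //; last by exists (- w p 0).
rewrite -(extvK y) -(extvK y'); apply/truncvP.
exists (- w p 0 *: extv y' + w).
by rewrite eq1 e1 scalerDl scale1r -addrA scalerDr scalerA.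
Qed.

(* Junk value 1 when [x] is not unimodular. *)
Definition completion N (p : 'I_N) (x : 'cV[O]_N) : 'M[O]_N :=
  if pselect (exists X : 'M[O]_N, X \in unitmx /\ X *m delta_mx p 0 = x) is left h
  then projT1 (cid h) else 1%:M.

Lemma completion_unit N p (x : 'cV[O]_N) : @completion N p x \in unitmx.
Proof.
rewrite /completion; case: pselect => [h|_]; last exact: unitmx1.
by case: (cid h) => X [].
Qed.

Lemma completionE N (x : 'cV[O]_N.+1) q : x q 0 \is a GRing.unit ->
  completion 0 x *m delta_mx 0 0 = x.
Proof.
move=> uq; rewrite /completion; case: pselect => [h|].
  by case: (cid h) => X [].
by case; have [X uX Xe] := unimodular_column uq; exists X.
Qed.

(* The second component is the pivot of the normalised half of the vector: its second
   half if the boolean is true, its first half (the second one being 0 modulo z)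
   otherwise. *)
Definition param := (bool * 'I_n * V * V)%type.

Definition par_valid (t : param) : bool :=
  let: (b, p, y, v) := t in (y \in pivot_normal p) && (b || [forall q, ev (v q) == 0]).

(** For a true boolean the first half x is recorded as v = C^-1 s(x), where C has first column y.
    Every v is allowed, and the orbit depends on v only, so the count for v is the same for all
    y. *)
Definition par_vec (t : param) : 'cV[O]_(n + n) :=
  let: (b, p, y, v) := t in
  let C := completion 0 (extv y) in
  if b then col_mx (map_mx (@fps_sg k) (C *m extv v)) (C *m delta_mx 0 0)
  else col_mx (extv y) (extv v).

Definition par_mx (t : param) : 'M[O]_(n + n) :=
  completion (lshift n ord0) (par_vec t).

Definition par_up (t : param) : nat :=
  let: (b, p, y, v) := t in if b then shift_up v else l.
Definition par_down (t : param) : nat :=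
  let: (b, p, y, v) := t in if b then shift_down v else 0.

Lemma normal_unit p (y : V) : y \in pivot_normal p -> extv y p 0 \is a GRing.unit.
Proof. by move=> ny; rewrite mxE (normal_pivot ny) unitr1. Qed.

Lemma par_mxE t : par_valid t -> par_mx t *m delta_mx (lshift n ord0) 0 = par_vec t.
Proof.
have -> : lshift n ord0 = 0 :> 'I_(n + n) by exact: val_inj.
have e0 : lshift n (ord0 : 'I_n) = 0 :> 'I_(n + n) by exact: val_inj.
case: t => -[[b p] y] v /= /andP[ny _]; rewrite /par_mx e0.
case: b => /=.
  apply: (@completionE _ _ (rshift n p)).
  by rewrite (@col_mxEd _ n n 1) (completionE (normal_unit ny)) normal_unit.
by apply: (@completionE _ _ (lshift n p)); rewrite (@col_mxEu _ n n 1) normal_unit.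
Qed.

Lemma par_exists (X : 'M[O]_(n + n)) : X \in unitmx ->
  exists t e w, [/\ par_valid t, e \is a GRing.unit &
    X *m delta_mx (lshift n ord0) 0 = e *: par_vec t + fps_z k ^+ l *: w].
Proof.
move=> uX; set x := X *m _.
have [q0 uq0] : exists q, x q 0 \is a GRing.unit by exact: unimodular_unit_coord.
rewrite -(vsubmxK x); set x1 := usubmx x; set x2 := dsubmx x.
have [[q uq]|no] := pselect (exists q, x2 q 0 \is a GRing.unit).
  have [p [y [e [w [ny ue x2E]]]]] := normal_exists uq.
  pose C := completion 0 (extv y).
  have uC : C \in unitmx by exact: completion_unit.
  have [w' vE] := extv_truncv (invmx C *m map_mx (@fps_sg k) (e^-1 *: x1)).
  pose v := truncv (invmx C *m map_mx (@fps_sg k) (e^-1 *: x1)).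
  (* Compensates the truncation error z^l w' in [v], which s turns into (-1)^l z^l s(C w'). *)
  pose w1 := - (e * (-1) ^+ l) *: map_mx (@fps_sg k) (C *m w').
  exists (true, p, y, v), e, (col_mx w1 w); split=> //=; first by rewrite ny.
  rewrite -/C (completionE (normal_unit ny)) !scale_col_mx add_col_mx -x2E; congr col_mx.
  rewrite /v vE mulmxDr mulKVmx // -scalemxAr map_mxD.
  have -> : map_mx (@fps_sg k) (map_mx (@fps_sg k) (e^-1 *: x1)) = e^-1 *: x1.
    by apply/matrixP => i j; rewrite !mxE fps_sgK.
  rewrite map_mxZ rmorphXn /= fps_sg_z.
  rewrite scalerDr scalerA mulrV // scale1r /w1 !scalerA -addrA -scalerDl.
  by rewrite (exprNn (fps_z k)) [X in _ + X *: _](_ : _ = 0) ?scale0r ?addr0 //; ring.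
have uq1 : exists q, x1 q 0 \is a GRing.unit.
  move: uq0; rewrite -[x]vsubmxK; case: (fintype.split_ordP q0) => q ->.
    by rewrite col_mxEu => uq; exists q.
  by rewrite col_mxEd => uq; case: no; exists q.
case: uq1 => q uq; have [p [y [e [w [ny ue x1E]]]]] := normal_exists uq.
have [w' vE] := extv_truncv (e^-1 *: x2).
exists (false, p, y, truncv (e^-1 *: x2)), e, (col_mx w (- e *: w')); split=> //.
  rewrite /par_valid ny; apply/forallP => q'; rewrite ffunE ev_trunc mxE rmorphM mulf_eq0.
  apply/orP; right; apply/negPn/negP => h; apply: no; exists q'.
  by rewrite fps_unit_ev0.
rewrite /par_vec !scale_col_mx add_col_mx -x1E; congr col_mx.
rewrite vE scalerDr scalerA mulrV // scale1r !scalerA -addrA -scalerDl.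
by rewrite [X in _ + X *: _](_ : _ = 0) ?scale0r ?addr0 //; ring.
Qed.

Lemma par_inj t t' e w : par_valid t -> par_valid t' -> e \is a GRing.unit ->
  par_vec t = e *: par_vec t' + fps_z k ^+ l *: w -> t = t'.
Proof.
have dsub (c : 'cV[O]_(n + n)) : e *: c + fps_z k ^+ l *: w =
    col_mx (e *: usubmx c + fps_z k ^+ l *: usubmx w)
           (e *: dsubmx c + fps_z k ^+ l *: dsubmx w).
  by rewrite -add_col_mx -!scale_col_mx !vsubmxK.
case: t t' => -[[b p] y] v [[[b' p'] y'] v'] /= /andP[ny nv] /andP[ny' nv'] ue.
rewrite dsub; case: b nv => nv; case: b' nv' => nv' /eq_col_mx[];
  rewrite ?col_mxKu ?col_mxKd ?(completionE (normal_unit ny))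
    ?(completionE (normal_unit ny')) => e1 e2.
- have [pp yy [h eh]] := normal_uniq ny ny' ue e2; subst p' y'.
  congr (_, _, _, _); set C := completion 0 _ in e1.
  have uC : C \in unitmx by exact: completion_unit.
  have := congr1 (map_mx (@fps_sg k)) e1; rewrite map_mxD !map_mxZ.
  have sK (c : 'cV[O]_n) : map_mx (@fps_sg k) (map_mx (@fps_sg k) c) = c.
    by apply/matrixP => i j; rewrite !mxE fps_sgK.
  rewrite !sK => /(congr1 (mulmx (invmx C))); rewrite mulmxDr -!scalemxAr !mulKmx // => e3.
  rewrite -(extvK v) -(extvK v'); apply/truncvP.
  (* From e = 1 + z^l h one gets s(e) = 1 + (-1)^l z^l s(h), so s(e) still acts trivially modulo
     z^l. *)
  exists ((-1) ^+ l *: (fps_sg h *: extv v' + invmx C *m map_mx (@fps_sg k) (usubmx w))).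
  rewrite e3 eh rmorphD rmorph1 rmorphM rmorphXn /= fps_sg_z scalerDl scale1r -addrA.
  congr (_ + _); rewrite (exprNn (fps_z k)) !scalerDr !scalerA.
  by rewrite (mulrC ((-1) ^+ l)).
(* Distinct booleans are incompatible: the second half is nonzero modulo z on one side only. *)
- have := extv_ev p e2; rewrite (normal_pivot ny) fps_coef1.
  have -> : ev (v' p) = 0 by move/forallP/(_ p)/eqP: nv'.
  by rewrite mulr0 => /eqP; rewrite oner_eq0.
- have := extv_ev p' e2; rewrite (normal_pivot ny') fps_coef1 mulr1.
  have -> : ev (v p') = 0 by move/forallP/(_ p')/eqP: nv.
  move=> /esym/eqP.
  by move: ue; rewrite fps_unit_ev0 => /negbTE ->.
- have [pp yy [h eh]] := normal_uniq ny ny' ue e1; subst p' y'.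
  congr (_, _, _, _); rewrite -(extvK v) -(extvK v'); apply/truncvP.
  exists (h *: extv v' + dsubmx w).
  by rewrite e2 eh scalerDl scale1r -addrA scalerDr scalerA.
Qed.

Lemma par_class (L : series_field k) (b : int) (t : param) :
  2%N \notin [pchar k] -> l%:Z < b -> par_valid t ->
  dcos (invmx (Theta L n *m Dm 1%:M (dg L (fun=> b))
     *m (map_mx (sf_of L) (par_mx t) *m dg L (pv (lshift n ord0) (- l%:Z)))))
    (Xm L (fun i => b + d2 (par_up t)%:Z (- (par_down t)%:Z) i)).
Proof.
move=> k2 lb vt; have te := par_mxE vt; move: vt te.
have ux : par_mx t \in unitmx by exact: completion_unit.
case: t ux => -[[c p] y] v ux /= /andP[ny _]; case: c ux => ux te.
  apply: (@class_of_pair _ _ _ _ k2 b (par_mx _) (completion 0 (extv y)) v 0) => //.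
    exact: completion_unit.
  by rewrite te scaler0 addr0.
rewrite oppr0; apply: (@class_of_unimodular _ _ _ _ k2 b (par_mx _) (extv y) (extv v) 0 p) => //.
  exact: normal_unit.
by rewrite te scaler0 addr0.
Qed.

Lemma par_down_le t : (par_down t <= l)%N.
Proof.
case: t => -[[b p] y] v; rewrite /par_down; case: b => //; rewrite /shift_down.
have h : (val_tail v <= l)%N by exact: first_index_le.
have : (val_min v <= val_tail v)%N by exact: geq_minr.
lia.
Qed.

End Representatives.

(** * Counting *)

Lemma card_value_eq (T : finType) (P : pred T) (f : T -> nat) s :
  #|[pred v | P v & f v == s]| =
  (#|[pred v | P v & (s <= f v)%N]| - #|[pred v | P v & (s < f v)%N]|)%N.
Proof.
rewrite -(cardID [pred v | (s < f v)%N] [pred v | P v & (s <= f v)%N]).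
rewrite [X in (X + _)%N](_ : _ = #|[pred v | P v & (s < f v)%N]|); last first.
  apply: eq_card => v; rewrite !inE; case: (P v) => //=.
  by case: (ltnP s (f v)) => h; rewrite ?andbF // andbT ltnW.
rewrite addKn; apply: eq_card => v; rewrite !inE -leqNgt.
by case: (P v); rewrite ?andbF //= eqn_leq.
Qed.

Lemma card_family_prod (aT rT : finType) (F : aT -> pred rT) :
  #|family F| = (\prod_x #|F x|)%N.
Proof. by rewrite card_family foldrE big_map big_enum. Qed.

Lemma prod_threshold l r a b : (r <= l)%N ->
  (\prod_(i < l) (if (i < r)%N then a else b) = a ^ r * b ^ (l - r))%N.
Proof.
move=> rl; rewrite -(big_mkord xpredT (fun i => if (i < r)%N then a else b)).
rewrite (@big_cat_nat _ _ _ r) //=; congr (_ * _)%N.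
  transitivity (\prod_(0 <= i < r) a)%N; last by rewrite prod_nat_const_nat subn0.
  by apply: eq_big_nat => i /andP[_ ->].
rewrite -prod_nat_const_nat; apply: eq_big_nat => i /andP[].
by rewrite leqNgt => /negbTE ->.
Qed.

Section Counting.
Variables (k : finFieldType) (l m : nat).
Local Notation O := (fpseries k).
Local Notation A := {ffun 'I_l -> k}.
Local Notation n := m.+2.
Local Notation V := {ffun 'I_n -> A}.
Local Notation q := #|k|.
Local Notation ev c := (fps_coef (ext c) 0).

Lemma card_val_ge r : (r <= l)%N -> #|[pred c : A | (r <= val_trunc c)%N]| = (q ^ (l - r))%N.
Proof.
move=> rl; pose F (i : 'I_l) : pred k := [pred a | (i < r)%N ==> (a == 0)].
rewrite (_ : #|_| = #|family F|); last first.
  apply: eq_card => c; rewrite inE; apply/first_index_geP/familyP => // h i.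
    rewrite inE; apply/implyP => ir; have := h _ ir.
    by rewrite ext_coef negbK.
  move=> ir; have il := leq_trans ir rl; have := h (Ordinal il).
  by rewrite inE /= ir /= -(ext_coef c (Ordinal il)) negbK.
have -> : (q ^ (l - r) = \prod_(i < l) (if (i < r)%N then 1 else q))%N.
  by rewrite prod_threshold // exp1n mul1n.
rewrite card_family_prod.
apply: eq_bigr => i _; case: ifP => ir.
  by rewrite -(card1 (0 : k)); apply: eq_card => a; rewrite !inE ir.
by apply: eq_card => a; rewrite !inE ir.
Qed.

Lemma val_tail_geP (v : V) s : (s <= l)%N ->
  reflect (forall i : 'I_n, i != ord0 -> (s <= val_trunc (v i))%N) (s <= val_tail v)%N.
Proof.
move=> sl; apply: (iffP (first_index_geP _ sl)) => [h i i0|h j js].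
  apply/first_index_geP => // j js; move: (h j js) => /existsPn.
  by case: (unliftP ord0 i) i0 => [i' ->|->] // _ /(_ i').
apply/existsPn => i; have i0 : fintype.lift ord0 i != ord0 by rewrite eq_sym neq_lift.
by have /first_index_geP := h _ i0; apply.
Qed.

Lemma card_vals_ge r s : (r <= l)%N -> (s <= l)%N ->
  #|[pred v : V | (r <= val_trunc (v ord0))%N & (s <= val_tail v)%N]|
  = (q ^ (l - r) * (q ^ (l - s)) ^ m.+1)%N.
Proof.
move=> rl sl.
pose F (i : 'I_n) : pred A := [pred c | ((if i == ord0 then r else s) <= val_trunc c)%N].
rewrite (_ : #|_| = #|family F|); last first.
  apply: eq_card => v; rewrite inE /=; apply/andP/familyP => [[h1 /val_tail_geP h2] i|h].
    by rewrite inE; have [->//|i0] := eqVneq i ord0; exact: h2.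
  split; first by have := h ord0; rewrite inE eqxx.
  by apply/val_tail_geP => // i /negbTE i0; have := h i; rewrite inE i0.
rewrite card_family_prod big_ord_recl; congr (_ * _)%N; first exact: card_val_ge.
rewrite (eq_bigr (fun=> q ^ (l - s))%N); last by move=> i _; exact: card_val_ge.
by rewrite prod_nat_const card_ord.
Qed.

Lemma card_ev0 : (0 < l)%N -> #|[pred c : A | ev c == 0]| = (q ^ l.-1)%N.
Proof.
move=> l0; rewrite -subn1 -card_val_ge //; apply: eq_card => c; rewrite !inE.
apply/eqP/first_index_geP => // [h [|i]//|h]; first by rewrite h eqxx.
by have := h 0%N isT; rewrite negbK => /eqP.
Qed.

Lemma card_nonunit : (0 < l)%N ->
  #|[pred v : V | [forall i, ev (v i) == 0]]| = ((q ^ l.-1) ^ n)%N.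
Proof.
move=> l0; rewrite (_ : #|_| = #|family (fun _ : 'I_n => [pred c : A | ev c == 0])|); last first.
  by apply: eq_card => v; apply/forallP/familyP => h i; have := h i; rewrite inE.
rewrite card_family_prod (eq_bigr (fun=> q ^ l.-1)%N); last by move=> i _; exact: card_ev0.
by rewrite prod_nat_const card_ord.
Qed.

Lemma card_normal (p : 'I_n) : (0 < l)%N ->
  #|@pivot_normal k l m p| = ((q ^ l.-1) ^ p * (q ^ l) ^ (n - p.+1))%N.
Proof.
move=> l0; have c q' : #|@normal_at k l m p q'| =
    if (q' < p)%N then (q ^ l.-1)%N else if q' == p then 1%N else (q ^ l)%N.
  case: ifP => qp.
    transitivity #|[pred c : A | ev c == 0]|; last exact: card_ev0.
    by apply: eq_card => c; rewrite !inE qp.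
  case: ifP => qq.
    rewrite -(card1 (trunc l (1 : O))); apply: eq_card => c.
    by rewrite !inE qp qq.
  rewrite (_ : #|_| = #|{: A}|); first by rewrite card_ffun card_ord.
  by apply: eq_card => c; rewrite !inE qp qq.
rewrite card_family_prod (eq_bigr _ (fun q' _ => c q')).
rewrite (bigD1 p) //= ltnn eqxx mul1n.
rewrite (eq_bigr (fun q' : 'I_n => if (q' < p)%N then q ^ l.-1 else q ^ l)%N); last first.
  by move=> q' /negbTE ->.
have pn : (p <= n)%N by rewrite ltnW.
(* The full product gives the pivot a factor q^l where the true count has 1; this factor is
   cancelled below. *)
have := prod_threshold (q ^ l.-1) (q ^ l) pn; rewrite (bigD1 p) //= ltnn.
have -> : (n - p = (n - p.+1).+1)%N by rewrite -subSn ?subSS.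
rewrite expnS mulnCA => /eqP; rewrite eqn_pmul2l ?expn_gt0 ?(ltnW (card_finNzRing_gt1 k)) //.
by move/eqP.
Qed.
End Counting.

(** * Numbers of vectors with given invariants *)

Section Totals.
Variables (k : finFieldType) (R : realType) (l m : nat).
Hypothesis l0 : (0 < l)%N.
Local Notation O := (fpseries k).
Local Notation A := {ffun 'I_l -> k}.
Local Notation n := m.+2.
Local Notation V := {ffun 'I_n -> A}.
Local Notation q := (#|k|%:R : R).
Local Notation vc v := (val_trunc (v ord0)).

Lemma q_gt1 : 1 < q.
Proof. by rewrite ltr1n card_finNzRing_gt1. Qed.

Definition vals_ge r s : R := q ^+ (l - r) * q ^+ ((l - s) * m.+1).

Lemma natr_vals_ge r s : (r <= l)%N -> (s <= l)%N ->
  #|[pred v : V | (r <= vc v)%N & (s <= val_tail v)%N]|%:R = vals_ge r s.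
Proof. by move=> rl sl; rewrite card_vals_ge // natrM !natrX /vals_ge exprM. Qed.

Lemma natr_value_eq (P : pred V) (f : V -> nat) s :
  #|[pred v | P v & f v == s]|%:R =
  #|[pred v | P v & (s <= f v)%N]|%:R - #|[pred v | P v & (s < f v)%N]|%:R :> R.
Proof.
rewrite card_value_eq natrB //; apply: subset_leq_card; apply/fintype.subsetP => v.
by rewrite !inE => /andP[-> /ltnW ->].
Qed.

Lemma natr_trunc_eq r s : (r < l)%N -> (s <= l)%N ->
  #|[pred v : V | (s <= val_tail v)%N & vc v == r]|%:R = vals_ge r s - vals_ge r.+1 s.
Proof.
move=> rl sl; rewrite natr_value_eq -!natr_vals_ge //; last exact: ltnW.
by congr (_%:R - _%:R); apply: eq_card => v; rewrite !inE andbC.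
Qed.

Lemma natr_tail_eq r s : (r <= l)%N -> (s < l)%N ->
  #|[pred v : V | (r <= vc v)%N & val_tail v == s]|%:R = vals_ge r s - vals_ge r s.+1.
Proof. by move=> rl sl; rewrite natr_value_eq !natr_vals_ge // ltnW. Qed.

Lemma natr_both_eq r s : (r < l)%N -> (s < l)%N ->
  #|[pred v : V | vc v == r & val_tail v == s]|%:R =
  vals_ge r s - vals_ge r.+1 s - (vals_ge r s.+1 - vals_ge r.+1 s.+1).
Proof.
move=> rl sl; rewrite natr_value_eq -!natr_trunc_eq // ?(ltnW sl) //.
by congr (_%:R - _%:R); apply: eq_card => v; rewrite !inE andbC.
Qed.

Definition shift_count i j : R :=
  #|[pred v : V | shift_up v == i & shift_down v == j]|%:R.

Let vcl (v : V) : (vc v <= l)%N. Proof. exact: first_index_le. Qed.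
Let vtl (v : V) : (val_tail v <= l)%N. Proof. exact: first_index_le. Qed.

(** Solving up = l - d and down = 2 r - d, with up, down > 0 and l - up - down = 2 (t + 1), gives r
    = down + t + 1 and d = r + t + 1 < 2 r. So d is the valuation of the tail, and r < d must be
    that of the first coordinate. *)
Lemma shift_count_generic i j t : l = (i.+1 + j.+1 + t.+1.*2)%N ->
  shift_count i.+1 j.+1 = q ^+ (i.+1 + t) * (q - 1) * (q ^+ (i * m.+1) * (q ^+ m.+1 - 1)).
Proof.
move=> lE; rewrite /shift_count.
rewrite (_ : #|_| = #|[pred v : V | vc v == (j.+1 + t.+1)%N &
    val_tail v == (j.+1 + t.+1.*2)%N]|); last first.
  apply: eq_card => v; rewrite !inE /shift_up /shift_down /val_min.
  by have := vcl v; have := vtl v; move: (vc v) (val_tail v) => x y; lia.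
rewrite natr_both_eq; [|lia|lia]; rewrite /vals_ge.
have -> : (l - (j.+1 + t.+1) = (i.+1 + t).+1)%N by lia.
have -> : (l - (j.+1 + t.+1).+1 = (i.+1 + t))%N by lia.
have -> : (l - (j.+1 + t.+1.*2) = i.+1)%N by lia.
have -> : (l - (j.+1 + t.+1.*2).+1 = i)%N by lia.
by rewrite mulSn !(exprS, exprD); ring.
Qed.

(** Now d = r: the tail has valuation exactly r, and the first coordinate is only bounded below. *)
Lemma shift_count_extreme i j : l = (i.+1 + j.+1)%N ->
  shift_count i.+1 j.+1 = q ^+ i.+1 * (q ^+ (i * m.+1) * (q ^+ m.+1 - 1)).
Proof.
move=> lE; rewrite /shift_count.
rewrite (_ : #|_| = #|[pred v : V | (j.+1 <= vc v)%N & val_tail v == j.+1]|); last first.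
  apply: eq_card => v; rewrite !inE /shift_up /shift_down /val_min.
  by have := vcl v; have := vtl v; move: (vc v) (val_tail v) => x y; lia.
rewrite natr_tail_eq; [|lia|lia]; rewrite /vals_ge.
have -> : (l - j.+1 = i.+1)%N by lia.
have -> : (l - j.+2 = i)%N by lia.
by rewrite mulSn !(exprS, exprD); ring.
Qed.

(** Down = 0 means d = 2 r: the tail is only bounded below by 2 r, and r = t + 1 is the valuation of
    the first coordinate. *)
Lemma shift_count_up i t : l = (i + t.+1.*2)%N ->
  shift_count i 0 = q ^+ (i + t) * (q - 1) * q ^+ (i * m.+1).
Proof.
move=> lE; rewrite /shift_count.
rewrite (_ : #|_| = #|[pred v : V | (t.+1.*2 <= val_tail v)%N & vc v == t.+1]|); last first.
  apply: eq_card => v; rewrite !inE /shift_up /shift_down /val_min.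
  by have := vcl v; have := vtl v; move: (vc v) (val_tail v) => x y; lia.
rewrite natr_trunc_eq; [|lia|lia]; rewrite /vals_ge.
have -> : (l - t.+1 = (i + t).+1)%N by lia.
have -> : (l - t.+2 = i + t)%N by lia.
have -> : (l - t.+1.*2 = i)%N by lia.
by rewrite exprS; ring.
Qed.

(** Up = 0 means d = l: the tail vanishes modulo z^l, and only the valuation of the first coordinate
    is left. *)
Lemma shift_count_down j t : l = (j + t.+1.*2)%N ->
  shift_count 0 j = q ^+ t * (q - 1).
Proof.
move=> lE; rewrite /shift_count.
rewrite (_ : #|_| = #|[pred v : V | (l <= val_tail v)%N & vc v == (j + t.+1)%N]|); last first.
  apply: eq_card => v; rewrite !inE /shift_up /shift_down /val_min.
  by have := vcl v; have := vtl v; move: (vc v) (val_tail v) => x y; lia.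
rewrite natr_trunc_eq; [|lia|lia]; rewrite /vals_ge.
have -> : (l - (j + t.+1) = t.+1)%N by lia.
have -> : (l - (j + t.+1).+1 = t)%N by lia.
by rewrite subnn mul0n exprS; ring.
Qed.

Lemma shift_count_max_down : shift_count 0 l = 1.
Proof.
rewrite /shift_count.
rewrite (_ : #|_| = #|[pred v : V | (l <= vc v)%N & (l <= val_tail v)%N]|); last first.
  apply: eq_card => v; rewrite !inE /shift_up /shift_down /val_min.
  by have := vcl v; have := vtl v; move: (vc v) (val_tail v) => x y; lia.
by rewrite natr_vals_ge // /vals_ge subnn mul1r.
Qed.

(** Here r = 0, so v ranges over the vectors that are nonzero modulo z. *)
Lemma shift_count_max_up : shift_count l 0 = q ^+ (l * n) - q ^+ (l.-1 * n).
Proof.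
rewrite /shift_count.
have -> : q ^+ (l * n) = #|{: V}|%:R.
  by rewrite !card_ffun !card_ord -natrX expnM.
have -> : q ^+ (l.-1 * n) = #|[pred v : V | (1 <= vc v)%N & (1 <= val_tail v)%N]|%:R.
  by rewrite natr_vals_ge // /vals_ge subn1 -exprD mulnS.
rewrite -natrB ?max_card //; congr (_%:R).
rewrite -(cardC [pred v : V | (1 <= vc v)%N & (1 <= val_tail v)%N]) addKn.
apply: eq_card => v; rewrite !inE /shift_up /shift_down /val_min.
by have := vcl v; have := vtl v; move: (vc v) (val_tail v) => x y; lia.
Qed.

(** The number of points of P^(n-1) over O/z^l: [n] points over k, each with q^((l-1)(n-1))
    lifts. *)
Lemma normal_total :
  \sum_(p < n) #|@pivot_normal k l m p|%:R = q ^+ (l.-1 * m.+1) * qnum q n.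
Proof.
have q1 : q - 1 != 0 by rewrite subr_eq0 gt_eqF ?q_gt1.
rewrite /qnum subrX1 mulrAC mulfV // mul1r mulr_sumr (reindex_inj rev_ord_inj) /=.
apply: eq_bigr => p _; rewrite card_normal // natrM !natrX -!exprM -!exprD; congr (_ ^+ _).
have pn : (p < n)%N := ltn_ord p.
have -> : (n - (rev_ord p).+1 = p)%N by rewrite /=; lia.
have -> : (rev_ord p = m.+1 - p :> nat)%N by [].
have aux x y u : (u * x + u.+1 * y = u * (x + y) + y)%N.
  by rewrite mulSn mulnDr addnCA addnC.
by rewrite -[in X in (_ + X)%N](prednK l0) aux subnK.
Qed.

(** For a true boolean the conditions on y and v are independent. A false one contributes only when
    i = l and j = 0, with all v that vanish modulo z. *)
Lemma par_total i j :
  #|[pred t : param k l m | [&& par_valid t, par_up t == i & par_down t == j]]|%:R =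
  q ^+ (l.-1 * m.+1) * qnum q n *
    (shift_count i j + if (i == l) && (j == 0%N) then q ^+ (l.-1 * n) else 0).
Proof.
rewrite -sum1_card natr_sum big_mkcond /=.
pose f (b : bool) (p : 'I_n) (y v : V) : R :=
  (if [&& par_valid (b, p, y, v), par_up (b, p, y, v) == i & par_down (b, p, y, v) == j]
   then 1 else 0).
transitivity (\sum_(b : bool) \sum_p \sum_y \sum_v f b p y v).
  rewrite (pair_bigA _ (fun b p => \sum_y \sum_v f b p y v)) /=.
  rewrite (pair_bigA _ (fun bp y => \sum_v f bp.1 bp.2 y v)) /=.
  rewrite (pair_bigA _ (fun bpy v => f bpy.1.1 bpy.1.2 bpy.2 v)) /=.
  by apply: eq_bigr => -[[[b p] y] v] _.
rewrite big_bool /= mulrDr; congr (_ + _).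
  rewrite -normal_total mulr_suml; apply: eq_bigr => p _.
  rewrite -sum1_card natr_sum mulr_suml [RHS]big_mkcond; apply: eq_bigr => y _.
  rewrite /f /=; case: (y \in pivot_normal p) => /=; last by rewrite big1.
  rewrite mul1r /shift_count -sum1_card natr_sum [RHS]big_mkcond.
  by apply: eq_bigr => v _; rewrite inE.
rewrite -normal_total mulr_suml; apply: eq_bigr => p _.
rewrite -sum1_card natr_sum mulr_suml [RHS]big_mkcond; apply: eq_bigr => y _.
rewrite /f /=; case: (y \in pivot_normal p) => /=; last by rewrite big1.
rewrite mul1r eq_sym [0%N == j]eq_sym.
case: ifP => ij; last by rewrite big1 // => v _; rewrite andbF.
rewrite exprM -!natrX -(card_nonunit k m l0) -sum1_card natr_sum [RHS]big_mkcond.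
by apply: eq_bigr => v _; rewrite andbT inE.
Qed.

End Totals.

(** * Haar measure *)

Lemma mx_denom (k : fieldType) (L : series_field k) m n (A : 'M[sf_sort L]_(m, n)) :
  exists c : nat, mxint (sf_z L ^+ c *: A).
Proof.
pose c i j := projT1 (cid (sf_denom_z (A i j))).
exists (\max_(i < m) \max_(j < n) c i j)%N => i j; rewrite mxE.
have cM : (c i j <= \max_(i < m) \max_(j < n) c i j)%N.
  exact: leq_trans (leq_bigmax j) (leq_bigmax (F := fun i => (\max_(j < n) c i j)%N) i).
rewrite -(subnK cM) exprD -mulrA; apply: lintM; first exact: lint_zX.
by rewrite /c; case: cid.
Qed.

Section Group.
Local Open Scope classical_set_scope.
Variables (k : fieldType) (N : nat).
Local Notation L := (laurent_sf k).
Local Notation G := (GL k N).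

Lemma GL_HP (g : G) : 2%N \notin [pchar k] -> GL_H g <-> mxH (L := L) (GLmx g).
Proof.
move=> k2; split=> [hg|[_ hg] i j].
  split; first exact: GLmx_unit.
  by apply/matrixP => i j; rewrite mxE; exact/laurent_even_lsg/hg.
apply: (lsg_laurent_even k2).
by move/matrixP/(_ i j): hg; rewrite mxE.
Qed.

Lemma double_cosetKH (g x : G) : 2%N \notin [pchar k] ->
  double_coset (@GL_K k N) x (@GL_H k N) g <-> dcos (L := L) (GLmx g) (GLmx x).
Proof.
move=> k2; split=> [[a [b [ka hb ->]]]|[A [B [kA hB e]]]].
  by exists (GLmx a), (GLmx b); split=> //; apply/GL_HP.
exists (MkGL (mxK_unit kA)), (MkGL (proj1 hB)); split=> //.
- by apply/GL_HP.
- exact: val_inj.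
Qed.

Definition coset (g : G) : set G := [set (g * x)%g | x in @GL_K k N].

Lemma cosetP (g x : G) :
  coset g x <-> exists2 K, mxK (L := L) K & GLmx x = GLmx g *m K.
Proof.
split=> [[y Ky <-]|[K kK e]]; first by exists (GLmx y).
by exists (MkGL (mxK_unit kK)) => //; exact: val_inj.
Qed.

(** If z^c x^-1 is integral, then x + z^(c+1) E = x (1 + z (z^c x^-1 E)), and the second factor lies
    in K. *)
Lemma coset_open (g : G) : GL_open (coset g).
Proof.
move=> x /cosetP[K kK xE].
have [c ic] := mx_denom (L := L) (invmx (GLmx x)).
exists c.+1 => h hx; apply/cosetP.
pose E : 'M[L]_N := \matrix_(i, j) sf_of L (projT1 (cid (hx i j))).
have iE : mxint (L := L) E by move=> i j; rewrite mxE; exact: lint_of.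
have hE : GLmx h = GLmx x + sf_z L ^+ c.+1 *: E.
  apply/matrixP => i j; rewrite mxE [in X in _ = _ + X]mxE [X in _ = _ + _ * X]mxE.
  case: cid => f /= fE.
  by apply/eqP; rewrite addrC -subr_eq; apply/eqP.
exists (K *m (1%:M + sf_z L *: (sf_z L ^+ c *: invmx (GLmx x) *m E))).
  by apply: mxKM => //; apply: mxK_near1; exact: mxintM.
rewrite mulmxA -xE mulmxDr mulmx1 hE; congr (_ + _).
rewrite -scalemxAr -!scalemxAl -scalemxAr mulmxA mulmxV ?GLmx_unit // mul1mx.
by rewrite scalerA -exprS.
Qed.

End Group.

(** For y = K0 Y K and P = K0 V^-1 H the two factors [K0] cancel in y^-1 P, which reduces the orbit
    to that of the lattice spanned by V Y. *)
Lemma dcos_translate (k : fieldType) (L : series_field k) n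
    (V K0 Y K H P : 'M[sf_sort L]_n) :
  V \in unitmx -> Y \in unitmx -> mxK K0 -> mxK K -> mxH H ->
  P = K0 *m invmx V *m H -> dcos (invmx (K0 *m Y *m K) *m P) (invmx (V *m Y)).
Proof.
move=> uV uY kK0 kK hH ->; have uK0 := mxK_unit kK0; have uK := mxK_unit kK.
exists (invmx K), H; split=> //; first exact: mxKV.
rewrite (invmxM (A := K0 *m Y)) ?unitmx_mul ?uK0 // (invmxM uK0 uY) (invmxM uV uY).
by rewrite !mulmxA mulmxKV.
Qed.

Section Measure.
Local Open Scope classical_set_scope.
Variables (k : finFieldType) (R : realType) (N : nat).
Variable mu : {measure set (GLborel k N) -> \bar R}.
Hypothesis hmu : normalised_haar mu.

Lemma coset_measurable (g : GL k N) : measurable (coset g : set (GLborel k N)).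
Proof. by apply: sub_sigma_algebra; exact: coset_open. Qed.

Lemma coset1 : coset (1%g : GL k N) = @GL_K k N.
Proof.
apply/seteqP; split=> [x [y Ky <-]|x Kx]; first by rewrite mul1g.
by exists x; rewrite ?mul1g.
Qed.

Lemma measure_coset (g : GL k N) : mu (coset g) = 1%E.
Proof.
case: hmu => inv mK; rewrite -mK; apply: inv.
by rewrite -coset1; exact: coset_measurable.
Qed.

Lemma measure_cosets (T : finType) (P : pred T) (g : T -> GL k N) :
  (forall t t' x, P t -> P t' -> coset (g t) x -> coset (g t') x -> t = t') ->
  let S := \bigcup_(t in [set t | P t]) coset (g t) in
  measurable (S : set (GLborel k N)) /\ mu S = (#|P|%:R)%:E.
Proof.
move=> disj S; have fP : finite_set [set t | P t] by exact: finite_finset.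
split; first by apply: fin_bigcup_measurable => // t _; exact: coset_measurable.
rewrite measure_fin_bigcup //; last first.
- by move=> t _; exact: coset_measurable.
- by move=> t t' Pt Pt' [x [h h']]; exact: disj h h'.
have -> : [set t | P t] = [set` enum P].
  by apply/seteqP; split=> t /=; rewrite mem_enum.
rewrite -fsbig_seq ?enum_uniq // (eq_bigr (fun=> 1%E)); last first.
  by move=> t _; exact: measure_coset.
rewrite cardE; elim: (enum P) => [|t s IH]; first by rewrite big_nil.
by rewrite big_cons IH /= -EFinD -natr1 addrC.
Qed.

End Measure.

(** * The structure constant as a number of cosets *)

Section StructureConstant.
Local Open Scope classical_set_scope.
Variables (k : finFieldType) (R : realType) (m : nat).
Hypothesis k2 : 2%N \notin [pchar k].
Local Notation n := m.+2.
Local Notation L := (laurent_sf k).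
Variable mu : {measure set (GLborel k (n + n)) -> \bar R}.
Hypothesis hmu : normalised_haar mu.

(** The diagonal lists the parts in reverse order, so z^-l is its first entry. *)
Lemma pi_mx_dg (l : nat) :
  pi_mx k (n + n) (rcons (nseq (n + n - 1) 0) (- l%:Z))
  = dg L (pv (lshift n ord0) (- l%:Z)).
Proof.
rewrite /pi_mx /dg; congr diag_mx; apply/rowP => i; rewrite !mxE; congr (_ ^ _).
have iN := ltn_ord i; rewrite nth_rcons size_nseq nth_nseq /pv -val_eqE /=.
have [->|i0] := eqVneq (nat_of_ord i) 0%N; first by rewrite ltnn eqxx.
by rewrite ifT ?if_same //; lia.
Qed.

(** The integrand is the indicator function of a disjoint union of cosets of measure 1, one for each
    parameter with the right orbit. The matrix [K0] from the normal form of Pi^nu is absorbed by the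
    left factor of K pi^mu K. *)
Lemma hconst_card (l : nat) (a : int) (i j : nat) :
  (0 < l)%N -> l%:Z < a - 1 -> (j <= l)%N ->
  hconst mu (rcons (nseq (n + n - 1) 0) (- l%:Z)) (nseq n a ++ nseq n 0)
    ((a + i%:Z) :: nseq m a ++ (a - j%:Z) :: nseq n 0)
  = (#|[pred t : param k l m | [&& par_valid t, par_up t == i & par_down t == j]]|%:R)%:E.
Proof.
move=> l0 la jl; set pi := rcons _ _; set nu := _ ++ _; set lam := _ :: _.
set P := [pred t : param k l m | _].
have lamE : lam = ((a + i%:Z) :: nseq m a ++ [:: a - j%:Z]) ++ nseq n 0.
  by rewrite /lam /= -catA.
have ja : j%:Z < a - 1 by lia.
have a1 : 1 < a by lia.
have [K0 [H0 [kK0 hH0 nuE]]] := Pi_nu_normal_form k2 n a1.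
pose p0 : 'I_(n + n) := lshift n ord0.
pose b := a - 1.
pose V := Theta L n *m Dm 1%:M (dg L (fun=> b)).
have uV : V \in unitmx.
  by rewrite unitmx_mul Theta_unit // Dm_unit ?unitmx1 ?dg_unit.
pose U (t : param k l m) := map_mx (sf_of L) (par_mx t) *m dg L (pv p0 (- l%:Z)).
have uX (t : param k l m) : par_mx t \in unitmx by exact: completion_unit.
have uU t : U t \in unitmx.
  by rewrite unitmx_mul dg_unit andbT; apply: mxK_unit; exact: toF_mxK.
have ug t : K0 *m U t \in unitmx by rewrite unitmx_mul uU mxK_unit.
pose g t : GL k (n + n) := MkGL (ug t).
pose S := \bigcup_(t in [set t | P t]) coset (g t).
have uPi x := GLmx_unit (@Pi_GL k (n + n) x).
have [mS muS] : measurable (S : set (GLborel k (n + n))) /\ mu S = (#|P|%:R)%:E.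
  apply: measure_cosets => // t t' x /and3P[vt _ _] /and3P[vt' _ _].
  move=> /cosetP[K kK xE] /cosetP[K' kK' xE'].
  have eU : U t *m K = U t' *m K'.
    apply: (can_inj (mulKmx (mxK_unit kK0))).
    by rewrite (mulmxA K0 (U t)) (mulmxA K0 (U t')); exact: etrans (esym xE) xE'.
  have eU2 : U t = U t' *m (K' *m invmx K).
    by rewrite mulmxA -eU mulmxK ?mxK_unit.
  have kKK : mxK (K' *m invmx K) by apply: mxKM => //; exact: mxKV.
  have [e [w [ue]]] := coset_unimodular l0 (uX t') (uX t) kKK eU2.
  by rewrite !par_mxE //; exact: par_inj.
have SP x : S x <-> double_coset (@GL_K k (n + n)) (pi_GL k (n + n) pi) (@GL_K k (n + n)) x
    /\ dcos (L := L) (GLmx (x^-1 * Pi_GL k (n + n) nu)%g) (GLmx (Pi_GL k (n + n) lam)).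
  have uK0 := mxK_unit kK0.
  have red (Y K : 'M[L]_(n + n)) : Y \in unitmx -> mxK K ->
      dcos (invmx (K0 *m Y *m K) *m Pi_mx k (n + n) nu) (invmx (V *m Y)).
    by move=> uY kK; exact: dcos_translate uV uY kK0 kK hH0 nuE.
  have lamN := Pi_lambda_normal_form k2 m i ja.
  have tclass t : P t -> dcos (invmx (V *m U t)) (Pi_mx k (n + n) lam).
    move=> /and3P[vt /eqP ti /eqP tj]; rewrite lamE; apply: dcos_trans (dcos_sym lamN).
    by have := par_class l0 L k2 la vt; rewrite ti tj.
  split=> [[t Pt /cosetP[K kK xE]]|[[x1 [x2 [kx1 kx2 xE]]] dx]].
    split; last first.
      apply: dcos_trans (tclass t Pt).
      change (dcos (L := L) (invmx (GLmx x) *m Pi_mx k (n + n) nu) (invmx (V *m U t))).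
      have xE' : GLmx x = K0 *m U t *m K := xE.
      have := red _ _ (uU t) kK.
      by rewrite -xE'.
    have kA : mxK (K0 *m map_mx (sf_of L) (par_mx t)).
      by apply: mxKM => //; exact: toF_mxK.
    exists (MkGL (mxK_unit kA)), (MkGL (mxK_unit kK)); split=> //.
    apply: val_inj; rewrite [LHS]xE.
    change (K0 *m U t *m K = K0 *m map_mx (sf_of L) (par_mx t) *m pi_mx k (n + n) pi *m K).
    by rewrite pi_mx_dg (mulmxA K0).
  (* Conversely, the coset of an arbitrary x is determined by the first column of K0^-1 x1, and
     normalising this column produces the parameter t. *)
  have [X [uXX XE]] : mxK (invmx K0 *m GLmx x1) by apply: mxKM => //; exact: mxKV.
  have [t [e [w [vt ue Xe]]]] := par_exists l0 uXX.
  rewrite -(par_mxE l0 vt) in Xe.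
  have [K kK Keq] := unimodular_coset L (uX t) uXX Xe.
  have xE2 : GLmx x = K0 *m U t *m (K *m GLmx x2).
    rewrite xE mulmxA -(mulmxA K0) -Keq -XE.
    change (GLmx x1 *m pi_mx k (n + n) pi *m GLmx x2
            = K0 *m (invmx K0 *m GLmx x1 *m dg L (pv p0 (- l%:Z))) *m GLmx x2).
    by rewrite pi_mx_dg !mulmxA mulmxV // mul1mx.
  have kKx : mxK (K *m GLmx x2) by apply: mxKM.
  exists t; last by apply/cosetP; exists (K *m GLmx x2).
  have d1 : dcos (invmx (V *m U t)) (Pi_mx k (n + n) lam).
    apply: dcos_trans dx; apply: dcos_sym.
    change (dcos (L := L) (invmx (GLmx x) *m Pi_mx k (n + n) nu) (invmx (V *m U t))).
    by have := red _ _ (uU t) kKx; rewrite -xE2.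
  rewrite lamE in d1.
  (* The orbit determines the exponents, so t has the prescribed invariants. *)
  have d2' := dcos_trans (dcos_sym (par_class l0 L k2 la vt)) (dcos_trans d1 lamN).
  have [] := Xm_inj k2 _ ja d2'.
    by apply: le_lt_trans la; rewrite lez_nat par_down_le.
  by move=> ti tj; rewrite /P /= vt ti tj !eqxx.
rewrite -muS /hconst /convolution -/pi -/nu -/lam.
transitivity (\int[mu]_(y in [set: GLborel k (n + n)]) (\1_S y : R)%:E)%E; last first.
  by rewrite integral_indic // setIT.
apply: eq_integral => y _; congr (_%:E).
rewrite /d_fun /c_fun !indicE -natrM mulnb; congr ((nat_of_bool _)%:R).
apply/idP/idP.
  move=> /andP[]; rewrite !inE => /(double_cosetKH _ _ k2) h1 h2.
  by apply/SP.
rewrite inE => /SP[h1 h2]; apply/andP; rewrite !inE; split=> //.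
exact/(double_cosetKH _ _ k2).
Qed.

End StructureConstant.

(** * Closed formulas and the symmetry between i and j *)

Section Formulas.
Variables (k : finFieldType) (R : realType) (l m : nat).
Hypothesis l0 : (0 < l)%N.
Local Notation q := (#|k|%:R : R).
Local Notation n := m.+2.

Definition pcount (i j : nat) : R :=
  #|[pred t : param k l m | [&& par_valid t, par_up t == i & par_down t == j]]|%:R.

Lemma pcountE i j e (c : R) (f : nat) :
  shift_count k R l m i j + (if (i == l) && (j == 0%N) then q ^+ (l.-1 * n) else 0)
    = q ^+ f * c ->
  e = (l.-1 * m.+1 + f)%N%:Z -> pcount i j = q ^ e * qnum q n * c.
Proof.
move=> sc ->; rewrite /pcount par_total // sc -exprnP exprD.
by rewrite mulrA; congr (_ * _); rewrite mulrAC.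
Qed.

Lemma qnumK d : q ^+ d - 1 = (q - 1) * qnum q d.
Proof.
by rewrite /qnum mulrC divfK // subr_eq0 gt_eqF // q_gt1.
Qed.

Lemma pcount_generic i j : (1 <= i)%N -> (1 <= j)%N -> (i + j < l)%N ->
  (2 %| l - (i + j))%N ->
  pcount i j = q ^ ((l%:Z + i%:Z - 2) * n%:Z - ((l + i + j) %/ 2)%N%:Z + 1)
                 * qnum q n * qnum q m.+1 * (q - 1) ^+ 2.
Proof.
case: i j => [|i] [|j] // _ _ ijl par; have [t lE] : exists t, l = (i.+1 + j.+1 + t.+1.*2)%N.
  by exists ((l - (i.+1 + j.+1)) %/ 2).-1; lia.
rewrite -[RHS]mulrA.
apply: (@pcountE _ _ _ _ (i.+1 + t + i * m.+1)).
  rewrite (shift_count_generic k R m l0 lE) qnumK (_ : _ && _ = false); last by rewrite andbF.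
  by rewrite addr0 !exprD; ring.
have -> : ((l + i.+1 + j.+1) %/ 2 = i.+1 + j.+1 + t.+1)%N by lia.
rewrite lE; lia.
Qed.

Lemma pcount_extreme i j : (1 <= i)%N -> (1 <= j)%N -> (i + j)%N = l ->
  pcount i j = q ^ ((l%:Z + i%:Z - 2) * n%:Z - l%:Z + 2) * qnum q n * qnum q m.+1 * (q - 1).
Proof.
case: i j => [|i] [|j] // _ _ ijl.
rewrite -[RHS]mulrA.
apply: (@pcountE _ _ _ _ (i.+1 + i * m.+1)).
  rewrite (shift_count_extreme k R m l0 (esym ijl)) qnumK (_ : _ && _ = false) ?andbF //.
  by rewrite addr0 !exprD; ring.
rewrite -ijl; lia.
Qed.

Lemma pcount_max_up :
  pcount l 0 = q ^ ((2 * l%:Z - 1) * n%:Z - (l%:Z - 1)) * qnum q n.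
Proof.
rewrite -[RHS]mulr1; apply: (@pcountE _ _ _ _ (l * n)).
  by rewrite (shift_count_max_up k R m l0) !eqxx mulr1 subrK.
case: l l0 => // l' _; lia.
Qed.

Lemma pcount_up i : (i < l)%N -> (2 %| l - i)%N ->
  pcount i 0 = q ^ ((l%:Z + i%:Z - 1) * n%:Z - ((l + i) %/ 2)%N%:Z) * qnum q n * (q - 1).
Proof.
move=> il par; have [t lE] : exists t, l = (i + t.+1.*2)%N.
  by exists ((l - i) %/ 2).-1; lia.
apply: (@pcountE _ _ _ _ (i + t + i * m.+1)).
  rewrite (shift_count_up k R m l0 lE) (ltn_eqF il) addr0 !exprD; ring.
have -> : ((l + i) %/ 2 = i + t.+1)%N by lia.
rewrite lE; lia.
Qed.

Lemma pcount_max_down :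
  pcount 0 l = q ^ ((l%:Z - 1) * n%:Z - (l%:Z - 1)) * qnum q n.
Proof.
rewrite -[RHS]mulr1; apply: (@pcountE _ _ _ _ 0).
  by rewrite (shift_count_max_down k R m l0) eq_sym gtn_eqF // addr0 mulr1.
case: l l0 => // l' _; lia.
Qed.

Lemma pcount_down j : (j < l)%N -> (2 %| l - j)%N ->
  pcount 0 j = q ^ ((l%:Z - 1) * n%:Z - ((l + j) %/ 2)%N%:Z) * qnum q n * (q - 1).
Proof.
move=> jl par; have [t lE] : exists t, l = (j + t.+1.*2)%N.
  by exists ((l - j) %/ 2).-1; lia.
apply: (@pcountE _ _ _ _ t).
  by rewrite (shift_count_down k R m l0 lE) eq_sym gtn_eqF // addr0.
have -> : ((l + j) %/ 2 = j + t.+1)%N by lia.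
rewrite lE; lia.
Qed.

(** Read off from the closed formulas: the half sums in the exponents are symmetric in i and j, so
    only the multiple of n changes. *)
Lemma pcount_swap i j : (i + j <= l)%N -> (2 %| l - (i + j))%N ->
  pcount i j = q ^ ((i%:Z - j%:Z) * n%:Z) * pcount j i.
Proof.
have q0 : q != 0 by rewrite gt_eqF // (lt_trans ltr01) // q_gt1.
have shift e e' (c : R) : e = (i%:Z - j%:Z) * n%:Z + e' ->
    q ^ e * c = q ^ ((i%:Z - j%:Z) * n%:Z) * (q ^ e' * c).
  by move=> ->; rewrite expfzDr // mulrA.
move=> ijl par; have jil : (j + i <= l)%N by rewrite addnC.
have par' : (2 %| l - (j + i))%N by rewrite addnC.
case: (posnP i) => [i0|i0]; case: (posnP j) => [j0|j0].
- by subst i j; rewrite subrr mul0r expr0z mul1r.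
- subst i; have [jl|jl] := eqVneq j l.
    by subst j; rewrite pcount_max_down pcount_max_up; apply: shift; ring.
  rewrite pcount_down ?pcount_up //; try lia.
  by rewrite -!mulrA; apply: shift; ring.
- subst j; have [il|il] := eqVneq i l.
    by subst i; rewrite pcount_max_down pcount_max_up; apply: shift; ring.
  rewrite pcount_down ?pcount_up //; try lia.
  by rewrite -!mulrA; apply: shift; ring.
have [il|il] := eqVneq (i + j)%N l.
  have il' : (j + i)%N = l by rewrite addnC.
  rewrite !pcount_extreme // -!mulrA; apply: shift; ring.
rewrite !pcount_generic //; try lia.
rewrite -!mulrA; apply: shift; rewrite addnAC; ring.
Qed.

End Formulas.

Lemma hconst_pcount (k : finFieldType) (R : realType) (l m N : nat) (a : int)
    (mu : {measure set (GLborel k N) -> \bar R}) (i j : nat) :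
  2%N \notin [pchar k] -> N = (m.+2 + m.+2)%N -> normalised_haar mu ->
  (0 < l)%N -> l%:Z < a - 1 -> (j <= l)%N ->
  hconst mu (rcons (nseq (N - 1) 0) (- l%:Z)) (nseq m.+2 a ++ nseq m.+2 0)
    ((a + i%:Z) :: nseq m a ++ (a - j%:Z) :: nseq m.+2 0)
  = (pcount k R l m i j)%:E.
Proof. by move=> k2 NE hmu l0 la jl; subst N; exact: hconst_card. Qed.

Theorem theorem4p1 (k : finFieldType) (hk : 2%N \notin [pchar k])
    (R : realType) (n : nat) (hn : (2 <= n)%N)
    (m : {measure set (GLborel k (2 * n)) -> \bar R}) (hm : normalised_haar m)
    (l : nat) (hl : (1 <= l)%N) (a : int) (hla : l%:Z < a - 1)
    (i j : nat) (hij : (i + j <= l)%N) (hpar : (2 %| l - (i + j))%N) :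
  let q : R := #|k|%:R in
  let p := pconst m l a in
  [/\ [/\ (1 <= i)%N /\ (1 <= j)%N -> (i + j < l)%N ->
          p i j = (q ^ ((l%:Z + i%:Z - 2) * n%:Z - ((l + i + j) %/ 2)%N%:Z + 1)
                   * qnum q n * qnum q (n - 1) * (q - 1) ^+ 2)%:E
        & (1 <= i)%N /\ (1 <= j)%N -> (i + j)%N = l ->
          p i j = (q ^ ((l%:Z + i%:Z - 2) * n%:Z - l%:Z + 2)
                   * qnum q n * qnum q (n - 1) * (q - 1))%:E],
      [/\ j = 0%N -> i = l ->
          p i j = (q ^ ((2 * l%:Z - 1) * n%:Z - (l%:Z - 1)) * qnum q n)%:E
        & j = 0%N -> (i < l)%N ->
          p i j = (q ^ ((l%:Z + i%:Z - 1) * n%:Z - ((l + i) %/ 2)%N%:Z)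
                   * qnum q n * (q - 1))%:E],
      [/\ i = 0%N -> j = l ->
          p i j = (q ^ ((l%:Z - 1) * n%:Z - (l%:Z - 1)) * qnum q n)%:E
        & i = 0%N -> (j < l)%N ->
          p i j = (q ^ ((l%:Z - 1) * n%:Z - ((l + j) %/ 2)%N%:Z)
                   * qnum q n * (q - 1))%:E],
      i = 0%N /\ j = 0%N ->
          p i j = (q ^ ((l%:Z - 1) * n%:Z - (l %/ 2)%N%:Z)
                   * qnum q n * (q - 1))%:E
    & p i j = ((q ^ ((i%:Z - j%:Z) * n%:Z))%:E * p j i)%E].
Proof.
case: n hn m hm => [|[|m']] // _ m hm q p.
have N2 : (2 * m'.+2 = m'.+2 + m'.+2)%N by rewrite mul2n addnn.
have jl : (j <= l)%N by apply: leq_trans hij; exact: leq_addl.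
have il : (i <= l)%N by apply: leq_trans hij; exact: leq_addr.
have pE i' j' : (j' <= l)%N -> p i' j' = (pcount k R l m' i' j')%:E.
  by move=> jl'; rewrite /p /pconst subSS subSS subn0; exact: hconst_pcount.
rewrite !pE // subSS subn0; split; last by rewrite -EFinM pcount_swap.
- split=> [[i1 j1] ijl|[i1 j1] ijl]; first by rewrite pcount_generic.
  by rewrite pcount_extreme.
- split=> [-> ->|j0 il']; first by rewrite pcount_max_up.
  by move: hpar; rewrite j0 addn0 => hpar'; rewrite pcount_up.
- split=> [-> ->|i0 jl']; first by rewrite pcount_max_down.
  by move: hpar; rewrite i0 add0n => hpar'; rewrite pcount_down.
(* As l > 0, this is the formula for i = 0 and j < l, taken at j = 0. *)
- by move=> [i0 j0]; move: hpar; rewrite i0 j0 subn0 => hpar'; rewrite pcount_down ?subn0 ?addn0.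
Qed.
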